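(* Let $\pi\in\mathbb{C}[z_1,z_2,z_3]$ be the polynomial $$\pi(z)=1-z_1^2-z_2^2-z_3^2+\tfrac{1}{13}\,(z_2^2-z_1^3)^2 .$$ Then $\pi$ is stable, $\dim_{\mathbb{R}}(\mathcal{Z}(\pi)\cap\mathbb{S}_3)=1$, and, for a Nash stratification $\mathcal{Z}(\pi)\cap\mathbb{S}_3=\bigcup_i M_i$, the set $\mathcal{Z}(\pi)\cap\mathbb{S}_3$ has a weak essential singularity at the point $\alpha=(0,0,1)$ (with respect to some component $M_i$ with $\alpha\in\overline{M_i}\setminus M_i$), while $\alpha$ is not an essential singularity of $\mathcal{Z}(\pi)\cap\mathbb{S}_3$.
   Context: Notation (with $n=3$, $p=\pi$): $\langle z,w\rangle=\sum_j z_j\overline{w_j}$ and $\|z\|=\sqrt{\langle z,z\rangle}$ on $\mathbb{C}^n$; $\mathbb{B}_n=\{\|z\|<1\}$, $\mathbb{S}_n=\{\|z\|=1\}$; $\mathcal{Z}(p)$ is the zero set of $p$ in $\mathbb{C}^n$. A polynomial $p$ is stable if $\mathcal{Z}(p)\cap\mathbb{B}_n=\emptyset$. For $E\subset\mathbb{C}^n=\mathbb{R}^{2n}$, $\dim_{\mathbb{R}}E$ is the maximal dimension of a real submanifold of $\mathbb{R}^{2n}$ contained in $E$. Semi-algebraic notions: a map between semi-algebraic sets is semi-algebraic if its graph is. A Nash function/map is a semi-algebraic map of class $C^\infty$ (it is then real analytic); a Nash diffeomorphism is a bijection which is Nash together with its inverse. A Nash submanifold of $\mathbb{R}^N$ of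 dimension $d$ is a semi-algebraic set $M$ such that each $x\in M$ admits a Nash diffeomorphism $\phi$ from an open semi-algebraic neighborhood $\Omega$ of $0$ in $\mathbb{R}^N$ onto an open semi-algebraic neighborhood $\Omega'$ of $x$ with $\phi(0)=x$ and $\phi((\mathbb{R}^d\times\{0\})\cap\Omega)=M\cap\Omega'$. Complex tangential: a $C^1$ curve $\gamma$ in $\mathbb{S}_n$ is complex tangential if $\langle\gamma'(t),\gamma(t)\rangle=0$ for all $t$; a submanifold $N\subset\mathbb{S}_n$ is complex tangential if $\langle w,\zeta\rangle=0$ for all $\zeta\in N$ and $w\in T_\zeta N$; a map $\Phi$ from an open subset of $\mathbb{R}^m$ into $\mathbb{S}_n$ is complex tangential if $\langle\Phi'(x)h,\Phi(x)\rangle=0$ for all $x$ and $h\in\mathbb{R}^m$. Nash stratification of $\mathcal{Z}(p)\cap\mathbb{S}_n$ (one-dimensional case): a finite partition $\{M_i\}_i$ of $\mathcal{Z}(p)\cap\mathbb{S}_n$ such that $M_i\cap\overline{M_j}\ne\emptyset$, $i\neq j$, implies $M_i\subset\overline{M_j}$; each $M_i$ is a Nash submanifold contained in $\mathbb{S}_n$ which is the image of $(-1,1)^{\dim_{\mathbb{R}}M_i}$, $\dim_{\mathbb{R}}M_i\in\{0,1\}$, under a complex tangential Nash diffeomorphism; and $\overline{M_i}\setminus M_i$ consists of exactly two distinct points for each one-dimensional $M_i$. Admissible curves: for $\alpha\in\overline{M_i}\setminus M_i$, call a real analytic map $\gamma_\alpha:(-\epsilon,\epsilon)\to\mathcal{Z}(p)\cap\mathbb{S}_n$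 ($\epsilon>0$) admissible for $(\alpha,M_i)$ if it is a homeomorphism onto its image and: (i) $\gamma_\alpha((0,\epsilon))\subset M_i$, $\gamma_\alpha(0)=\alpha$; (ii) $\gamma_\alpha'(t)\ne0$ for all $t\neq0$; (iii) there is a unique $k$ with $\gamma_\alpha((-\epsilon,0))\subset M_k$; (iv) there is $\delta_0>0$ such that for all $0<\delta<\delta_0$ the set $\gamma_\alpha((-\epsilon,\epsilon))\cap\{\|z-\alpha\|<\delta\}$ with $\alpha$ removed has exactly two connected components, meeting at $\alpha$ (both have $\alpha$ in their closure); (v) $\gamma_\alpha$ is complex tangential; (vi) after a unitary change of coordinates taking $\alpha$ to $(0,\dots,0,1)$, there are an integer $\nu>1$ and $b_\nu^1,\dots,b_\nu^{n-1}\in\mathbb{C}$, not all zero, such that with $a=-\frac12\sum_{j}|b_\nu^j|^2$ one has $\gamma_\alpha(t)=(b_\nu^1t^\nu+o(t^\nu),\dots,b_\nu^{n-1}t^\nu+o(t^\nu),1+at^{2\nu}+o(t^{2\nu}))$. Singularities: $\alpha\in\overline{M_i}\setminus M_i$ is regular (respectively strong regular) with respect to $M_i$ if there exist an admissible $\gamma_\alpha$ for $(\alpha,M_i)$ and a $C^\infty$ complex tangential submanifold $N$ (respectively a one-dimensional $C^\infty$ complex tangential submanifold $N$) lying in $\mathbb{S}_n$ with $\gamma_\alpha([0,\epsilon))\subset N$. $\mathcal{Z}(p)\cap\mathbb{S}_n$ has an essential singularity (respectively weak essential singularity) at $\alpha\in\overline{M_i}\setminus M_i$ if $\alpha$ is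 not regular (respectively not strong regular) with respect to $M_i$. *)

(* Defs.v *)
From HB Require Import structures.
From mathcomp Require Import all_boot all_order all_algebra.
From mathcomp Require Import complex spectral.
From mathcomp Require Import all_classical all_reals all_analysis.
From mathcomp Require Import -(notations) mpoly.

Set Implicit Arguments.
Unset Strict Implicit.
Unset Printing Implicit Defensive.
Import Order.TTheory GRing.Theory Num.Theory.
Import numFieldNormedType.Exports.
Local Open Scope classical_set_scope.
Local Open Scope ring_scope.
Local Open Scope complex_scope.

Notation mvar i := (mpolyX _ (mnm1 i)).
Notation mevalrow p x := (meval (fun i => x 0%R i) p).

Section SemiAlgebraic.
Context {R : realType}.

(* The Boolean algebra of sets generated by the sets {P > 0}. *)
Inductive semialg (N : nat) : set 'rV[R]_N -> Prop :=
| semialg_pos (P : mpoly N R) : semialg [set x : 'rV[R]_N | 0 < mevalrow P x]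
| semialg_setI A B : semialg A -> semialg B -> semialg (A `&` B)
| semialg_setU A B : semialg A -> semialg B -> semialg (A `|` B)
| semialg_setC A : semialg A -> semialg (~` A).

Definition semialg_map (m k : nat) (A : set 'rV[R]_m) (B : set 'rV[R]_k)
    (f : 'rV[R]_m -> 'rV[R]_k) : Prop :=
  [/\ semialg A, semialg B, (forall x, A x -> B (f x)) &
      semialg [set row_mx x (f x) | x in A]].

End SemiAlgebraic.

Section Smooth.
Context {R : realType}.

(* Class C^k on an open set U.  The domain V is always finite-dimensional     *)
(* below, so that f is C^(k+1) iff it is differentiable and x |-> f'(x) v is  *)
(* C^k for every v.                                                           *)
Fixpoint Ck {V W : normedModType R} (k : nat) (U : set V) (f : V -> W) : Prop :=
  if k is k'.+1 then
    (forall x, U x -> differentiable f x) /\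
    (forall v, Ck k' U (fun x => 'd f x v))
  else forall x, U x -> {for x, continuous f}.

(* C^oo on an arbitrary set A: f agrees near each point of A with a map that  *)
(* is C^oo on an open set.  For A open this is the usual notion, and for A a  *)
(* submanifold it amounts to being C^oo in charts.                            *)
Definition smooth_on {V W : normedModType R} (A : set V) (f : V -> W) : Prop :=
  forall x, A x -> exists (U : set V) (g : V -> W),
    [/\ open U, U x, (forall k, Ck k U g) & forall y, A y -> U y -> f y = g y].

Definition analytic_on {W : normedModType R} (A : set R) (f : R -> W) : Prop :=
  forall t0, A t0 -> exists (c : nat -> W) (r : R), 0 < r /\
    forall t, `|t - t0| < r ->
      (fun m : nat => \sum_(k < m) (t - t0) ^+ k *: c k) @ \oo --> f t.

Definition smooth_diffeo {V W : normedModType R} (A : set V) (B : set W)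
    (f : V -> W) : Prop :=
  [/\ set_bij A B f, smooth_on A f &
      exists g : W -> V, smooth_on B g /\ (forall x, A x -> g (f x) = x)].

Definition nash_map (m k : nat) (A : set 'rV[R]_m) (B : set 'rV[R]_k)
    (f : 'rV[R]_m -> 'rV[R]_k) : Prop :=
  semialg_map A B f /\ smooth_on A f.

Definition nash_diffeo (m k : nat) (A : set 'rV[R]_m) (B : set 'rV[R]_k)
    (f : 'rV[R]_m -> 'rV[R]_k) : Prop :=
  [/\ set_bij A B f, nash_map A B f &
      exists g, nash_map B A g /\ (forall x, A x -> g (f x) = x)].

(* R^d x {0} in R^N *)
Definition flat (N d : nat) : set 'rV[R]_N :=
  [set u : 'rV[R]_N | forall j : 'I_N, (d <= j)%N -> u 0 j = 0].

Definition charted (N : nat)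
    (diffeo : set 'rV[R]_N -> set 'rV[R]_N -> ('rV[R]_N -> 'rV[R]_N) -> Prop)
    (d : nat) (M : set 'rV[R]_N) : Prop :=
  (d <= N)%N /\
  forall x, M x -> exists (O O' : set 'rV[R]_N) (phi : 'rV[R]_N -> 'rV[R]_N),
    [/\ open O /\ O 0, open O' /\ O' x, diffeo O O' phi, phi 0 = x &
        phi @` (flat d `&` O) = M `&` O'].

Definition smooth_submanifold (N d : nat) (M : set 'rV[R]_N) : Prop :=
  charted smooth_diffeo d M.

Definition nash_submanifold (N d : nat) (M : set 'rV[R]_N) : Prop :=
  semialg M /\ charted (@nash_diffeo N N) d M.

(* dim_R E = d.  Nonemptiness is needed because the empty set is a            *)
(* submanifold of every dimension.                                            *)
Definition has_dimR (N : nat) (E : set 'rV[R]_N) (d : nat) : Prop :=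
  (exists M, [/\ smooth_submanifold d M, M !=set0 & M `<=` E]) /\
  (forall d' M, smooth_submanifold d' M -> M !=set0 -> M `<=` E -> (d' <= d)%N).

(* w is the velocity at x of a smooth curve drawn on M. *)
Definition tangent (N : nat) (M : set 'rV[R]_N) (x w : 'rV[R]_N) : Prop :=
  exists (e : R) (c : R -> 'rV[R]_N),
    [/\ 0 < e, smooth_on `]- e, e[%classic c, c @` `]- e, e[ `<=` M,
        c 0 = x & derive1 c 0 = w].

(* (-1, 1)^m *)
Definition cube (m : nat) : set 'rV[R]_m := 
  [set u : 'rV[R]_m | forall j, -1 < u 0 j < 1].

Definition homeo_onto_image {V W : topologicalType} (A : set V) (f : V -> W)
    : Prop :=
  {within A, continuous f} /\
  exists g : W -> V,
    {within f @` A, continuous g} /\ (forall x, A x -> g (f x) = x).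

End Smooth.

Section ComplexSpace.
Context {R : realType}.

(* C^n = R^(2n), with (x, y) in R^n x R^n identified with x + iy              *)
Definition toC (n : nat) (x : 'rV[R]_(n + n)) : 'rV[R[i]]_n :=
  \row_j (x 0 (lshift n j) +i* x 0 (rshift n j)).

Definition toR (n : nat) (z : 'rV[R[i]]_n) : 'rV[R]_(n + n) :=
  row_mx (\row_j complex.Re (z 0 j)) (\row_j complex.Im (z 0 j)).

Lemma toRK (n : nat) : cancel (@toR n) (@toC n).
Proof.
move=> z; apply/rowP => j; rewrite mxE /toR row_mxEl row_mxEr !mxE.
by case: (z 0 j).
Qed.

Lemma toCK (n : nat) : cancel (@toC n) (@toR n).
Proof.
move=> x; rewrite -[RHS]hsubmxK; congr row_mx; apply/rowP => j; by rewrite !mxE.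
Qed.

Definition herm (n : nat) (z w : 'rV[R[i]]_n) : R[i] :=
  \sum_j z 0 j * (w 0 j)^*%C.

Definition hnorm (n : nat) (z : 'rV[R[i]]_n) : R :=
  Num.sqrt (complex.Re (herm z z)).

Definition cball (n : nat) : set 'rV[R[i]]_n := [set z : 'rV[R[i]]_n | hnorm z < 1].

Definition csphere (n : nat) : set 'rV[R[i]]_n := [set z : 'rV[R[i]]_n | hnorm z = 1].

Definition zeros (n : nat) (p : mpoly n R[i]) : set 'rV[R[i]]_n :=
  [set z : 'rV[R[i]]_n | mevalrow p z = 0].

Definition stable (n : nat) (p : mpoly n R[i]) : Prop :=
  zeros p `&` @cball n = set0.

Definition rsphere (n : nat) : set 'rV[R]_(n + n) := @toC n @^-1` @csphere n.

Definition zsphere (n : nat) (p : mpoly n R[i]) : set 'rV[R]_(n + n) :=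
  @toC n @^-1` (zeros p `&` @csphere n).

Definition ct_map (m n : nat) (A : set 'rV[R]_m)
    (f : 'rV[R]_m -> 'rV[R]_(n + n)) : Prop :=
  forall x h, A x -> herm (toC ('d f x h)) (toC (f x)) = 0.

Definition ct_curve (n : nat) (A : set R) (c : R -> 'rV[R]_(n + n)) : Prop :=
  forall t, A t -> herm (toC (derive1 c t)) (toC (c t)) = 0.

Definition ct_submanifold (n d : nat) (N : set 'rV[R]_(n + n)) : Prop :=
  [/\ smooth_submanifold d N, N `<=` @rsphere n &
      forall x w, N x -> tangent N x w -> herm (toC w) (toC x) = 0].

(* d is the dimension of M i, which is determined by M i because M i is       *)
(* nonempty, being the image of a cube.                                       *)
Definition nash_stratification (n : nat) (X : set 'rV[R]_(n + n))
    (I : finType) (M : I -> set 'rV[R]_(n + n)) : Prop :=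
  [/\ \bigcup_i M i = X,
      trivIset setT M,
      (forall i j, i != j ->
         M i `&` closure (M j) !=set0 -> M i `<=` closure (M j)) &
      forall i, exists d : nat,
        [/\ (d <= 1)%N, nash_submanifold d (M i), M i `<=` @rsphere n,
            (exists f, nash_diffeo (@cube R d) (M i) f /\ ct_map (@cube R d) f) &
            d = 1%N -> exists a b : 'rV[R]_(n + n),
              a != b /\ closure (M i) `\` M i = [set a; b]]].

(* c(t) = (b_1 t^nu + o(t^nu), ..., b_n t^nu + o(t^nu),                       *)
(*         1 + a t^(2 nu) + o(t^(2 nu)))                                      *)
Definition ct_expansion (n : nat) (c : R -> 'rV[R[i]]_n.+1) : Prop :=
  exists (nu : nat) (b : 'rV[R[i]]_n),
    let a : R := - 2^-1 * \sum_j Normc.normc (b 0 j) ^+ 2 in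
    [/\ (1 < nu)%N, b != 0,
        (forall j : 'I_n,
           (fun t : R => Normc.normc
              (c t 0 (lift ord_max j) - b 0 j * (t ^+ nu)%:C)) =o_ (0 : R)
           (fun t : R => t ^+ nu)) &
        (fun t : R => Normc.normc
           (c t 0 ord_max - (1 + a * t ^+ (2 * nu))%:C)) =o_ (0 : R)
        (fun t : R => t ^+ (2 * nu))].

Definition two_branches (n : nat) (E : set 'rV[R]_(n + n))
    (alpha : 'rV[R]_(n + n)) : Prop :=
  exists C1 C2 : set 'rV[R]_(n + n),
    [/\ C1 <> C2, [set connected_component E x | x in E] = [set C1; C2],
        closure C1 alpha & closure C2 alpha].

Definition admissible (n : nat) (X : set 'rV[R]_(n.+1 + n.+1)) (I : finType)
    (M : I -> set 'rV[R]_(n.+1 + n.+1)) (i : I) (alpha : 'rV[R]_(n.+1 + n.+1))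
    (e : R) (c : R -> 'rV[R]_(n.+1 + n.+1)) : Prop :=
  let J := `]- e, e[%classic in
  [/\ 0 < e, c @` J `<=` X, analytic_on J c & homeo_onto_image J c] /\
  [/\ c @` `]0, e[ `<=` M i /\ c 0 = alpha,
      (forall t : R, J t -> t != 0 -> derive1 c t != 0) &
      (exists! k : I, c @` `]- e, 0[ `<=` M k)] /\
  [/\ (exists delta0 : R, 0 < delta0 /\
         forall delta : R, 0 < delta < delta0 ->
           two_branches
             ((c @` J `&` [set x : 'rV[R]_(n.+1 + n.+1) |
                             hnorm (toC (x - alpha)) < delta]) `\ alpha)
             alpha),
      ct_curve J c &
      (exists U : 'M[R[i]]_n.+1,
         [/\ U \is unitarymx, toC alpha *m U = delta_mx 0 ord_max &
             ct_expansion (fun t => toC (c t) *m U)])].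

Definition frontier_pt (n : nat) (I : finType) (M : I -> set 'rV[R]_(n + n))
    (i : I) (alpha : 'rV[R]_(n + n)) : Prop :=
  (closure (M i) `\` M i) alpha.

Definition regular_wrt (n : nat) (X : set 'rV[R]_(n.+1 + n.+1)) (I : finType)
    (M : I -> set 'rV[R]_(n.+1 + n.+1)) (i : I) (alpha : 'rV[R]_(n.+1 + n.+1))
    : Prop :=
  exists (e : R) (c : R -> 'rV[R]_(n.+1 + n.+1)), admissible X M i alpha e c /\
  exists (d : nat) (N : set 'rV[R]_(n.+1 + n.+1)),
    @ct_submanifold n.+1 d N /\ c @` `[0, e[ `<=` N.

Definition strong_regular_wrt (n : nat) (X : set 'rV[R]_(n.+1 + n.+1))
    (I : finType) (M : I -> set 'rV[R]_(n.+1 + n.+1)) (i : I)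
    (alpha : 'rV[R]_(n.+1 + n.+1)) : Prop :=
  exists (e : R) (c : R -> 'rV[R]_(n.+1 + n.+1)), admissible X M i alpha e c /\
  exists N : set 'rV[R]_(n.+1 + n.+1),
    @ct_submanifold n.+1 1 N /\ c @` `[0, e[ `<=` N.

Definition essential_sing_wrt (n : nat) (X : set 'rV[R]_(n.+1 + n.+1))
    (I : finType) (M : I -> set 'rV[R]_(n.+1 + n.+1)) (i : I)
    (alpha : 'rV[R]_(n.+1 + n.+1)) : Prop :=
  frontier_pt M i alpha /\ ~ regular_wrt X M i alpha.

Definition weak_essential_sing_wrt (n : nat) (X : set 'rV[R]_(n.+1 + n.+1))
    (I : finType) (M : I -> set 'rV[R]_(n.+1 + n.+1)) (i : I)
    (alpha : 'rV[R]_(n.+1 + n.+1)) : Prop :=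
  frontier_pt M i alpha /\ ~ strong_regular_wrt X M i alpha.

(* The indices 0, 1, 2 : 'I_3 stand for the variables z1, z2, z3. *)
Definition pi_poly : mpoly 3 R[i] :=
  let z1 : mpoly 3 R[i] := mvar (0 : 'I_3) in
  let z2 : mpoly 3 R[i] := mvar (1 : 'I_3) in
  let z3 : mpoly 3 R[i] := mvar (2 : 'I_3) in
  1 - z1 ^+ 2 - z2 ^+ 2 - z3 ^+ 2 + (13%:R)^-1 *: (z2 ^+ 2 - z1 ^+ 3) ^+ 2.

(* (0, 0, 1) *)
Definition alpha3 : 'rV[R]_(3 + 3) := toR (delta_mx 0 ord_max : 'rV[R[i]]_3).

End ComplexSpace.

(* Main.v *)
Require Import Defs.
From mathcomp Require Import all_boot all_order all_fingroup all_algebra.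
From mathcomp Require Import complex spectral.
From mathcomp Require Import all_classical all_reals all_analysis.
From mathcomp Require Import -(notations) mpoly.
From mathcomp Require Import ring lra zify.

Set Implicit Arguments.
Unset Strict Implicit.
Unset Printing Implicit Defensive.
Import Order.TTheory GRing.Theory Num.Theory.
Import numFieldNormedType.Exports.
Local Open Scope classical_set_scope.
Local Open Scope ring_scope.
Local Open Scope complex_scope.

(** Let q = z_2^2 - z_1^3 and let y be the imaginary part of z. In the closed
    ball the real part of the equation of the zero set reads
    13 (1 - |z|^2) + 26 |y|^2 + (Re q)^2 = (Im q)^2, and (Im q)^2 <= 9 |y|^2
    because Im q vanishes with y. Hence there is no zero in the open ball, and
    on the sphere the zero set is the real curve y = 0, |x| = 1, x_2^2 = x_1^3
    (pi_ball_bound, zsphere_piP). This curve is a circle with two ordinary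
    cusps, at (0, 0, 1) and (0, 0, -1). Being contained in the real unit
    sphere S^2, it is complex tangential wherever it is smooth, and so is S^2
    itself (real_sphere_ct).

    Dimension. The second coordinate is at most two-to-one on the curve
    (zsphere_three), whereas a continuous function on a square takes some
    value three times (square_three_points); so no surface fits in the curve.
    The arcs have dimension one.

    Stratification. The strata are the two cusps and the two arcs x_2 > 0 and
    x_2 < 0. Each arc is the graph over the height x_3 in (-1, 1) of a Nash
    function, the positive root s of s^4 + s^6 = 1 - x_3^2 giving x_1 = s^2
    and x_2 = s^3 or - s^3; graphs are Nash submanifolds with Nash charts and
    parametrizations (nash_coord_graph, coord_graph_param).

    Weak essential singularity. A smooth one-dimensional submanifold through
    a cusp meets the curve near the cusp in the cusp alone
    (pole_not_accumulation): comparing orders in x_2^2 = x_1^3 and in the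
    other equations, a smooth curve with nonzero velocity cannot satisfy
    them at parameters tending to 0. So no one-dimensional submanifold
    contains a half-branch, and for any stratification the cusp belongs to no
    stratum of dimension one.

    Regularity. The strata of an arbitrary stratification are semi-algebraic,
    so each contains or misses the germ of each half of the cusp
    (semialg_decided). A stratum with the cusp in its frontier thus contains
    one half of t |-> (t^2, sg t^3, sqrt (1 - t^4 - t^6)) with sg = 1 or -1,
    and this parametrization is admissible; its analyticity comes from the
    power series of the square root of a polynomial (sqrt_poly_series). The
    half-curve lies in the upper half of S^2, a complex tangential surface
    (ct_upper_cap). *)

(** * Smooth maps between normed spaces *)

Section Ck_calculus.
Context {R : realType}.

Lemma row_cvg {T : Type} n (F : set_system T) {FF : Filter F}
    (f : T -> 'rV[R]_n) (l : 'rV[R]_n) :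
  (forall j, (fun x => f x 0 j) @ F --> l 0 j) -> f @ F --> l.
Proof.
move=> H; apply/cvgrPdist_le => /= e e0; near=> x.
rewrite [leLHS]/Num.Def.normr/= mx_normrE (bigmax_le _ (ltW e0))//= => i _.
rewrite !mxE/= !ord1; move: i; near: x; apply: filter_forall => /= i.
exact: ((cvgrPdist_le _ _).1 (H i.2)).
Unshelve. all: by end_near. Qed.

(** Differentials are germs: this is what lets a map that is smooth on a set,
    hence only locally equal to smooth maps, be differentiated. *)
Lemma near_eq_is_diff {V W : normedModType R} (f g : V -> W) (x : V) :
  {near x, f =1 g} -> differentiable f x -> is_diff x g ('d f x).
Proof.
move=> fg df.
have Hs : \forall h \near (0 : V), f (h + x) = g (h + x).
  by move: fg; rewrite (near_shift 0 x) subr0.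
have Hg : g \o shift x = cst (g x) + 'd f x +o_ 0 id.
  apply/eqaddoP => e e0.
  have /eqaddoP/(_ e e0) := diff_locally df.
  rewrite -(nbhs_singleton fg) => Hf.
  near=> h; rewrite /= !fctE /= -(near Hs h)//.
  by near: h; apply: filterS Hf => h.
have dE : 'd g x = 'd f x :> (V -> W).
  by apply: diff_unique => //; exact: diff_continuous.
apply: DiffDef => //; apply/diff_locallyP; rewrite dE; split => //.
exact: diff_continuous.
Unshelve. all: by end_near. Qed.

Lemma Ck_ext {V W : normedModType R} k (U : set V) (f g : V -> W) :
  open U -> (forall x, U x -> f x = g x) -> Ck k U f -> Ck k U g.
Proof.
move=> oU; elim: k f g => [|k IH] f g fg /=.
  move=> fc x Ux; have nfg : {near x, f =1 g}.
    by near do apply: fg; exact: open_nbhs_nbhs.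
  have : g y @[y --> x] --> f x.
    by apply: cvg_trans (fc x Ux); exact: near_eq_cvg.
  by rewrite fg.
move=> [df dk]; have D x : U x -> is_diff x g ('d f x).
  move=> Ux; apply: near_eq_is_diff; last exact: df.
  by near do apply: fg; exact: open_nbhs_nbhs.
split=> [x /D[]//|v]; apply: IH (dk v) => x Ux.
by have [_ e] := D x Ux; exact: (congr1 (fun h : V -> W => h v) (esym e)).
Unshelve. all: by end_near. Qed.

Lemma Ck_sub {V W : normedModType R} k (U U' : set V) (f : V -> W) :
  U' `<=` U -> Ck k U f -> Ck k U' f.
Proof.
move=> sU; elim: k f => [|k IH] f /=; first by move=> fc x /sU; exact: fc.
by move=> [df dk]; split=> [x /sU|v]; [exact: df | exact: IH].
Qed.

Lemma Ck_pred {V W : normedModType R} k (U : set V) (f : V -> W) :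
  Ck k.+1 U f -> Ck k U f.
Proof.
elim: k f => [|k IH] f /=.
  by move=> [df _] x Ux; apply: differentiable_continuous; exact: df.
by move=> [df dk]; split=> // v; apply: IH; have [] := dk v.
Qed.

Lemma Ck_continuous {V W : normedModType R} k (U : set V) (f : V -> W) x :
  Ck k U f -> U x -> {for x, continuous f}.
Proof. by elim: k => [|k IH]; [exact|move/Ck_pred]. Qed.

Lemma Ck_cst {V W : normedModType R} k (U : set V) (a : W) : Ck k U (fun=> a).
Proof.
elim: k a => [|k IH] a /=; first by move=> x _; exact: cst_continuous.
split=> [x _|v]; first exact: differentiable_cst.
rewrite (_ : (fun x => _) = (fun=> 0)) //.
by apply/funext => x; have [_ /= ->] := @is_diff_cst _ V W a x.
Qed.

Lemma CkD {V W : normedModType R} k (U : set V) (f g : V -> W) : open U ->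
  Ck k U f -> Ck k U g -> Ck k U (fun x => f x + g x).
Proof.
move=> oU; elim: k f g => [|k IH] f g /=.
  by move=> fc gc x Ux; apply: continuousD; [exact: fc|exact: gc].
move=> [df dkf] [dg dkg]; split=> [x Ux|v].
  by apply: differentiableD; [exact: df|exact: dg].
apply: (Ck_ext oU _ (IH _ _ (dkf v) (dkg v))) => x Ux.
exact/esym/(congr1 (fun h : V -> W => h v) (diffD (df x Ux) (dg x Ux))).
Qed.

Lemma CkM {V : normedModType R} k (U : set V) (f g : V -> R) : open U ->
  Ck k U f -> Ck k U g -> Ck k U (fun x => f x * g x).
Proof.
move=> oU; elim: k f g => [|k IH] f g.
  by move=> fc gc x Ux; apply: continuousM; [exact: fc|exact: gc].
move=> fk gk; have := (fk, gk) => /= -[[df dkf] [dg dkg]]; split=> [x Ux|v].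
  by apply: differentiableM; [exact: df|exact: dg].
have := CkD oU (IH _ _ (Ck_pred fk) (dkg v)) (IH _ _ (Ck_pred gk) (dkf v)).
apply: Ck_ext => // x Ux.
exact/esym/(congr1 (fun h : V -> R => h v) (diffM (df x Ux) (dg x Ux))).
Qed.

Lemma CkX {V : normedModType R} k (U : set V) (f : V -> R) n : open U ->
  Ck k U f -> Ck k U (fun x => f x ^+ n).
Proof.
move=> oU fk; elim: n => [|n IH].
  by rewrite (_ : (fun x => _) = (fun=> 1)) //; exact: Ck_cst.
rewrite (_ : (fun x => _) = (fun x => f x * f x ^+ n)); first exact: CkM.
by apply/funext => x; rewrite exprS.
Qed.

Lemma CkN {V : normedModType R} k (U : set V) (f : V -> R) : open U ->
  Ck k U f -> Ck k U (fun x => - f x).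
Proof.
move=> oU fk; have := CkM oU (Ck_cst k U (-1 : R)) fk.
by apply: Ck_ext => // x _; rewrite mulN1r.
Qed.

Lemma CkV {V : normedModType R} k (U : set V) (f : V -> R) : open U ->
  (forall x, U x -> f x != 0) -> Ck k U f -> Ck k U (fun x => (f x)^-1).
Proof.
move=> oU f0; elim: k f f0 => [|k IH] f f0.
  by move=> fc x Ux; apply: continuousV; [exact: f0|exact: fc].
move=> fk; have := fk => /= -[df dk]; split=> [x Ux|v].
  by apply: differentiableV; [exact: df|exact: f0].
have := CkM oU (CkN oU (CkX 2 oU (IH f f0 (Ck_pred fk)))) (dk v).
apply: Ck_ext => // x Ux.
apply/esym; rewrite exprVn.
exact: (congr1 (fun h : V -> R => h v) (diffV (df x Ux) (f0 x Ux))).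
Qed.

Lemma row_differentiable {V : normedModType R} n (f : V -> 'rV[R]_n) (x : V) :
  (forall j, differentiable (fun y => f y 0 j) x) -> differentiable f x.
Proof.
move=> H; have := @differentiable_sum _ _ _ n
  (fun j y => f y 0 j *: (delta_mx 0 j : 'rV[R]_n)) x.
rewrite (_ : \sum_(_ < _) _ = f); first by apply=> j; exact: differentiableZl.
by apply/funext => y; rewrite fct_sumE -row_sum_delta.
Qed.

Lemma coord_is_diff {V : normedModType R} n (f : V -> 'rV[R]_n) (x : V) j :
  differentiable f x -> is_diff x (fun y => f y 0 j) (fun v => 'd f x v 0 j).
Proof.
move=> df.
have @c : {linear 'rV[R]_n -> R}.
  by exists (fun N : 'rV[R]_n => N 0 j); do 2![eexists]; do ?[constructor];
     rewrite ?mxE// => ? *; rewrite ?mxE//; move=> ?; rewrite !mxE.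
have cc : continuous c by exact: coord_continuous.
have H : differentiable c (f x) by exact: linear_differentiable.
rewrite (_ : (fun y => f y 0 j) = c \o f) //.
apply: DiffDef; first exact: differentiable_comp.
by rewrite diff_comp // diff_lin.
Qed.

Lemma Ck_row {V : normedModType R} n k (U : set V) (f : V -> 'rV[R]_n) :
  open U -> (forall j, Ck k U (fun x => f x 0 j)) -> Ck k U f.
Proof.
move=> oU; elim: k f => [|k IH] f H.
  by move=> x Ux; apply: row_cvg => j; exact: H.
have D x : U x -> differentiable f x.
  by move=> Ux; apply: row_differentiable => j; have [+ _] := H j; exact.
split=> // v; apply: IH => j; have [_ /(_ v)] := H j.
by apply: Ck_ext => // x /D/(@coord_is_diff _ _ _ _ j)[_ ->].
Qed.

Lemma Ck_coord m k (U : set 'rV[R]_m) j : Ck k U (fun x => x 0 j).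
Proof.
case: k => [|k] /=; first by move=> x _; exact: coord_continuous.
split=> [x _|v]; first exact: differentiable_coord.
rewrite (_ : (fun x => _) = (fun=> v 0 j)); first exact: Ck_cst.
apply/funext => x; have D := @is_diff_id _ _ x.
have [dx e] := D; have [_ e'] := coord_is_diff j dx.
apply: etrans (congr1 (fun h : 'rV[R]_m -> R => h v) e') _.
exact: (congr1 (fun h : 'rV[R]_m -> 'rV[R]_m => h v 0 j) e).
Qed.

(** A function whose differential is as smooth as the function itself is
    smooth of every order. It is the way to treat functions given by an
    equation, such as roots, whose derivative is an expression in the
    function. *)
Lemma Ck_bootstrap {V : normedModType R} k (U : set V) (f : V -> R)
    (df : V -> V -> R) : open U ->
  (forall x, U x -> is_diff x f (df x)) ->
  (forall k, Ck k U f -> forall v, Ck k U (fun x => df x v)) ->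
  Ck k U f.
Proof.
move=> oU fD H; elim: k => [|k IH].
  by move=> x /fD[df0 _]; exact: differentiable_continuous.
split=> [x /fD[]//|v]; apply: Ck_ext (H k IH v) => // x /fD[_].
by move=> ->.
Qed.

End Ck_calculus.

(** * Polynomial maps and semi-algebraic sets *)

Section Affine.
Context {R : realType}.

Lemma row_is_diff {V : normedModType R} n (f : V -> 'rV[R]_n) (x : V)
    (df : 'I_n -> V -> R) :
  (forall j, is_diff x (fun y => f y 0 j) (df j)) ->
  is_diff x f (fun v => \row_j df j v).
Proof.
move=> H; have fx : differentiable f x.
  by apply: row_differentiable => j; case: (H j).
apply: DiffDef => //; apply/funext => v; apply/rowP => j; rewrite mxE.
have [_ e1] := H j; have [_ e2] := coord_is_diff j fx.
exact: (congr1 (fun h : V -> R => h v) (etrans (esym e2) e1)).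
Qed.

(** A map with constant differential needs no chain rule of higher order: the
    derivatives of the composite in the direction v are those of f in the
    fixed direction dT v, and the induction goes through. *)
Lemma Ck_comp_affine {U V W : normedModType R} k (D : set V) (f : V -> W)
    (T dT : U -> V) : (forall x, is_diff x T dT) -> open D ->
  Ck k D f -> Ck k (T @^-1` D) (f \o T).
Proof.
move=> dTx oD.
have dx x : differentiable T x by case: (dTx x).
have cT : continuous T by move=> x; exact: differentiable_continuous.
elim: k f => [|k IH] f.
  by move=> fc x Dx; apply: continuous_comp; [exact: cT|exact: fc].
move=> [df dk]; split=> [x Dx|v].
  by apply: differentiable_comp; [exact: dx|exact: df].
have oTD : open (T @^-1` D) by apply: open_comp => // x _; exact: cT.
apply: (Ck_ext oTD _ (IH _ (dk (dT v)))) => x Dx /=.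
have e := diff_comp (dx x) (df _ Dx).
rewrite -[RHS]/((fun h : U -> W => h v) _) e /=.
by have [_ ->] := dTx x.
Qed.

(** Predicate form of polynomial functions, so that polynomiality of an
    explicit formula is proved from its shape rather than by exhibiting a
    multivariate polynomial. *)
Definition polyfun m (f : 'rV[R]_m -> R) : Prop :=
  exists P : mpoly m R, forall x : 'rV[R]_m, mevalrow P x = f x.

Definition polymap m n (f : 'rV[R]_m -> 'rV[R]_n) : Prop :=
  forall j, polyfun (fun x => f x 0 j).

Lemma polyfun_cst m (a : R) : polyfun (fun _ : 'rV[R]_m => a).
Proof. by exists (mpolyC m a) => x; rewrite mevalC. Qed.

Lemma polyfun_coord m (j : 'I_m) : polyfun (fun x : 'rV[R]_m => x 0 j).
Proof. by exists (mvar j) => x; rewrite mevalXU. Qed.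

Lemma polyfunD m (f g : 'rV[R]_m -> R) :
  polyfun f -> polyfun g -> polyfun (fun x => f x + g x).
Proof. by move=> [P fE] [Q gE]; exists (P + Q) => x; rewrite mevalD fE gE. Qed.

Lemma polyfunM m (f g : 'rV[R]_m -> R) :
  polyfun f -> polyfun g -> polyfun (fun x => f x * g x).
Proof. by move=> [P fE] [Q gE]; exists (P * Q) => x; rewrite mevalM fE gE. Qed.

Lemma polyfunN m (f : 'rV[R]_m -> R) : polyfun f -> polyfun (fun x => - f x).
Proof. by move=> [P fE]; exists (- P) => x; rewrite rmorphN /= fE. Qed.

Lemma polyfunB m (f g : 'rV[R]_m -> R) :
  polyfun f -> polyfun g -> polyfun (fun x => f x - g x).
Proof. by move=> pf pg; apply: polyfunD => //; exact: polyfunN. Qed.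

Lemma polyfunX m (f : 'rV[R]_m -> R) n :
  polyfun f -> polyfun (fun x => f x ^+ n).
Proof. by move=> [P fE]; exists (P ^+ n) => x; rewrite rmorphXn/= fE. Qed.

Lemma semialg_gt0 m (f : 'rV[R]_m -> R) :
  polyfun f -> semialg [set x | 0 < f x].
Proof.
move=> [P fE]; rewrite (_ : mkset _ = [set x : 'rV[R]_m | 0 < mevalrow P x]).
  exact: semialg_pos.
by apply/seteqP; split => x /=; rewrite fE.
Qed.

Lemma semialg_eq m (f g : 'rV[R]_m -> R) :
  polyfun f -> polyfun g -> semialg [set x | f x = g x].
Proof.
move=> pf pg; rewrite (_ : mkset _ =
  ~` ([set x | 0 < f x - g x] `|` [set x | 0 < g x - f x])).
  by apply/semialg_setC/semialg_setU; apply/semialg_gt0/polyfunB.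
apply/seteqP; split => x /=.
  by move=> ->; rewrite subrr ltxx; case.
by move=> /not_orP[/negP + /negP]; rewrite !subr_gt0; lra.
Qed.

Lemma semialg_forall m n (A : 'I_n -> set 'rV[R]_m) :
  (forall j, semialg (A j)) -> semialg [set x | forall j, A j x].
Proof.
elim: n A => [A _|n IH A HA].
  rewrite (_ : mkset _ = [set x | (fun=> 0 : R) x = (fun=> 0) x]).
    by apply: semialg_eq; exact: polyfun_cst.
  by apply/seteqP; split=> x //= _ [].
rewrite (_ : mkset _ =
    A ord0 `&` [set x | forall j : 'I_n, A (lift ord0 j) x]).
  by apply: semialg_setI => //; exact: IH.
apply/seteqP; split=> x /=; first by move=> H; split=> *; exact: H.
by move=> [H0 H] j; case: (unliftP ord0 j) => [i|] ->.
Qed.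

(** Induction on the Boolean combination; polynomial maps pull back the
    generating sets. *)
Lemma semialg_preimage m n (g : 'rV[R]_m -> 'rV[R]_n) (A : set 'rV[R]_n) :
  polymap g -> semialg A -> semialg (g @^-1` A).
Proof.
move=> /choice[P PE]; elim => {A} [Q|A B _ IA _ IB|A B _ IA _ IB|A _ IA].
- have := semialg_pos (comp_mpoly [tuple P i | i < n] Q).
  congr (semialg _); apply/seteqP; split=> x /=; rewrite comp_mpoly_meval;
    by rewrite (@meval_eq _ _ _ (fun i => g x 0 i)) // => i;
    rewrite tnth_mktuple PE.
- exact: semialg_setI.
- exact: semialg_setU.
- exact: semialg_setC.
Qed.

End Affine.

(** * Nash graphs over coordinate subspaces *)

Section NashGraph.
Context {R : realType}.

Lemma coord_id_is_diff n (x : 'rV[R]_n) j :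
  is_diff x (fun y => y 0 j) (fun v => v 0 j).
Proof.
have [dx e] := @is_diff_id _ _ x; have [dx' e'] := coord_is_diff j dx.
apply: DiffDef => //; apply: etrans e' _; apply/funext => v.
exact: (congr1 (fun h : 'rV[R]_n -> 'rV[R]_n => h v 0 j) e).
Qed.

Lemma rowDE n (x y : 'rV[R]_n) j : (x + y) 0 j = x 0 j + y 0 j.
Proof. by rewrite mxE. Qed.

Lemma rowBE n (x y : 'rV[R]_n) j : (x - y) 0 j = x 0 j - y 0 j.
Proof. by rewrite !mxE. Qed.

Lemma Ck_row_coord {V : normedModType R} n k (U : set V) (f : V -> 'rV[R]_n) j :
  open U -> Ck k U f -> Ck k U (fun x => f x 0 j).
Proof.
move=> oU; elim: k f => [|k IH] f.
  move=> fc x Ux.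
  exact: (@continuous_comp _ _ _ f (fun z : 'rV[R]_n => z 0 j) x (fc x Ux)
    (@coord_continuous _ _ _ _ _ _)).
move=> [df dk].
have D x : U x -> is_diff x (fun y => f y 0 j) (fun v => 'd f x v 0 j).
  by move=> Ux; apply: coord_is_diff; exact: df.
split=> [x /D[]//|v]; have := IH _ (dk v).
by apply: Ck_ext => // x /D[_ e]; exact: (congr1 (fun h : V -> R => h v) (esym e)).
Qed.

Lemma polymap_row_mx m p q (f : 'rV[R]_m -> 'rV[R]_p) (g : 'rV[R]_m -> 'rV[R]_q) :
  polymap f -> polymap g -> polymap (fun x => row_mx (f x) (g x)).
Proof.
move=> pf pg j; case: (split_ordP j) => i ->.
  by under eq_fun do rewrite row_mxEl.
by under eq_fun do rewrite row_mxEr.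
Qed.

Lemma polymapB m p (f g : 'rV[R]_m -> 'rV[R]_p) :
  polymap f -> polymap g -> polymap (fun x => f x - g x).
Proof.
move=> pf pg j; under eq_fun do rewrite !mxE.
exact: polyfunB.
Qed.

Lemma polymap_lsubmx m p : polymap (fun x : 'rV[R]_(m + p) => lsubmx x).
Proof. by move=> j; under eq_fun do rewrite !mxE; exact: polyfun_coord. Qed.

Lemma polymap_rsubmx m p : polymap (fun x : 'rV[R]_(m + p) => rsubmx x).
Proof. by move=> j; under eq_fun do rewrite !mxE; exact: polyfun_coord. Qed.

Lemma polymap_comp m p q (f : 'rV[R]_p -> 'rV[R]_q) (g : 'rV[R]_m -> 'rV[R]_p) :
  polymap f -> polymap g -> polymap (f \o g).
Proof.
move=> pf /choice[P PE] j; have [Q QE] := pf j.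
exists (comp_mpoly [tuple P i | i < p] Q) => x.
rewrite comp_mpoly_meval (@meval_eq _ _ _ (fun i => g x 0 i)) ?QE// => i.
by rewrite tnth_mktuple PE.
Qed.

(** The shear x |-> x + F x is invertible with inverse x |-> x - F x as soon
    as F does not change along it. Precomposing with an affine map T having
    the left inverse L gives at once the charts of a graph (T an affine
    isomorphism) and its global parametrization (T the inclusion of the base
    plane). The graphs of the diffeomorphism and of its inverse are both
    polynomial preimages of the graph of F, whence their semi-algebraicity. *)
Lemma shear_nash_diffeo p N (T dT : 'rV[R]_p -> 'rV[R]_N)
    (L : 'rV[R]_N -> 'rV[R]_p) (F : 'rV[R]_N -> 'rV[R]_N) (D B : set 'rV[R]_N) :
  (forall v, L (T v) = v) -> polymap T -> (forall v, is_diff v T dT) ->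
  open D -> semialg D -> (forall k, Ck k D F) ->
  (forall k, Ck k D (fun x => L (x - F x))) ->
  semialg [set row_mx x (F x) | x in D] ->
  (forall x, D x -> D (x + F x) /\ F (x + F x) = F x) ->
  (forall x, D x -> D (x - F x) /\ F (x - F x) = F x) ->
  B = [set x | D x /\ T (L (x - F x)) = x - F x] -> semialg B ->
  nash_diffeo (T @^-1` D) B (fun v => T v + F (T v)).
Proof.
move=> LT pT dTE oD sD FC LFC sF FD FB BE sB.
set A := T @^-1` D.
pose f v := T v + F (T v); pose g x := L (x - F x).
rewrite -/f.
have cT : continuous T.
  by move=> v; apply: differentiable_continuous; case: (dTE v).
have oA : open A by apply: open_comp => // x _; exact: cT.
have sA : semialg A by exact: semialg_preimage.
have fK v : A v -> g (f v) = v.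
  by move=> Av; rewrite /g /f (FD _ Av).2 addrK LT.
have AB v : A v -> B (f v).
  move=> Av; rewrite BE; split; first exact: (FD _ Av).1.
  by rewrite /f (FD _ Av).2 addrK LT.
have BA x : B x -> A (g x) /\ f (g x) = x.
  rewrite BE => -[Dx xE]; have [D' FE] := FB _ Dx.
  by rewrite /A /= /g /f xE FE subrK.
have sG : semialg [set row_mx v (f v) | v in A].
  rewrite (_ : [set _ | _ in _] = (fun y => row_mx (T (lsubmx y))
      (rsubmx y - T (lsubmx y))) @^-1` [set row_mx x (F x) | x in D]).
    apply: semialg_preimage sF; have pTl := polymap_comp pT (@polymap_lsubmx p N).
    by apply: polymap_row_mx => //; apply: polymapB => //; exact: polymap_rsubmx.
  apply/seteqP; split=> y /=.
    move=> [v Av <-]; exists (T v) => //.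
    by rewrite row_mxKl row_mxKr /f [T v + _]addrC addrK.
  move=> [x Dx /eq_row_mx[xE FE]]; exists (lsubmx y); first by rewrite /A /= -xE.
  by rewrite /f -xE FE -xE [x + _]addrC subrK hsubmxK.
have sG' : semialg [set row_mx x (g x) | x in B].
  rewrite (_ : [set _ | _ in _] = (fun y => row_mx (lsubmx y)
      (lsubmx y - T (rsubmx y))) @^-1` [set row_mx x (F x) | x in D]).
    apply: semialg_preimage sF; have pTr := polymap_comp pT (@polymap_rsubmx N p).
    have pl := @polymap_lsubmx N p.
    by apply: polymap_row_mx => //; apply: polymapB.
  apply/seteqP; split=> y /=.
    rewrite BE => -[x [Dx xE] <-]; exists x => //.
    by rewrite row_mxKl row_mxKr /g xE opprB addrC subrK.
  move=> [x Dx /eq_row_mx[xE FE]].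
  have TE : T (rsubmx y) = x - F x by rewrite FE xE opprB addrC subrK.
  exists x; first by rewrite BE; split => //; rewrite -TE LT.
  by rewrite /g -TE LT xE hsubmxK.
split.
- split; first by move=> v /AB.
    by move=> v w /set_mem/fK e1 /set_mem/fK e2 e; rewrite -e1 -e2 e.
  by move=> x /BA[Ag e]; exists (g x).
- split; first by split.
  move=> v Av; exists A, f; split => // k.
  apply: CkD => //; last exact: Ck_comp_affine.
  have CkT : Ck k.+1 setT T.
    split=> [x _|w]; first by case: (dTE x).
    rewrite (_ : (fun x => _) = fun=> dT w); first exact: Ck_cst.
    by apply/funext => x; have [_ ->] := dTE x.
  by apply: Ck_sub (Ck_pred CkT).
- exists g; split; last by move=> v /fK.
  split; first by split => // x /BA[].
  by move=> x; rewrite BE => -[Dx _]; exists D, g; split.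
Qed.

Section graph_over_coordinates.
Variables (N d : nat) (s : 'S_N) (F : 'rV[R]_N -> 'rV[R]_N) (D : set 'rV[R]_N).
Hypothesis dN : (d <= N)%N.
Hypotheses (oD : open D) (sD : semialg D).
Hypothesis Dbase : forall x y : 'rV[R]_N,
  (forall j : 'I_N, (j < d)%N -> x 0 (s j) = y 0 (s j)) -> D x -> D y.
Hypothesis Fbase : forall x y : 'rV[R]_N,
  (forall j : 'I_N, (j < d)%N -> x 0 (s j) = y 0 (s j)) -> F x = F y.
Hypothesis F0 : forall (x : 'rV[R]_N) (j : 'I_N), (j < d)%N -> F x 0 (s j) = 0.
Hypothesis FC : forall k, Ck k D F.
Hypothesis sF : semialg [set row_mx x (F x) | x in D].

(** The graph of F over the first d coordinates taken in the order s; the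
    values of F are stored in the ambient space, with zero base coordinates. *)
Definition coord_graph : set 'rV[R]_N :=
  [set x | D x /\ forall j : 'I_N, (d <= j)%N -> x 0 (s j) = F x 0 (s j)].

(** The d base coordinates placed at s 0, ..., s (d - 1), zero elsewhere. *)
Definition base_plane (u : 'rV[R]_d) : 'rV[R]_N :=
  \row_i oapp (u 0) 0 (insub (val (s^-1%g i))).

Let proj (x : 'rV[R]_N) : 'rV[R]_d := \row_j x 0 (s (widen_ord dN j)).

Let base_planeE u (j : 'I_d) : base_plane u 0 (s (widen_ord dN j)) = u 0 j.
Proof.
rewrite mxE permK insubT //= => H.
by congr (u 0 _); apply/val_inj.
Qed.

Let base_plane0 u (j : 'I_N) : (d <= j)%N -> base_plane u 0 (s j) = 0.
Proof. by move=> dj; rewrite mxE permK insubF //= ltnNge dj. Qed.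

Let FD x : D x -> D (x + F x) /\ F (x + F x) = F x.
Proof.
move=> Dx; split; [apply: Dbase Dx|apply/esym/Fbase] => j jd;
  by rewrite mxE F0// addr0.
Qed.

Let FB x : D x -> D (x - F x) /\ F (x - F x) = F x.
Proof.
move=> Dx; split; [apply: Dbase Dx|apply/esym/Fbase] => j jd;
  by rewrite !mxE F0// subr0.
Qed.

Let polyB : polymap base_plane.
Proof.
move=> j; under eq_fun do rewrite mxE.
by case: insub => [i|] /=; [exact: polyfun_coord|exact: polyfun_cst].
Qed.

Let pr x := base_plane (proj x).

Let prE x j : pr x 0 (s j) = if (j < d)%N then x 0 (s j) else 0.
Proof.
rewrite /pr; case: ltnP => di; last by rewrite base_plane0.
have -> : j = widen_ord dN (Ordinal di) by exact/val_inj.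
by rewrite base_planeE mxE.
Qed.

Let polyPr : polymap pr.
Proof.
apply: polymap_comp => // j; under eq_fun do rewrite mxE.
exact: polyfun_coord.
Qed.

Let graphP x : coord_graph x <-> D x /\ x - pr x = F x.
Proof.
split=> -[Dx xE]; split=> //.
  apply/rowP => i.
  have [{}i ->] : exists i', i = s i' by exists (s^-1%g i); rewrite permKV.
  rewrite rowBE prE; case: (ltnP i d) => di; last by rewrite subr0 xE.
  by rewrite subrr F0.
by move=> j dj; rewrite -xE rowBE prE ltnNge dj subr0.
Qed.

Lemma semialg_coord_graph : semialg coord_graph.
Proof.
have -> : coord_graph = (fun x => row_mx x (x - pr x)) @^-1`
    [set row_mx x (F x) | x in D].
  apply/seteqP; split=> x /=; first by move=> /graphP[Dx ->]; exists x.
  by move=> [y Dy /eq_row_mx[<- FE]]; apply/graphP.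
have pid : polymap (fun x : 'rV[R]_N => x) by move=> j; exact: polyfun_coord.
by apply: semialg_preimage sF; apply: polymap_row_mx => //; exact: polymapB.
Qed.

(** The base plane parametrizes the graph globally: the shear applied to the
    inclusion of the plane. *)
Lemma coord_graph_param : nash_diffeo (base_plane @^-1` D) coord_graph
  (fun u => base_plane u + F (base_plane u)).
Proof.
have cpr (x y : 'rV[R]_N) : (forall j : 'I_N, (j < d)%N -> x 0 (s j) = y 0 (s j)) ->
    pr x = pr y.
  move=> xy; rewrite /pr; congr (base_plane _); apply/rowP => j; rewrite !mxE.
  exact: (xy (widen_ord dN j) (ltn_ord j)).
have prF x : pr (x - F x) = pr x.
  by apply: cpr => j jd; rewrite !mxE F0 // subr0.
apply: (@shear_nash_diffeo _ _ base_plane base_plane proj) => //.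
- by move=> v; apply/rowP => j; rewrite mxE base_planeE.
- move=> v; apply: row_is_diff => j; under eq_fun do rewrite mxE.
  case: insub => [i|] /=; last exact: is_diff_cst.
  exact: coord_id_is_diff.
- move=> k; apply: Ck_row => // j.
  apply: Ck_ext (@Ck_coord _ _ _ D (s (widen_ord dN j))) => // x _.
  by rewrite mxE rowBE F0 ?subr0 //= ltn_ord.
- apply/seteqP; split=> x /=.
    move=> /graphP[Dx xE]; split=> //; rewrite -/(pr _) prF.
    by rewrite -xE subKr.
  by move=> [Dx]; rewrite -/(pr _) prF => e; apply/graphP; rewrite e subKr.
- exact: semialg_coord_graph.
Qed.

(** The chart at a is the shear applied to the affine isomorphism that
    reorders the coordinates and moves the origin to the projection of a. It
    flattens the graph onto the base plane. *)
Lemma nash_coord_graph : nash_submanifold d coord_graph.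
Proof.
split; first exact: semialg_coord_graph.
split=> // a aG.
(* T carries the flat model to the base plane through the projection of a. *)
pose T (v : 'rV[R]_N) := pr a + \row_i v 0 (s^-1%g i).
pose L (x : 'rV[R]_N) := \row_j (x - pr a) 0 (s j).
have LT v : L (T v) = v.
  by apply/rowP => j; rewrite mxE /T addrAC subrr add0r mxE permK.
have TL x : T (L x) = x.
  by apply/rowP => i; rewrite /T rowDE [X in _ + X]mxE [X in _ + X]mxE rowBE permKV
    addrC subrK.
have [Da aE] := (graphP a).1 aG.
have [_ Fpr] := FB Da; rewrite -aE subKr aE in Fpr.
have T0 : T 0 = pr a.
  by rewrite /T (_ : \row_i _ = 0) ?addr0//; apply/rowP => j; rewrite !mxE.
have dT v : is_diff v T (fun v => \row_i v 0 (s^-1%g i)).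
  have D1 := @is_diff_cst _ 'rV[R]_N 'rV[R]_N (pr a) v.
  have D2 : is_diff v (fun v : 'rV[R]_N => \row_i v 0 (s^-1%g i) : 'rV[R]_N)
      (fun v => \row_i v 0 (s^-1%g i)).
    apply: row_is_diff => j; under eq_fun do rewrite mxE.
    exact: coord_id_is_diff.
  apply: is_diff_eq (is_diffD D1 D2) _.
  by apply/funext => w /=; rewrite fctE add0r.
have nd : nash_diffeo (T @^-1` D) D (fun v => T v + F (T v)).
  apply: (@shear_nash_diffeo _ _ T (fun v => \row_i v 0 (s^-1%g i)) L) => //.
  - move=> j; rewrite /T; under eq_fun do rewrite rowDE mxE.
    by apply: polyfunD; [exact: polyfun_cst|exact: polyfun_coord].
  - move=> k; apply: Ck_row => // j.
    have := CkD oD (CkD oD (@Ck_coord _ _ k D (s j)) (CkN oD (Ck_row_coord (s j) oD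
      (FC k)))) (Ck_cst k D (- pr a 0 (s j))).
    by apply: Ck_ext => // x _; rewrite !mxE.
  - by apply/seteqP; split=> x //= -[].
exists (T @^-1` D), D, (fun v => T v + F (T v)); split=> //.
- split; last by rewrite /= T0; have [] := FB Da; rewrite -aE subKr.
  apply: open_comp => // v _; apply: differentiable_continuous.
  by have [] := dT v.
- by rewrite T0 Fpr -aE addrC subrK.
- apply/seteqP; split=> x /=.
    move=> [v [vf Dv] <-]; have [D' F'] := FD Dv; split=> //.
    split=> // j dj; rewrite F' rowDE.
    by rewrite /T rowDE prE ltnNge dj add0r mxE permK vf // add0r.
  move=> [[Dx xE] _]; exists (L (x - F x)); last first.
    by rewrite TL (FB Dx).2 subrK.
  split; last by rewrite /= TL; exact: (FB Dx).1.
  move=> j dj; rewrite mxE rowBE prE ltnNge dj subr0.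
  by rewrite rowBE xE // subrr.
Qed.

End graph_over_coordinates.

End NashGraph.

(** * The zero set on the sphere is a real cuspidal curve *)

Local Notation ix j := (lshift 3 (j : 'I_3)).
Local Notation iy j := (rshift 3 (j : 'I_3)).

Section ZeroSet.
Context {R : realType}.

(** The real points of C^3, in the coordinates (x, y) of x + iy. *)
Definition embed3 (a b c : R) : 'rV[R]_(3 + 3) :=
  row_mx (\row_(j < 3) nth 0 [:: a; b; c] j) 0.

Lemma ord3P (k : 'I_3) : [\/ k = 0, k = 1 | k = 2].
Proof.
case: k => -[|[|[|//]]] i; [apply: Or31|apply: Or32|apply: Or33]; exact/val_inj.
Qed.

Lemma row33P (P : 'I_(3 + 3) -> Prop) :
  P (ix 0) -> P (ix 1) -> P (ix 2) -> P (iy 0) -> P (iy 1) -> P (iy 2) ->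
  forall j, P j.
Proof.
move=> H0 H1 H2 H3 H4 H5 j; case: (split_ordP j) => i ->; by case: (ord3P i) => ->.
Qed.

Lemma embed3E a b c : [/\ embed3 a b c 0 (ix 0) = a, embed3 a b c 0 (ix 1) = b,
  embed3 a b c 0 (ix 2) = c & forall j, embed3 a b c 0 (iy j) = 0].
Proof. by split=> *; rewrite ?row_mxEl ?row_mxEr !mxE. Qed.

Lemma embed3P (x : 'rV[R]_(3 + 3)) : (forall j, x 0 (iy j) = 0) ->
  x = embed3 (x 0 (ix 0)) (x 0 (ix 1)) (x 0 (ix 2)).
Proof.
move=> y0; apply/rowP; have [e0 e1 e2 e3] := embed3E (x 0 (ix 0)) (x 0 (ix 1)) (x 0 (ix 2)).
by apply: row33P; rewrite ?e0 ?e1 ?e2 ?e3 ?y0.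
Qed.

Lemma alpha3E : alpha3 = embed3 0 0 1 :> 'rV[R]_(3 + 3).
Proof.
rewrite /alpha3 /toR; congr row_mx; apply/rowP => j; rewrite !mxE.
  by case: j => -[|[|[|//]]] i.
by case: (_ == _ :> 'I_3).
Qed.

Lemma sum3 (V : nmodType) (f : 'I_3 -> V) : \sum_j f j = f 0 + f 1 + f 2.
Proof.
rewrite !big_ord_recr big_ord0 /= add0r.
by congr (f _ + f _ + f _); exact/val_inj.
Qed.

Definition sqnorm6 (x : 'rV[R]_(3 + 3)) : R :=
  x 0 (ix 0) ^+ 2 + x 0 (ix 1) ^+ 2 + x 0 (ix 2) ^+ 2 +
  (x 0 (iy 0) ^+ 2 + x 0 (iy 1) ^+ 2 + x 0 (iy 2) ^+ 2).

Lemma Re_herm (x w : 'rV[R]_(3 + 3)) : complex.Re (herm (toC x) (toC w)) =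
  \sum_(j < 3) (x 0 (ix j) * w 0 (ix j) + x 0 (iy j) * w 0 (iy j)).
Proof.
rewrite /herm; rewrite raddf_sum; apply: eq_bigr => j _.
by rewrite !mxE /=; ring.
Qed.

Lemma hnorm_sqnorm6 (x : 'rV[R]_(3 + 3)) : hnorm (toC x) = Num.sqrt (sqnorm6 x).
Proof. by rewrite /hnorm Re_herm sum3 /sqnorm6; congr Num.sqrt; ring. Qed.

Lemma sqnorm6_ge0 x : 0 <= sqnorm6 x.
Proof. by rewrite /sqnorm6 !addr_ge0 ?sqr_ge0. Qed.

Lemma hnorm_lt1 x : (hnorm (toC x) < 1) = (sqnorm6 x < 1).
Proof. by rewrite hnorm_sqnorm6 -[in LHS]sqrtr1 ltr_sqrt. Qed.

Lemma hnorm_eq1 x : hnorm (toC x) = 1 <-> sqnorm6 x = 1.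
Proof.
rewrite hnorm_sqnorm6; split=> [h|->]; last exact: sqrtr1.
by rewrite -[LHS]sqr_sqrtr ?sqnorm6_ge0 // h expr1n.
Qed.

Lemma meval_pi (z : 'rV[R[i]]_3) : mevalrow (@pi_poly R) z =
  1 - z 0 0 ^+ 2 - z 0 1 ^+ 2 - z 0 2 ^+ 2 +
  (13%:R)^-1 * (z 0 1 ^+ 2 - z 0 0 ^+ 3) ^+ 2.
Proof.
by rewrite /pi_poly; rewrite !(mevalD, mevalB, mevalN, mevalZ, mevalM, rmorph1,
  rmorphXn, mevalXU) /=.
Qed.

(** The imaginary part of q = z_2^2 - z_1^3 is grouped by the imaginary parts
    of z_2 and z_1, ready for the Cauchy-Schwarz inequality. *)
Lemma Re_pi x : complex.Re (mevalrow (@pi_poly R) (toC x)) =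
  1 - x 0 (ix 0) ^+ 2 - x 0 (ix 1) ^+ 2 - x 0 (ix 2) ^+ 2 +
  x 0 (iy 0) ^+ 2 + x 0 (iy 1) ^+ 2 + x 0 (iy 2) ^+ 2 +
  13^-1 * ((x 0 (ix 1) ^+ 2 - x 0 (iy 1) ^+ 2 - x 0 (ix 0) ^+ 3
            + 3 * x 0 (ix 0) * x 0 (iy 0) ^+ 2) ^+ 2
         - (x 0 (iy 1) * (2 * x 0 (ix 1)) + x 0 (iy 0) *
            (x 0 (iy 0) ^+ 2 - 3 * x 0 (ix 0) ^+ 2)) ^+ 2).
Proof.
rewrite meval_pi !mxE.
have -> : (13%:R : R[i])^-1 = (13^-1)%:C by rewrite -(rmorph_nat (real_complex R)) fmorphV.
rewrite !exprS !expr0 !mulr1 /=.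
by ring.
Qed.

(** With y the imaginary part of z and q = z_2^2 - z_1^3, the real part of the
    equation reads 13 (1 - |z|^2) + 26 |y|^2 + (Re q)^2 = (Im q)^2. Since Im q
    vanishes with y, Cauchy-Schwarz bounds its square by 9 |y|^2 in the closed
    ball; every term on the left must therefore vanish. The constant 13 only
    has to make 26 larger than 9. *)
Lemma pi_ball_bound (x1 x2 x3 y1 y2 y3 : R) :
  x1 ^+ 2 + x2 ^+ 2 + x3 ^+ 2 + (y1 ^+ 2 + y2 ^+ 2 + y3 ^+ 2) <= 1 ->
  1 - x1 ^+ 2 - x2 ^+ 2 - x3 ^+ 2 + y1 ^+ 2 + y2 ^+ 2 + y3 ^+ 2 +
  13^-1 * ((x2 ^+ 2 - y2 ^+ 2 - x1 ^+ 3 + 3 * x1 * y1 ^+ 2) ^+ 2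
         - (y2 * (2 * x2) + y1 * (y1 ^+ 2 - 3 * x1 ^+ 2)) ^+ 2) = 0 ->
  [/\ y1 = 0, y2 = 0, y3 = 0, x1 ^+ 2 + x2 ^+ 2 + x3 ^+ 2 = 1 & x2 ^+ 2 = x1 ^+ 3].
Proof.
move=> hN; set qr := (_ + 3 * x1 * _); set qi := y2 * _ + _ => h.
have p1 := sqr_ge0 x1; have p2 := sqr_ge0 x2; have p3 := sqr_ge0 x3.
have q1 := sqr_ge0 y1; have q2 := sqr_ge0 y2; have q3 := sqr_ge0 y3.
set n := y1 ^+ 2 - 3 * x1 ^+ 2 in qi h.
(* Cauchy-Schwarz, as a Lagrange identity. *)
have CS : qi ^+ 2 <= (y1 ^+ 2 + y2 ^+ 2) * (4 * x2 ^+ 2 + n ^+ 2).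
  rewrite -subr_ge0 (_ : _ - _ = (y2 * n - y1 * (2 * x2)) ^+ 2) ?sqr_ge0 //.
  by rewrite /qi; ring.
have n2 : n ^+ 2 <= 9 * (x1 ^+ 2 + y1 ^+ 2).
  have : n ^+ 2 <= 9 * (x1 ^+ 2 + y1 ^+ 2) ^+ 2.
    by rewrite /n; nra.
  have : (x1 ^+ 2 + y1 ^+ 2) ^+ 2 <= (x1 ^+ 2 + y1 ^+ 2) by nra.
  lra.
have B : qi ^+ 2 <= 9 * (y1 ^+ 2 + y2 ^+ 2).
  apply: le_trans CS _; rewrite mulrC ler_wpM2r ?addr_ge0 //; lra.
have qr0 := sqr_ge0 qr.
have y10 : y1 ^+ 2 = 0 by lra.
have y20 : y2 ^+ 2 = 0 by lra.
have y30 : y3 ^+ 2 = 0 by lra.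
have qr00 : qr ^+ 2 = 0 by lra.
have sq0 (a : R) : a ^+ 2 = 0 -> a = 0 by move/eqP; rewrite sqrf_eq0 => /eqP.
split; try exact: sq0; first by lra.
have := sq0 _ qr00; rewrite /qr y10 y20; lra.
Qed.

Lemma stable_pi : stable (@pi_poly R).
Proof.
rewrite /stable -subset0 => z [/=]; rewrite -[z]toRK; move: (toR z) => x.
rewrite /zeros /cball /= hnorm_lt1 => h hx.
have := Re_pi x; rewrite h => /esym /pi_ball_bound [|y1 y2 y3 e _].
  by rewrite -/(sqnorm6 x) ltW.
by move: hx; rewrite /sqnorm6 y1 y2 y3 e; lra.
Qed.

Lemma zsphere_piP (x : 'rV[R]_(3 + 3)) : zsphere (@pi_poly R) x <->
  [/\ forall j, x 0 (iy j) = 0,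
      x 0 (ix 0) ^+ 2 + x 0 (ix 1) ^+ 2 + x 0 (ix 2) ^+ 2 = 1 &
      x 0 (ix 1) ^+ 2 = x 0 (ix 0) ^+ 3].
Proof.
rewrite /zsphere /zeros /csphere /=; split.
  move=> [h /hnorm_eq1 n1].
  have := Re_pi x; rewrite h => /esym /pi_ball_bound [|y1 y2 y3 e q].
    by rewrite -/(sqnorm6 x) n1.
  by split=> // j; case: (ord3P j) => ->.
move=> [y0 n1 q].
split; last by apply/hnorm_eq1; rewrite /sqnorm6 !y0 n1; lra.
rewrite meval_pi !mxE !y0.
have rC (a : R) : a +i* 0 = a%:C by [].
rewrite !rC -!rmorphXn q subrr expr0n mulr0 addr0.
rewrite -(rmorph1 (real_complex R)) -!rmorphB.
apply: (congr1 (real_complex R) (y := 0)); lra.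
Qed.

End ZeroSet.

(** * Smoothness of square roots and of the parameter of the cusp *)

Section Roots.
Context {R : realType}.

(** Bootstrapping for composites f o h with f given by a differential equation
    f' = df in which df is built from f. *)
Lemma Ck_comp_scalar {V : normedModType R} (U : set V) (h : V -> R)
    (f df : R -> R) : open U -> (forall k, Ck k U h) ->
  (forall x, U x -> is_derive (h x) 1 f (df (h x))) ->
  (forall k, Ck k U (f \o h) -> Ck k U (df \o h)) ->
  forall k, Ck k U (f \o h).
Proof.
move=> oU hC fD H k.
apply: (@Ck_bootstrap _ _ _ _ _ (fun x v => 'd h x v * df (h x))) => //.
  move=> x Ux; have [fx fE] := fD x Ux.
  have hx : differentiable h x by have [+ _] := hC 1%N; exact.
  have fx' : differentiable f (h x) by exact/derivable1_diffP.
  apply: DiffDef; first exact: differentiable_comp.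
  apply: etrans (diff_comp hx fx') _; apply/funext => v /=.
  rewrite -fE -derive1E.
  exact: (congr1 (fun g : R -> R => g ('d h x v)) (diff1E fx')).
move=> m fm v; apply: CkM => //; last exact: H.
by have [_] := hC m.+1; exact.
Qed.

Lemma Ck_sqrt {V : normedModType R} (U : set V) (h : V -> R) :
  open U -> (forall k, Ck k U h) -> (forall x, U x -> 0 < h x) ->
  forall k, Ck k U (fun x => Num.sqrt (h x)).
Proof.
move=> oU hC h0; apply: (@Ck_comp_scalar _ _ _ _ (fun y => (2 * Num.sqrt y)^-1)) => //.
  by move=> x /h0 hx; exact: is_derive1_sqrt.
move=> k Hk; apply: CkV => //.
  by move=> x /h0 hx /=; rewrite mulf_neq0 // gt_eqF // sqrtr_gt0.
by apply: CkM => //; exact: Ck_cst.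
Qed.

(** The positive root s of s^4 + s^6 = y. With y = 1 - x_3^2 it parametrizes
    the curve x_1 = s^2, x_2 = s^3 on the sphere by its third coordinate. *)
Definition cusp_param (y : R) : R :=
  xget 0 [set s | 0 < s /\ s ^+ 4 + s ^+ 6 = y].

Lemma cusp_param_uniq (s y : R) : 0 < s -> s ^+ 4 + s ^+ 6 = y ->
  cusp_param y = s.
Proof.
move=> s0 sE; rewrite /cusp_param; case: xgetP => [r _ [r0 rE]|/(_ s)[]//].
have H : s ^+ 4 + s ^+ 6 = r ^+ 4 + r ^+ 6 by rewrite sE rE.
have L (a b : R) : 0 < a -> a < b -> a ^+ 4 + a ^+ 6 < b ^+ 4 + b ^+ 6.
  by move=> a0 ab; apply: ltrD; apply: ltrXn2r => //; exact: ltW.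
have [rs|sr|//] := ltgtP r s.
  by have := L _ _ r0 rs; rewrite H ltxx.
by have := L _ _ s0 sr; rewrite H ltxx.
Qed.

Lemma cusp_paramP (y : R) : 0 < y ->
  0 < cusp_param y /\ cusp_param y ^+ 4 + cusp_param y ^+ 6 = y.
Proof.
move=> y0.
pose p : {poly R} := 'X^4 + 'X^6.
have pE s : p.[s] = s ^+ 4 + s ^+ 6 by rewrite /p !hornerE.
have y1 : 1 <= 1 + y by rewrite lerDl ltW.
have [c cI cE] : exists2 c, c \in `[0, 1 + y] & p.[c] = y.
  apply: IVT; first by rewrite addr_ge0 // ltW.
    by apply: continuous_subspaceT; exact: continuous_horner.
  rewrite !pE !expr0n /= addr0.
  have H n : (0 < n)%N -> 1 + y <= (1 + y) ^+ n by move=> n0; exact: ler_eXnr.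
  have p4 := H 4%N isT; have p6 := H 6%N isT.
  by rewrite ge_min le_max (ltW y0) /= orbC; lra.
have c0 : 0 < c.
  rewrite lt_neqAle (itvP cI) andbT; apply/eqP => c0; move: cE y0.
  by rewrite -c0 pE !expr0n /= addr0 => <-; rewrite ltxx.
by rewrite (@cusp_param_uniq c) // -pE.
Qed.

(** Inverse function theorem in one variable, the derivative of s^4 + s^6
    being positive for s > 0. *)
Lemma is_derive_cusp_param (y : R) : 0 < y ->
  is_derive y 1 cusp_param (4 * cusp_param y ^+ 3 + 6 * cusp_param y ^+ 5)^-1.
Proof.
move=> /cusp_paramP[]; set s := cusp_param y => s0 <-.
pose p : {poly R} := 'X^4 + 'X^6.
have pE r : r ^+ 4 + r ^+ 6 = p.[r] by rewrite /p !hornerE.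
have dpE : 4 * s ^+ 3 + 6 * s ^+ 5 = p^`().[s].
  by rewrite /p derivD !derivXn hornerD !hornerMn !hornerXn !mulr_natl.
rewrite pE dpE; apply: is_derive_inverse.
- near=> z; apply: cusp_param_uniq; last exact: pE.
  by near: z; exact: lt_nbhsr.
- by near=> z; exact: continuous_horner.
- by rewrite -dpE gt_eqF // addr_gt0 // mulr_gt0 // exprn_gt0.
Unshelve. all: by end_near. Qed.

Lemma Ck_cusp_param {V : normedModType R} (U : set V) (h : V -> R) :
  open U -> (forall k, Ck k U h) -> (forall x, U x -> 0 < h x) ->
  forall k, Ck k U (fun x => cusp_param (h x)).
Proof.
move=> oU hC h0; apply: (@Ck_comp_scalar _ _ _ _
  (fun y => (4 * cusp_param y ^+ 3 + 6 * cusp_param y ^+ 5)^-1)) => //.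
  by move=> x /h0 hx; exact: is_derive_cusp_param.
move=> k Hk; apply: CkV => //.
  move=> x /h0 /cusp_paramP[hx _] /=.
  by rewrite gt_eqF // addr_gt0 // mulr_gt0 // exprn_gt0.
by apply: CkD => //; apply: CkM => //; (exact: Ck_cst || exact: CkX).
Qed.

End Roots.

(** * The two open arcs of the zero set and the upper half of the real sphere *)

Section BranchesAndCap.
Context {R : realType}.

Local Notation V12 := 'rV[R]_(3 + 3 + (3 + 3)).

Ltac pf := repeat first
  [exact: polyfun_coord | exact: polyfun_cst | apply: polyfunB | apply: polyfunD
  | apply: polyfunM | apply: polyfunX | apply: polyfunN].

Lemma Ck_embed3 {V : normedModType R} k (U : set V) (f g h : V -> R) : open U ->
  Ck k U f -> Ck k U g -> Ck k U h -> Ck k U (fun x => embed3 (f x) (g x) (h x)).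
Proof.
move=> oU fC gC hC; apply: Ck_row => //.
have E x := embed3E (f x) (g x) (h x).
apply: row33P.
- by apply: Ck_ext fC => // x _; have [-> _ _ _] := E x.
- by apply: Ck_ext gC => // x _; have [_ -> _ _] := E x.
- by apply: Ck_ext hC => // x _; have [_ _ -> _] := E x.
- by apply: Ck_ext (Ck_cst k U 0) => // x _; have [_ _ _ ->] := E x.
- by apply: Ck_ext (Ck_cst k U 0) => // x _; have [_ _ _ ->] := E x.
- by apply: Ck_ext (Ck_cst k U 0) => // x _; have [_ _ _ ->] := E x.
Qed.

Lemma open_polylt n (f : 'rV[R]_n -> R) (a : R) :
  Ck 0 setT f -> open [set x | f x < a].
Proof.
move=> fC; apply: (@open_comp _ _ f [set y | y < a]); last exact: open_lt.
by move=> x _; exact: fC.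
Qed.

Section Arc.
Variable sg : R.
Hypothesis sg2 : sg ^+ 2 = 1.

Definition branch_domain : set 'rV[R]_(3 + 3) := [set x | x 0 (ix 2) ^+ 2 < 1].

(** The point of the arc at a given height x_3, as a function on the whole
    space that depends on x_3 alone and has zero third coordinate. *)
Definition branch_fun (x : 'rV[R]_(3 + 3)) : 'rV[R]_(3 + 3) :=
  let s := cusp_param (1 - x 0 (ix 2) ^+ 2) in embed3 (s ^+ 2) (sg * s ^+ 3) 0.

(** One of the two arcs of the zero set joining the cusps, as a graph over the
    third coordinate in (-1, 1). The root s itself is not a parameter of the
    arc: it takes each value twice, except its maximum on the equator. *)
Definition cusp_branch : set 'rV[R]_(3 + 3) :=
  coord_graph 1 (tperm (ix 0) (ix 2)) branch_fun branch_domain.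

Lemma open_branch_domain : open branch_domain.
Proof. by apply: open_polylt; apply: CkX (openT) _; exact: Ck_coord. Qed.

Lemma semialg_branch_domain : semialg branch_domain.
Proof.
rewrite (_ : branch_domain = [set x | 0 < 1 - x 0 (ix 2) ^+ 2]).
  by apply: semialg_gt0; pf.
by apply/seteqP; split=> x; rewrite /branch_domain /= subr_gt0.
Qed.

(** For positive a the equations of the cusp, with the sign of b, determine a
    and b; this is what describes the graph of branch_fun by polynomial
    conditions without quantifiers. *)
Lemma branch_fun_uniq (x : 'rV[R]_(3 + 3)) (a b : R) : 0 < a -> 0 < sg * b ->
  a ^+ 2 + a ^+ 3 = 1 - x 0 (ix 2) ^+ 2 -> b ^+ 2 = a ^+ 3 ->
  branch_fun x = embed3 a b 0.
Proof.
move=> a0 b0 ha hb; rewrite /branch_fun.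
have s0 : 0 < Num.sqrt a by rewrite sqrtr_gt0.
have s2 : Num.sqrt a ^+ 2 = a by rewrite sqr_sqrtr // ltW.
rewrite (@cusp_param_uniq _ (Num.sqrt a)) //; last first.
  by rewrite -ha -[in RHS]s2 -!exprM.
have s3 : sg * b = Num.sqrt a ^+ 3.
  apply/eqP; rewrite -(@eqrXn2 _ 2) ?(ltW b0) ?exprn_ge0 ?(ltW s0) //.
  by rewrite exprMn sg2 mul1r hb -exprM mulnC exprM s2.
by rewrite s2 -s3 mulrA -expr2 sg2 mul1r.
Qed.

Lemma branch_funP (x : 'rV[R]_(3 + 3)) : branch_domain x -> exists a b : R,
  [/\ 0 < a, 0 < sg * b, a ^+ 2 + a ^+ 3 = 1 - x 0 (ix 2) ^+ 2, b ^+ 2 = a ^+ 3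
    & branch_fun x = embed3 a b 0].
Proof.
rewrite /branch_domain /branch_fun /=; rewrite -subr_gt0 => /cusp_paramP[].
set s := cusp_param _ => s0 sE; exists (s ^+ 2), (sg * s ^+ 3); split=> //.
- by rewrite exprn_gt0.
- by rewrite mulrA -expr2 sg2 mul1r exprn_gt0.
- by rewrite -!exprM.
- by rewrite exprMn sg2 mul1r -!exprM.
Qed.

Let tE (j : 'I_(3 + 3)) : (j < 1)%N -> tperm (ix 0) (ix 2) j = ix 2.
Proof.
move=> j1; have -> : j = ix 0 by apply/val_inj; case: j j1 => -[].
exact: tpermL.
Qed.

Lemma semialg_branch_graph :
  semialg [set row_mx x (branch_fun x) | x in branch_domain].
Proof.
pose l := @lshift (3 + 3) (3 + 3); pose r := @rshift (3 + 3) (3 + 3).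
rewrite (_ : [set _ | _ in _] =
  [set y : V12 | 0 < y 0 (r (ix 0))] `&` [set y : V12 | 0 < sg * y 0 (r (ix 1))] `&`
  ([set y : V12 | y 0 (r (ix 0)) ^+ 2 + y 0 (r (ix 0)) ^+ 3 = 1 - y 0 (l (ix 2)) ^+ 2] `&`
  [set y : V12 | y 0 (r (ix 1)) ^+ 2 = y 0 (r (ix 0)) ^+ 3]) `&`
  ([set y : V12 | y 0 (r (ix 2)) = 0] `&`
   [set y : V12 | forall j, [set y : V12 | y 0 (r (iy j)) = 0] y])).
  do ?apply: semialg_setI; try (by apply: semialg_gt0; pf); try (by apply: semialg_eq; pf).
  by apply: semialg_forall => j; apply: semialg_eq; pf.
apply/seteqP; split=> y /=.
  move=> [x /branch_funP[a [b [a0 b0 h1 h2 ->]]] <-]; have [e0 e1 e2 e3] := embed3E a b 0.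
  rewrite /l /r !row_mxEr e0 e1 e2 !row_mxEl; do !split=> //.
  by move=> j; rewrite row_mxEr e3.
move=> [[[h0 h1] [h2 h3]] [h4 h5]]; exists (lsubmx y).
  rewrite /branch_domain /= mxE -/(l _) -subr_gt0 -h2.
  by rewrite addr_gt0 // exprn_gt0.
rewrite (@branch_fun_uniq _ (y 0 (r (ix 0))) (y 0 (r (ix 1)))) //; last by rewrite mxE.
rewrite -[RHS]hsubmxK; congr row_mx.
rewrite [RHS]embed3P ?mxE ?h4 // => j; rewrite mxE; exact: h5.
Qed.

Lemma branch_base_ext (x y : 'rV[R]_(3 + 3)) :
  (forall j : 'I_(3 + 3), (j < 1)%N ->
     x 0 (tperm (ix 0) (ix 2) j) = y 0 (tperm (ix 0) (ix 2) j)) ->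
  x 0 (ix 2) = y 0 (ix 2).
Proof. by move=> /(_ (ix 0) isT); rewrite tpermL. Qed.

Lemma Ck_branch_fun k : Ck k branch_domain branch_fun.
Proof.
have oD := open_branch_domain.
have S : Ck k branch_domain (fun x => cusp_param (1 - x 0 (ix 2) ^+ 2)).
  apply: Ck_cusp_param => // [m|x]; last by rewrite /branch_domain /= subr_gt0.
  apply: CkD => //; first exact: Ck_cst.
  by apply: CkN => //; apply: CkX => //; exact: Ck_coord.
apply: Ck_embed3 => //; [exact: CkX | | exact: Ck_cst].
by apply: CkM => //; [exact: Ck_cst | exact: CkX].
Qed.

Lemma nash_cusp_branch : nash_submanifold 1 cusp_branch.
Proof.
apply: nash_coord_graph => //.
- exact: open_branch_domain.
- exact: semialg_branch_domain.
- by move=> x y /branch_base_ext; rewrite /branch_domain /= => ->.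
- by move=> x y /branch_base_ext; rewrite /branch_fun => ->.
- move=> x j /tE ->; rewrite /branch_fun; set s := cusp_param _.
  by have [_ _ -> _] := embed3E (s ^+ 2) (sg * s ^+ 3) 0.
- exact: Ck_branch_fun.
- exact: semialg_branch_graph.
Qed.

Lemma cusp_branchP (x : 'rV[R]_(3 + 3)) : cusp_branch x <->
  zsphere (@pi_poly R) x /\ 0 < sg * x 0 (ix 1).
Proof.
split.
  move=> [Dx H]; have [a [b [a0 b0 h1 h2 FE]]] := branch_funP Dx.
  have [e0 e1 e2 e3] := embed3E a b 0.
  rewrite FE in H.
  have x0 : x 0 (ix 0) = a by have := H (ix 2) isT; rewrite tpermR e0.
  have x1 : x 0 (ix 1) = b.
    by have := H (ix 1) isT; rewrite tpermD // e1.
  have y0 j : x 0 (iy j) = 0.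
    by have := H (iy j) isT; rewrite tpermD // e3.
  split; last by rewrite x1.
  by apply/zsphere_piP; split; rewrite ?x0 ?x1 //; lra.
move=> [/zsphere_piP[y0 n1 q] b0].
have x0 : 0 < x 0 (ix 0).
  have b2 : 0 < x 0 (ix 1) ^+ 2.
    by rewrite exprn_even_gt0 //= ; apply/eqP => b00; rewrite b00 mulr0 ltxx in b0.
  have := b2; rewrite q; case: (ltrP 0 (x 0 (ix 0))) => // a0.
  by rewrite exprSr pmulr_lgt0 ?ltNge ?sqr_ge0 //; nra.
have Dx : branch_domain x.
  rewrite /branch_domain /=; have := exprn_gt0 2 x0; have := sqr_ge0 (x 0 (ix 1)).
  by lra.
have FE := @branch_fun_uniq x _ _ x0 b0 _ q; rewrite /cusp_branch; split=> // j j1.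
rewrite FE; last by lra.
have [e0 e1 e2 e3] := embed3E (x 0 (ix 0)) (x 0 (ix 1)) 0.
move: j j1; apply: row33P => // _; rewrite ?tpermR ?tpermD ?e0 ?e1 ?e3 ?y0 //.
Qed.

End Arc.

Definition cap_domain : set 'rV[R]_(3 + 3) :=
  [set x | x 0 (ix 0) ^+ 2 + x 0 (ix 1) ^+ 2 < 1].

Definition cap_fun (x : 'rV[R]_(3 + 3)) : 'rV[R]_(3 + 3) :=
  embed3 0 0 (Num.sqrt (1 - (x 0 (ix 0) ^+ 2 + x 0 (ix 1) ^+ 2))).

(** The open upper half of the real unit sphere S^2, as a graph over the first
    two coordinates. *)
Definition upper_cap : set 'rV[R]_(3 + 3) :=
  coord_graph 2 (1%g : {perm 'I_(3 + 3)}) cap_fun cap_domain.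

Lemma open_cap_domain : open cap_domain.
Proof.
by apply: open_polylt; apply: CkD (openT) _ _; apply: CkX (openT) _; exact: Ck_coord.
Qed.

Lemma cap_base_ext (x y : 'rV[R]_(3 + 3)) :
  (forall j : 'I_(3 + 3), (j < 2)%N -> x 0 ((1%g : {perm 'I_(3 + 3)}) j) = y 0 ((1%g
    : {perm 'I_(3 + 3)}) j)) ->
  x 0 (ix 0) = y 0 (ix 0) /\ x 0 (ix 1) = y 0 (ix 1).
Proof.
by move=> H; have := H (ix 0) isT; have := H (ix 1) isT; rewrite !perm1.
Qed.

Lemma nash_upper_cap : nash_submanifold 2 upper_cap.
Proof.
have sC : semialg cap_domain.
  rewrite (_ : cap_domain = [set x | 0 < 1 - (x 0 (ix 0) ^+ 2 + x 0 (ix 1) ^+ 2)]).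
    by apply: semialg_gt0; pf.
  by apply/seteqP; split=> x; rewrite /cap_domain /= subr_gt0.
have oD := open_cap_domain.
apply: nash_coord_graph => //.
- by move=> x y /cap_base_ext; rewrite /cap_domain /= => -[-> ->].
- by move=> x y /cap_base_ext; rewrite /cap_fun => -[-> ->].
- move=> x j j2; rewrite perm1.
  have [e0 e1 e2 e3] := embed3E 0 0 (Num.sqrt (1 - (x 0 (ix 0) ^+ 2 + x 0 (ix 1) ^+ 2))).
  by move: j j2; apply: row33P.
- move=> k; apply: Ck_embed3 => //; try exact: Ck_cst.
  apply: Ck_sqrt => // [m|x]; last by rewrite /cap_domain /= subr_gt0.
  apply: CkD => //; first exact: Ck_cst.
  apply: CkN => //; apply: CkD => //; by apply: CkX => //; exact: Ck_coord.
pose l := @lshift (3 + 3) (3 + 3); pose r := @rshift (3 + 3) (3 + 3).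
rewrite (_ : [set _ | _ in _] =
  [set y : V12 | 0 < y 0 (r (ix 2))] `&`
  [set y : V12 | y 0 (r (ix 2)) ^+ 2 = 1 - (y 0 (l (ix 0)) ^+ 2 + y 0 (l (ix 1)) ^+ 2)] `&`
  [set y : V12 | y 0 (r (ix 0)) = 0] `&` [set y : V12 | y 0 (r (ix 1)) = 0] `&`
  [set y : V12 | forall j, [set y : V12 | y 0 (r (iy j)) = 0] y]).
  do ?apply: semialg_setI; try (by apply: semialg_gt0; pf); try (by apply: semialg_eq; pf).
  by apply: semialg_forall => j; apply: semialg_eq; pf.
apply/seteqP; split=> y /=.
  move=> [x Dx <-]; rewrite /cap_fun; set q := 1 - _.
  have q0 : 0 < q by rewrite subr_gt0.
  have [e0 e1 e2 e3] := embed3E 0 0 (Num.sqrt q).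
  rewrite /l /r !row_mxEr e0 e1 e2 !row_mxEl; do !split=> //.
  - by rewrite sqrtr_gt0.
  - by rewrite sqr_sqrtr // ltW.
  - by move=> j; rewrite row_mxEr e3.
move=> [[[[h0 h1] h2] h3] h4]; exists (lsubmx y).
  by rewrite /cap_domain /= !mxE -subr_gt0 -h1 exprn_gt0.
rewrite -[RHS]hsubmxK; congr row_mx; rewrite /cap_fun !mxE -h1 sqrtr_sqr gtr0_norm //.
by rewrite [RHS]embed3P ?mxE ?h2 ?h3 // => j; rewrite mxE; exact: h4.
Qed.

Lemma upper_capP (x : 'rV[R]_(3 + 3)) : upper_cap x <->
  [/\ forall j, x 0 (iy j) = 0,
     x 0 (ix 0) ^+ 2 + x 0 (ix 1) ^+ 2 + x 0 (ix 2) ^+ 2 = 1 & 0 < x 0 (ix 2)].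
Proof.
set q := 1 - (x 0 (ix 0) ^+ 2 + x 0 (ix 1) ^+ 2).
have [e0 e1 e2 e3] := embed3E 0 0 (Num.sqrt q).
split.
  move=> [Dx H]; have q0 : 0 < q by rewrite subr_gt0.
  have := H (ix 2) isT; rewrite perm1 e2 => x2.
  split; last by rewrite x2 sqrtr_gt0.
    by move=> j; have := H (iy j) isT; rewrite perm1 e3.
  by rewrite x2 sqr_sqrtr ?(ltW q0) // /q; ring.
move=> [y0 n1 x2]; split.
  by rewrite /cap_domain /=; have := exprn_gt0 2 x2; lra.
have qE : q = x 0 (ix 2) ^+ 2 by rewrite /q -n1; ring.
have sq : Num.sqrt q = x 0 (ix 2) by rewrite qE sqrtr_sqr gtr0_norm.
rewrite /cap_fun -/q; rewrite sq in e2 e3 *.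
by apply: row33P; rewrite ?perm1 ?e2 ?e3 ?y0.
Qed.

End BranchesAndCap.

(** * Complex tangency, closures and the cusps *)

Section CuspClosure.
Context {R : realType}.

Notation X := (zsphere (@pi_poly R)).

(** On the real unit sphere the Hermitian product of velocity and position is
    the real number <f', f>, half the derivative of the constant |f|^2. All
    complex tangency below comes from here. *)
Lemma real_sphere_ct {V : normedModType R} (f : V -> 'rV[R]_(3 + 3)) (x v : V) :
  differentiable f x ->
  (\forall y \near x, (forall j, f y 0 (iy j) = 0) /\
     f y 0 (ix 0) ^+ 2 + f y 0 (ix 1) ^+ 2 + f y 0 (ix 2) ^+ 2 = 1) ->
  herm (toC ('d f x v)) (toC (f x)) = 0.
Proof.
move=> fx fn.
have dc j := coord_is_diff j fx.
have near_cst (g : V -> R) (dg : V -> R) (a : R) : is_diff x g dg ->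
    (\forall y \near x, g y = a) -> dg v = 0.
  move=> [_ dgE] ga.
  have /near_eq_is_diff : {near x, (cst a : V -> R) =1 g}.
    by apply: filterS ga => y ->.
  move=> /(_ (differentiable_cst _ _))[_ e].
  have [_ e0] := @is_diff_cst _ V R a x.
  by rewrite -(congr1 (fun h : V -> R => h v) dgE) (congr1 (fun h : V -> R => h v) e)
    (congr1 (fun h : V -> R => h v) e0).
have im j : 'd f x v 0 (iy j) = 0.
  by apply: (near_cst _ _ 0 (dc (iy j))); apply: filterS fn => y [->].
have [y0 _] := nbhs_singleton fn.
have := near_cst _ _ 1 (is_diffD (is_diffD (is_diffM (dc (ix 0)) (dc (ix 0)))
  (is_diffM (dc (ix 1)) (dc (ix 1)))) (is_diffM (dc (ix 2)) (dc (ix 2)))).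
rewrite !fctE /= => H.
rewrite /herm sum3 !mxE !y0 !im.
have rC (a b : R) : (a +i* 0) * (b +i* 0)^*%C = (a * b)%:C.
  by rewrite /= oppr0; congr (_ +i* _); ring.
rewrite !rC -!rmorphD; apply: (congr1 (real_complex R) (y := 0)).
have := H; rewrite /GRing.scale /= => {}H.
apply: (@mulfI R 2) => //; rewrite mulr0; rewrite -[RHS]H; last first.
  by apply: filterS fn => y [_ <-]; rewrite !expr2.
by ring.
Qed.

Lemma cusp_branch_param (sg : R) : sg ^+ 2 = 1 -> exists f,
  nash_diffeo (@cube R 1) (cusp_branch sg) f /\ ct_map (@cube R 1) f.
Proof.
move=> sg2; pose B := @base_plane R (3 + 3) 1 (tperm (ix 0) (ix 2)).
have BE (u : 'rV[R]_1) : B u 0 (ix 2) = u 0 0.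
  by rewrite mxE tpermV tpermR insubT //=; congr (u 0 _); exact/val_inj.
have cubeE : @cube R 1 = B @^-1` branch_domain.
  apply/seteqP; split=> u; rewrite /cube /branch_domain /= BE.
    by move=> /(_ 0) /andP[? ?]; nra.
  by move=> ? j; rewrite ord1; apply/andP; split; nra.
have nd : nash_diffeo (@cube R 1) (cusp_branch sg) (fun u => B u + branch_fun sg (B u)).
  rewrite cubeE; apply: coord_graph_param => //.
  - exact: open_branch_domain.
  - exact: semialg_branch_domain.
  - by move=> x y /branch_base_ext; rewrite /branch_domain /= => ->.
  - by move=> x y /branch_base_ext; rewrite /branch_fun => ->.
  - move=> x j j1; have -> : j = ix 0 by apply/val_inj; case: j j1 => -[].
    rewrite tpermL /branch_fun; set s := cusp_param _.
    by have [_ _ -> _] := embed3E (s ^+ 2) (sg * s ^+ 3) 0.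
  - exact: Ck_branch_fun.
  - exact: semialg_branch_graph.
eexists; split; first exact: nd.
have [[fA _ _] [_ fC] _] := nd.
have oC : open (@cube R 1).
  rewrite cubeE; apply: open_comp; last exact: open_branch_domain.
  move=> u _; apply: differentiable_continuous; apply: row_differentiable => j.
  under eq_fun do rewrite mxE.
  by case: insub => [i|] /=; [exact: differentiable_coord|exact: differentiable_cst].
move=> x h Cx; apply: real_sphere_ct.
  have [U [g [oU Ux gC fg]]] := fC x Cx.
  have [gd _] := gC 1%N.
  apply: (@ex_diff _ _ _ _ _ _ _ (near_eq_is_diff _ (gd x Ux))).
  have oCU : nbhs x (@cube R 1 `&` U) by apply: open_nbhs_nbhs; split; [exact: openI|].
  by apply: filterS oCU => y [Cy Uy]; rewrite fg.
apply: filterS (open_nbhs_nbhs (conj oC Cx)) => y /fA /(cusp_branchP sg2)[/zsphere_piP[]].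
by [].
Qed.

Lemma closed_eqfun n (f g : 'rV[R]_n -> R) :
  Ck 0 setT f -> Ck 0 setT g -> closed [set x | f x = g x].
Proof.
move=> fC gC; rewrite (_ : mkset _ = (fun x => f x + -1 * g x) @^-1` [set 0]).
  apply: closed_comp; last exact: closed_eq.
  have H := CkD openT fC (CkM openT (Ck_cst 0 setT (-1 : R)) gC).
  by move=> x _; exact: H.
by apply/seteqP; split=> x /=; lra.
Qed.

Lemma closed_zsphere : closed X.
Proof.
rewrite (_ : X = [set x : 'rV[R]_(3 + 3) | x 0 (ix 0) ^+ 2 + x 0 (ix 1) ^+ 2 + x 0
  (ix 2) ^+ 2 = 1] `&`
  [set x : 'rV[R]_(3 + 3) | x 0 (ix 1) ^+ 2 = x 0 (ix 0) ^+ 3] `&`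
  \bigcap_j [set x : 'rV[R]_(3 + 3) | x 0 (iy j) = 0]).
  apply: closedI; last first.
    by apply: closed_bigI => j _; apply: closed_eqfun; [exact: Ck_coord|exact: Ck_cst].
  have cX j n : Ck 0 setT (fun x : 'rV[R]_(3 + 3) => x 0 (ix j) ^+ n).
    by apply: (CkX n openT); exact: Ck_coord.
  apply: closedI; apply: closed_eqfun => //; last exact: Ck_cst.
  exact: (CkD openT (CkD openT (cX 0 2%N) (cX 1 2%N)) (cX 2 2%N)).
apply/seteqP; split=> x.
  by move=> /zsphere_piP[y0 n1 q]; split; [split|move=> j _; exact: y0].
by move=> [[n1 q] y0]; apply/zsphere_piP; split=> // j; exact: y0.
Qed.

(** For sg = 1 or -1 and tau = 1 or -1, the cusp at the pole (0, 0, tau)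
    traversed in one of the two directions; it lies on the zero set for |t| <=
    1/2. *)
Definition cusp (sg tau t : R) : 'rV[R]_(3 + 3) :=
  embed3 (t ^+ 2) (sg * t ^+ 3) (tau * Num.sqrt (1 - t ^+ 4 - t ^+ 6)).

Lemma cusp_radicand_gt0 (t : R) : `|t| <= 2^-1 -> 0 < 1 - t ^+ 4 - t ^+ 6.
Proof.
move=> t2; have tt : t ^+ 2 <= 4^-1.
  by rewrite -[t ^+ 2]ger0_norm ?sqr_ge0 // normrX; have := normr_ge0 t; nra.
have := sqr_ge0 t; move: tt; have -> : t ^+ 4 = t ^+ 2 * t ^+ 2 by ring.
have -> : t ^+ 6 = t ^+ 2 * (t ^+ 2 * t ^+ 2) by ring.
move: (t ^+ 2) => a a4 a0; have aa : a * a <= 4^-1 * a by rewrite ler_wpM2r.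
have : a * (a * a) <= 4^-1 * (a * a) by rewrite ler_wpM2r // mulr_ge0.
lra.
Qed.

Lemma cusp_zsphere (sg tau t : R) : sg ^+ 2 = 1 -> tau ^+ 2 = 1 ->
  `|t| <= 2^-1 -> X (cusp sg tau t).
Proof.
move=> sg2 tau2 t2.
have [e0 e1 e2 e3] := embed3E (t ^+ 2) (sg * t ^+ 3) (tau * Num.sqrt (1 - t ^+ 4 - t ^+ 6)).
have p := ltW (cusp_radicand_gt0 t2).
apply/zsphere_piP; rewrite /cusp e0 e1 e2; split=> //.
  by rewrite !exprMn sg2 tau2 sqr_sqrtr //; ring.
by rewrite exprMn sg2; ring.
Qed.

Lemma cusp_in_branch (sg tau t : R) : sg ^+ 2 = 1 -> tau ^+ 2 = 1 ->
  0 < t <= 2^-1 -> cusp_branch sg (cusp sg tau t).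
Proof.
move=> sg2 tau2 /andP[t0 t2]; apply/cusp_branchP => //; split.
  by apply: cusp_zsphere => //; rewrite gtr0_norm.
have [e0 e1 e2 e3] := embed3E (t ^+ 2) (sg * t ^+ 3) (tau * Num.sqrt (1 - t ^+ 4 - t ^+ 6)).
by rewrite /cusp e1 mulrA -expr2 sg2 mul1r exprn_gt0.
Qed.

Lemma cusp_continuous (sg tau : R) : continuous (cusp sg tau).
Proof.
move=> t; apply: (@Ck_continuous _ _ _ 0 setT _ _ _ I).
apply: Ck_embed3; first exact: openT.
all: have id0 : Ck 0 (setT : set R) (fun t : R => t) by move=> ? _; exact: cvg_id.
- exact: (CkX 2 openT id0).
- exact: (CkM openT (Ck_cst 0 setT sg) (CkX 3 openT id0)).
- apply: (CkM openT (Ck_cst 0 setT tau)).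
  have H := CkD openT (CkD openT (Ck_cst 0 setT (1 : R)) (CkN openT (CkX 4 openT
    id0))) (CkN openT (CkX 6 openT id0)).
  move=> x _; apply: (@continuous_comp _ _ _ (fun t : R => 1 - t ^+ 4 - t ^+ 6) Num.sqrt).
    exact: H.
  exact: sqrt_continuous.
Qed.

Lemma cusp0 (sg tau : R) : cusp sg tau 0 = embed3 0 0 tau.
Proof. by rewrite /cusp !expr0n /= mulr0 !subr0 sqrtr1 mulr1. Qed.

Lemma closure_cusp_branch_pole (sg tau : R) : sg ^+ 2 = 1 -> tau ^+ 2 = 1 ->
  closure (cusp_branch sg) (embed3 0 0 tau).
Proof.
move=> sg2 tau2 B; rewrite -(cusp0 sg tau) => B0.
have H : \forall t \near (0 : R)^'+, B (cusp sg tau t).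
  by apply: cvg_within; exact: (cusp_continuous B0).
have H2 : \forall t \near (0 : R)^'+, 0 < t <= 2^-1.
  near=> t; apply/andP; split=> //; near: t; apply: nbhs_right_le.
  by rewrite invr_gt0.
have [t [Bt t0]] : exists t, B (cusp sg tau t) /\ 0 < t <= 2^-1.
  by apply: (@filter_ex _ ((0 : R)^'+)); exact: filterI H H2.
by exists (cusp sg tau t); split => //; exact: cusp_in_branch.
Unshelve. all: by end_near. Qed.

(** On the zero set, x_2 = 0 forces x_1 = 0 and then x_3 = 1 or x_3 = -1. *)
Lemma zsphere_pole (x : 'rV[R]_(3 + 3)) : X x -> x 0 (ix 1) = 0 ->
  x = embed3 0 0 1 \/ x = embed3 0 0 (- 1).
Proof.
move=> /zsphere_piP[y0 n1 q] x1; rewrite (embed3P y0) x1.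
move: q; rewrite x1 expr0n /= => /esym/eqP; rewrite expf_eq0 /= => /eqP x0.
move: n1; rewrite x1 x0 !expr0n /= !add0r => /eqP; rewrite sqrf_eq1.
by case/orP => /eqP ->; [left|right].
Qed.

Lemma zsphere_poles (tau : R) : tau ^+ 2 = 1 -> X (embed3 0 0 tau).
Proof.
move=> tau2; have [e0 e1 e2 e3] := embed3E 0 0 tau.
by apply/zsphere_piP; rewrite e0 e1 e2 tau2 !expr0n /= !add0r.
Qed.

(** Limits of the arc stay in the closed half x_2 >= 0 (up to sign) of the
    zero set, and leave the arc only where x_2 = 0. *)
Lemma closure_cusp_branch (sg : R) : sg ^+ 2 = 1 ->
  closure (cusp_branch sg) `\` cusp_branch sg = [set embed3 0 0 1; embed3 0 0 (- 1)].
Proof.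
move=> sg2; apply/seteqP; split=> x /=.
  move=> [cx nx]; have [Xx x1] : X x /\ 0 <= sg * x 0 (ix 1).
    suff : closure (cusp_branch sg) `<=` X `&`
      [set x : 'rV[R]_(3 + 3) | 0 <= sg * x 0 (ix 1)].
      by apply.
    have cl : closed (X `&` [set x : 'rV[R]_(3 + 3) | 0 <= sg * x 0 (ix 1)]).
      apply: closedI; first exact: closed_zsphere.
      apply: (@closed_comp _ _ (fun x : 'rV[R]_(3 + 3) =>
        sg * x 0 (ix 1)) [set y | 0 <= y]); last exact: closed_ge.
      have H := CkM openT (Ck_cst 0 setT sg) (@Ck_coord _ (3 + 3) 0 setT (ix 1)).
      by move=> y _; exact: H.
    rewrite [X in _ `<=` X](closure_id _).1 //; apply: closure_subset.
    by move=> y /(cusp_branchP sg2)[Xy /ltW].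
  apply: zsphere_pole => //.
  have sg0 : sg != 0 by apply/eqP => sg0; move: sg2; rewrite sg0 expr0n /= => /eqP;
    rewrite eq_sym oner_eq0.
  apply: (mulfI sg0); rewrite mulr0; apply/eqP; rewrite eq_le x1 andbT leNgt.
  by apply/negP => x10; apply: nx; apply/cusp_branchP.
have Narc tau : ~ cusp_branch sg (embed3 0 0 tau).
  by have [_ e1 _ _] := embed3E 0 0 tau; move=> /(cusp_branchP sg2)[_];
    rewrite e1 mulr0 ltxx.
by move=> [->|->]; split=> //; apply: closure_cusp_branch_pole => //;
  rewrite ?expr1n ?sqrrN ?expr1n.
Qed.

End CuspClosure.

(** * A Nash stratification *)

Section CuspStratification.
Context {R : realType}.

Notation X := (zsphere (@pi_poly R)).

Lemma nash_smooth_submanifold N d (M : set 'rV[R]_N) :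
  nash_submanifold d M -> smooth_submanifold d M.
Proof.
move=> [_ [dN ch]]; split=> // x Mx.
have [Q [Q' [phi [? ? [bij [_ sphi] [g [[_ sg] gK]]] ? ?]]]] := ch x Mx.
by exists Q, Q', phi; split=> //; split=> //; exists g.
Qed.

Lemma closure_set1 (a : 'rV[R]_(3 + 3)) : closure [set a] = [set a].
Proof. by
  apply/esym/closure_id/accessible_closed_set1/hausdorff_accessible/norm_hausdorff. Qed.

Lemma semialg_set1 N (a : 'rV[R]_N) : semialg [set a].
Proof.
rewrite (_ : [set a] = [set x | forall j, [set x : 'rV[R]_N | x 0 j = a 0 j] x]).
  apply: semialg_forall => j; apply: semialg_eq; first exact: polyfun_coord.
  exact: polyfun_cst.
apply/seteqP; split=> x /=; first by move=> ->.
by move=> H; apply/rowP.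
Qed.

Lemma nash_point (a : 'rV[R]_(3 + 3)) : nash_submanifold 0 [set a].
Proof.
rewrite (_ : [set a] = coord_graph 0 (1%g : {perm 'I_(3 + 3)}) (fun=> a) setT).
  have sT : semialg (setT : set 'rV[R]_(3 + 3)).
    rewrite (_ : setT = [set x : 'rV[R]_(3 + 3) | (fun=> 0 : R) x = (fun=> 0) x]).
      by apply: semialg_eq; exact: polyfun_cst.
    by apply/seteqP; split.
  apply: nash_coord_graph => //.
  - exact: openT.
  - by move=> k; exact: Ck_cst.
  - rewrite (_ : [set _ | _ in _] = rsubmx @^-1` [set a]).
      by apply: semialg_preimage; [exact: polymap_rsubmx|exact: semialg_set1].
    apply/seteqP; split=> y /=; first by move=> [x _ <-]; rewrite row_mxKr.
    by move=> ya; exists (lsubmx y) => //; rewrite -ya hsubmxK.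
apply/seteqP; split=> x /=; first by move=> ->.
by move=> [_ H]; apply/rowP => j; have := H j isT; rewrite perm1.
Qed.

Lemma point_param (a : 'rV[R]_(3 + 3)) : exists f,
  nash_diffeo (@cube R 0) [set a] f /\ ct_map (@cube R 0) f.
Proof.
have c0 : @cube R 0 = setT by apply/seteqP; split=> x // _ [].
have s0 : semialg (@cube R 0).
  rewrite c0 (_ : setT = [set 0]); first exact: semialg_set1.
  by apply/seteqP; split=> x // _; apply/rowP => -[].
exists (fun=> a); split; last first.
  move=> x h _; have -> : 'd (fun=> a) x h = 0.
    have [_ e] := @is_diff_cst _ 'rV[R]_0 'rV[R]_(3 + 3) a x.
    exact: (congr1 (fun g : 'rV[R]_0 -> 'rV[R]_(3 + 3) => g h) e).
  by rewrite /herm big1 // => j _; rewrite !mxE mul0r.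
have uq (x y : 'rV[R]_0) : x = y by apply/rowP => -[].
split.
- split; [by []|by move=> x y _ _ _; exact: uq|].
  by move=> x ->; exists 0 => //; rewrite c0.
- split; last first.
    by move=> x _; exists setT, (fun=> a); split=> //; [exact: openT|move=> k;
      exact: Ck_cst].
  split=> //; first exact: semialg_set1.
  rewrite (_ : [set _ | _ in _] = [set row_mx 0 a]); first exact: semialg_set1.
  apply/seteqP; split=> y /=; first by move=> [x _ <-]; rewrite (uq x 0).
  by move=> ->; exists 0 => //; rewrite c0.
exists (fun=> 0); split; last by move=> x _; exact: uq.
split; last first.
  by move=> x _; exists setT, (fun=> 0); split=> //; [exact: openT|move=> k; exact: Ck_cst].
split=> //; [exact: semialg_set1|by rewrite c0|].
rewrite (_ : [set _ | _ in _] = [set row_mx a 0]); first exact: semialg_set1.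
by apply/seteqP; split=> y /=; [move=> [x -> <-]|move=> ->; exists a].
Qed.

(** Four strata, indexed by dimension and sign: the arcs x_2 > 0 and x_2 < 0,
    and the two cusps. *)
Definition stratum (i : bool * bool) : set 'rV[R]_(3 + 3) :=
  if i.1 then cusp_branch ((-1) ^+ i.2) else [set embed3 0 0 ((-1) ^+ i.2)].

Let sg2 (b : bool) : ((-1) ^+ b : R) ^+ 2 = 1.
Proof. by case: b; rewrite ?sqrrN expr1n. Qed.

Lemma stratum_zsphere i : stratum i `<=` X.
Proof.
case: i => [[] b] x /=.
  by move=> /(cusp_branchP (sg2 b))[].
by move=> ->; exact: zsphere_poles.
Qed.

Lemma zsphere_rsphere : X `<=` @rsphere R 3.
Proof. by move=> x [_]. Qed.

(** The signs of x_2 and x_3 tell the strata apart. *)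
Lemma stratum_sign i x : stratum i x -> if i.1 then is_true (0 < (-1) ^+ i.2 * x 0 (ix 1))
  else x 0 (ix 1) = 0 /\ x 0 (ix 2) = (-1) ^+ i.2.
Proof.
case: i => [[] b] /=; first by move=> /(cusp_branchP (sg2 b))[].
by move=> ->; have [_ -> -> _] := embed3E 0 0 ((-1) ^+ b : R).
Qed.

Lemma stratum_inj i j x : stratum i x -> stratum j x -> i = j.
Proof.
move=> /stratum_sign + /stratum_sign; case: i j => [[] b] [[] c] /=.
- by case: b c => -[] //= h1 h2; exfalso; move: h1 h2; rewrite ?expr0 ?expr1; lra.
- by move=> h [e _]; move: h; rewrite e mulr0 ltxx.
- by move=> [-> _]; rewrite mulr0 ltxx.
- move=> [_ ->] [_]; case: b c => -[] //= h; exfalso; move: h;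
    rewrite ?expr0 ?expr1; lra.
Qed.

Lemma cusp_stratification : nash_stratification X stratum.
Proof.
split.
- apply/seteqP; split=> x; first by move=> [i _]; exact: stratum_zsphere.
  move=> Xx; have [x1|x1|x1] := ltgtP (x 0 (ix 1)) 0.
  + exists (true, true) => //; apply/cusp_branchP; first exact: sg2.
    by split=> //; rewrite expr1 mulN1r oppr_gt0.
  + exists (true, false) => //; apply/cusp_branchP; first exact: sg2.
    by split=> //; rewrite expr0 mul1r.
  + by have [->|->] := zsphere_pole Xx x1; [exists (false, false)|exists (false, true)].
- by move=> i j _ _ [x [xi xj]]; exact: stratum_inj xi xj.
- move=> i [[] c] ij /= [x [xi xj]]; last first.
    move: xj; rewrite {1}/stratum /= closure_set1 => xj.
    by move: ij; rewrite (@stratum_inj i (false, c) x) ?eqxx.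
  have H := closure_cusp_branch (sg2 c).
  have nx : ~ stratum (true, c) x.
    by move=> /(stratum_inj xi) e; rewrite e eqxx in ij.
  have xx : [set embed3 0 0 1; embed3 0 0 (-1)] x by rewrite -H; split.
  have x1 : x 0 (ix 1) = 0.
    by case: xx => ->; have [_ e _ _] := embed3E 0 0 (1 : R);
      have [_ e' _ _] := embed3E 0 0 (-1 : R); rewrite ?e ?e'.
  case: i ij xi => -[] b ij; first by move=> /stratum_sign /=; rewrite x1 mulr0 ltxx.
  move=> xi y /= ->; have : (closure (cusp_branch ((-1) ^+ c)) `\` cusp_branch ((-1)
    ^+ c)) (embed3 0 0 ((-1) ^+ b : R)).
    by rewrite H; case: b {ij xi} => /=; [right|left]; rewrite ?expr1.
  by case.
- case=> -[] b.
  + exists 1%N; split=> //.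
    * exact: nash_cusp_branch.
    * by apply: subset_trans zsphere_rsphere; exact: stratum_zsphere.
    * exact: cusp_branch_param.
    * move=> _; exists (embed3 0 0 1), (embed3 0 0 (-1)); split;
      last exact: closure_cusp_branch.
      apply/eqP => /(congr1 (fun x : 'rV[R]_(3 + 3) => x 0 (ix 2))).
      have [_ _ -> _] := embed3E 0 0 (1 : R); have [_ _ -> _] := embed3E 0 0 (-1 : R); lra.
  + exists 0%N; split=> //.
    * exact: nash_point.
    * by apply: subset_trans zsphere_rsphere; exact: (@stratum_zsphere (false, b)).
    * exact: point_param.
Qed.

End CuspStratification.

(** * The dimension of the zero set *)

Section Dimension.
Context {R : realType}.

Notation X := (zsphere (@pi_poly R)).

(** If G takes different values at two points of a segment, the intermediate
    value theorem applied along three arcs joining them, disjoint except at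
    their ends, gives three points with the same value; otherwise three points
    of the segment do. *)
Lemma square_three_points (r : R) (G : R * R -> R) : 0 < r ->
  (forall p : R * R, `|p.1| < r -> `|p.2| < r -> {for p, continuous G}) ->
  exists p1 p2 p3 : R * R, [/\ p1 != p2, p1 != p3, p2 != p3,
    G p1 = G p2 /\ G p2 = G p3 &
    forall p, p \in [:: p1; p2; p3] -> `|p.1| < r /\ `|p.2| < r].
Proof.
move=> r0 Gc; pose e := r / 3.
have e0 : 0 < e by rewrite divr_gt0.
have er : r = 3 * e by rewrite /e; field.
have path_points (a b : R) : 0 <= a <= 2 * e -> 0 <= b <= 2 * e ->
    G (a, 0) != G (b, 0) -> exists p1 p2 p3 : R * R,
    [/\ p1 != p2, p1 != p3, p2 != p3, G p1 = G p2 /\ G p2 = G p3 &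
    forall p, p \in [:: p1; p2; p3] -> `|p.1| < r /\ `|p.2| < r].
  move=> aI bI Gab; have ab : b - a != 0.
    by apply: contra Gab; rewrite subr_eq0 => /eqP ->.
  (* Parabolic arcs from (a, 0) to (b, 0), of heights proportional to k. *)
  pose pt k s : R * R := (a + s * (b - a), k * (s * (1 - s)) * e).
  have ptr k s : 0 <= k <= 2 -> 0 <= s <= 1 -> `|(pt k s).1| < r /\ `|(pt k s).2| < r.
    move=> kI sI; rewrite /pt /=.
    have h1 : 0 <= a + s * (b - a) <= 2 * e.
      by rewrite (_ : a + s * (b - a) = (1 - s) * a + s * b); [nra|ring].
    have h2 : 0 <= s * (1 - s) <= 1 by nra.
    have h3 : 0 <= k * (s * (1 - s)) <= 2 by nra.
    have h4 : 0 <= k * (s * (1 - s)) * e <= 2 * e by nra.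
    by rewrite !ger0_norm; lra.
  pose v := (G (a, 0) + G (b, 0)) / 2.
  have mid k : 0 <= k <= 2 -> exists2 s, 0 < s < 1 & G (pt k s) = v.
    move=> kI.
    have id0 : Ck 0 (setT : set R) (fun t : R => t) by move=> ? _; exact: cvg_id.
    have c1 : Ck 0 setT (fun s => (pt k s).1).
      exact: (CkD openT (Ck_cst 0 setT a) (CkM openT id0 (Ck_cst 0 setT (b - a)))).
    have c2 : Ck 0 setT (fun s => (pt k s).2).
      have cB := CkD openT (Ck_cst 0 setT (1 : R)) (CkN openT id0).
      exact: (CkM openT (CkM openT (Ck_cst 0 setT k) (CkM openT id0 cB)) (Ck_cst 0 setT e)).
    have p0 : pt k 0 = (a, 0) by rewrite /pt !mul0r addr0 mulr0 mul0r.
    have p1 : pt k 1 = (b, 0) by rewrite /pt subrr !mulr0 mul0r mul1r subrKC.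
    have [s sI sE] : exists2 s, s \in `[0, 1] & G (pt k s) = v.
      apply: IVT => //; last first.
        rewrite p0 p1 ge_min le_max /v.
        by have [h|h] := leP (G (a, 0)) (G (b, 0)); apply/andP; split; apply/orP;
          [left|right|right|left]; lra.
      apply: continuous_in_subspaceT => s; rewrite inE /= => sI.
      have [h1 h2] : `|(pt k s).1| < r /\ `|(pt k s).2| < r.
        by apply: ptr => //; move: sI; rewrite in_itv.
      apply: (@continuous_comp _ _ _ (pt k) G); last exact: Gc.
      exact: (cvg_pair (c1 s I) (c2 s I)).
    exists s => //; have sn0 : s != 0.
      apply/eqP => s0; move: sE Gab; rewrite s0 p0 /v => h /eqP; apply; lra.
    have sn1 : s != 1.
      apply/eqP => s1; move: sE Gab; rewrite s1 p1 /v => h /eqP; apply; lra.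
    by move: sI; rewrite in_itv /= => /andP[? ?]; rewrite !lt_neqAle eq_sym sn0 sn1;
      apply/andP.
  have [s0 s0I G0] := mid 0 ltac:(by lra).
  have [s1 s1I G1] := mid 1 ltac:(by lra).
  have [s2 s2I G2] := mid 2 ltac:(by lra).
  have inj k l s t : 0 < s < 1 -> 0 < t < 1 -> k != l -> pt k s != pt l t.
    move=> sI tI kl; apply/eqP => -[h1 h2].
    have st : s = t by apply: (mulIf ab); lra.
    move: h2; rewrite -st => /(mulIf (lt0r_neq0 e0)) h2; move/eqP: kl; apply.
    by apply: (mulIf _ h2); rewrite gt_eqF // mulr_gt0; lra.
  exists (pt 0 s0), (pt 1 s1), (pt 2 s2); split.
  - by apply: inj => //; apply/eqP; lra.
  - by apply: inj => //; apply/eqP; lra.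
  - by apply: inj => //; apply/eqP; lra.
  - by rewrite G0 G1 G2.
  - by move=> p; rewrite !inE => /or3P[]/eqP ->; apply: ptr; lra.
have [E1|] := eqVneq (G (0, 0)) (G (e, 0)); last by apply: path_points; lra.
have [E2|] := eqVneq (G (e, 0)) (G (2 * e, 0)); last by apply: path_points; lra.
exists (0, 0), (e, 0), (2 * e, 0); split=> //.
- by apply/eqP => -[]; lra.
- by apply/eqP => -[]; lra.
- by apply/eqP => -[]; lra.
- by move=> p; rewrite !inE => /or3P[]/eqP -> /=; rewrite ?normr0; split=> //;
  rewrite ger0_norm; lra.
Qed.

(** The second coordinate determines the first through x_1^3 = x_2^2, and the
    third up to sign through the sphere. *)
Lemma zsphere_eq_coord2 (x y : 'rV[R]_(3 + 3)) : X x -> X y -> x 0 (ix 1) = y 0 (ix 1) ->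
  x 0 (ix 0) = y 0 (ix 0) /\ x 0 (ix 2) ^+ 2 = y 0 (ix 2) ^+ 2.
Proof.
move=> /zsphere_piP[_ nx qx] /zsphere_piP[_ ny qy] e1.
have e0 : x 0 (ix 0) = y 0 (ix 0).
  have h : x 0 (ix 0) ^+ 3 = y 0 (ix 0) ^+ 3 by rewrite -qx -qy e1.
  have px := sqr_ge0 (x 0 (ix 1)); rewrite qx in px.
  have py := sqr_ge0 (y 0 (ix 1)); rewrite qy in py.
  have p3 (a : R) : 0 <= a ^+ 3 -> 0 <= a by rewrite exprn_odd_ge0.
  apply: (@pexpIrn R 3 isT _ _ _ _ h); rewrite nnegrE; [exact: p3 px|exact: p3 py].
by split=> //; move: nx; rewrite -ny e0 e1 => /addrI.
Qed.

(** The second coordinate is at most two-to-one on the zero set. *)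
Lemma zsphere_three (x y z : 'rV[R]_(3 + 3)) : X x -> X y -> X z ->
  x 0 (ix 1) = y 0 (ix 1) -> y 0 (ix 1) = z 0 (ix 1) ->
  [\/ x = y, x = z | y = z].
Proof.
move=> Xx Xy Xz exy eyz.
have [h1 k1] := zsphere_eq_coord2 Xx Xy exy; have [h2 k2] := zsphere_eq_coord2 Xy Xz eyz.
have eqX (u w : 'rV[R]_(3 + 3)) : X u -> X w -> u 0 (ix 0) = w 0 (ix 0) ->
    u 0 (ix 1) = w 0 (ix 1) -> u 0 (ix 2) = w 0 (ix 2) -> u = w.
  move=> /zsphere_piP[u0 _ _] /zsphere_piP[w0 _ _] e1 e2 e3.
  by rewrite (embed3P u0) (embed3P w0) e1 e2 e3.
move/eqP: k1; rewrite eqf_sqr => /orP[/eqP k1|/eqP k1]; first by apply: Or31; exact: eqX.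
move/eqP: k2; rewrite eqf_sqr => /orP[/eqP k2|/eqP k2]; first by apply: Or33; exact: eqX.
by apply: Or32; apply: eqX; rewrite ?h1 ?exy // k1 k2 opprK.
Qed.

Lemma smooth_on_continuous {V W : normedModType R} (A : set V) (f : V -> W) x :
  open A -> smooth_on A f -> A x -> {for x, continuous f}.
Proof.
move=> oA fC Ax; have [U [g [oU Ux gC fg]]] := fC x Ax.
suff : f y @[y --> x] --> g x by rewrite -fg.
apply: cvg_trans (gC 0%N x Ux); apply: near_eq_cvg.
have := open_nbhs_nbhs (conj (openI oA oU) (conj Ax Ux)).
by apply: filterS => y [Ay Uy]; rewrite fg.
Qed.

(** A chart of a submanifold of dimension at least 2 restricts to an injective
    map from a square to the zero set; composed with the second coordinate it
    would be continuous and at most two-to-one. *)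
Lemma zsphere_dim_le1 d (M : set 'rV[R]_(3 + 3)) :
  smooth_submanifold d M -> M !=set0 -> M `<=` X -> (d <= 1)%N.
Proof.
move=> [d6 ch] [a Ma] MX; rewrite leqNgt; apply/negP => d2.
have [Q [Q' [phi [[oQ Q0] [oQ' Q'a] [[_ inj _] phiC _] _ img]]]] := ch a Ma.
have /nbhs_ballP[r /= r0 rQ] := open_nbhs_nbhs (conj oQ Q0).
pose u (p : R * R) : 'rV[R]_(3 + 3) := embed3 p.1 p.2 0.
have uE (p : R * R) : [/\ u p 0 (ix 0) = p.1, u p 0 (ix 1) = p.2,
    u p 0 (ix 2) = 0 & forall j, u p 0 (iy j) = 0] := embed3E p.1 p.2 0.
have uQ p : `|p.1| < r -> `|p.2| < r -> Q (u p).
  move=> p1 p2; apply: rQ; rewrite -ball_normE /ball_ /= sub0r normrN.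
  rewrite [ltLHS]/Num.Def.normr/= mx_normrE; apply: bigmax_lt => //= -[i j] _ /=.
  rewrite ord1; have [e0 e1 e2 e3] := uE p; move: j.
  by apply: row33P; rewrite ?e0 ?e1 ?e2 ?e3 ?normr0.
have uX p : `|p.1| < r -> `|p.2| < r -> X (phi (u p)).
  move=> p1 p2; apply: MX.
  have : (phi @` (flat d `&` Q)) (phi (u p)).
    exists (u p) => //; split; last exact: uQ.
    move=> j dj; have : (2 <= j)%N := leq_trans d2 dj; move: j {dj}.
    by have [e0 e1 e2 e3] := uE p; apply: row33P.
  by rewrite img => -[].
have uc : continuous u.
  move=> p; apply: row_cvg => j; have [e0 e1 e2 e3] := uE p.
  move: j; apply: row33P; rewrite ?e0 ?e1 ?e2 ?e3.
  - under eq_fun do rewrite (let: And4 h _ _ _ := uE _ in h); exact: cvg_fst.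
  - under eq_fun do rewrite (let: And4 _ h _ _ := uE _ in h); exact: cvg_snd.
  - under eq_fun do rewrite (let: And4 _ _ h _ := uE _ in h); exact: cvg_cst.
  - under eq_fun do rewrite (let: And4 _ _ _ h := uE _ in h 0); exact: cvg_cst.
  - under eq_fun do rewrite (let: And4 _ _ _ h := uE _ in h 1); exact: cvg_cst.
  - under eq_fun do rewrite (let: And4 _ _ _ h := uE _ in h 2); exact: cvg_cst.
have [|p1 [p2 [p3 [n12 n13 n23 [G12 G23] pr]]]] :=
    @square_three_points r (fun p => phi (u p) 0 (ix 1)) r0.
  move=> p p1 p2; have phic := smooth_on_continuous oQ phiC (uQ p p1 p2).
  apply: (@continuous_comp _ _ _ (fun p => phi (u p)) (fun z : 'rV[R]_(3 + 3) =>
    z 0 (ix 1))).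
    exact: continuous_comp (uc p) phic.
  exact: coord_continuous.
have [h11 h12] := pr p1 ltac:(by rewrite !inE eqxx).
have [h21 h22] := pr p2 ltac:(by rewrite !inE eqxx ?orbT).
have [h31 h32] := pr p3 ltac:(by rewrite !inE eqxx ?orbT).
have uinj p q : `|p.1| < r -> `|p.2| < r -> `|q.1| < r -> `|q.2| < r ->
    phi (u p) = phi (u q) -> p = q.
  move=> ? ? ? ? /inj; rewrite !inE => /(_ (uQ _ _ _) (uQ _ _ _)) upq.
  have {}upq : u p = u q by exact: upq.
  have [e0 e1 _ _] := uE p; have [e0' e1' _ _] := uE q.
  by rewrite [p]surjective_pairing [q]surjective_pairing -e0 -e1 -e0' -e1' -/(u p)
    -/(u q) upq.
have [] := zsphere_three (uX _ h11 h12) (uX _ h21 h22) (uX _ h31 h32) G12 G23.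
- by move=> /uinj e; move/eqP: n12; apply; exact: e.
- by move=> /uinj e; move/eqP: n13; apply; exact: e.
- by move=> /uinj e; move/eqP: n23; apply; exact: e.
Qed.

Lemma zsphere_dim : has_dimR X 1.
Proof.
have o2 : (1 : R) ^+ 2 = 1 by rewrite expr1n.
split; last exact: zsphere_dim_le1.
exists (cusp_branch 1); split.
- exact/nash_smooth_submanifold/nash_cusp_branch.
- exists (cusp 1 1 2^-1); apply: cusp_in_branch => //; lra.
- by move=> x /(cusp_branchP o2)[].
Qed.

End Dimension.

(** * No smooth curve passes through a cusp inside the zero set *)

Section NoSmoothCurve.
Context {R : realType}.

Notation X := (zsphere (@pi_poly R)).

(** The curve is the first coordinate line of a chart. It is regular because
    the chart has a smooth inverse, and it exhausts the submanifold near a: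
    the last clause transports statements about small nonzero parameters to
    points of M near a. *)
Lemma submanifold_curve N (M : set 'rV[R]_N) (a : 'rV[R]_N) :
  smooth_submanifold 1 M -> M a -> exists (V : set R) (c : R -> 'rV[R]_N),
  [/\ open V /\ V 0, forall k, Ck k V c, c 0 = a, 'd c 0 1 != 0 &
    forall B : set 'rV[R]_N, (\forall t \near (0 : R)^', B (c t)) ->
      \forall x \near a, M x -> x != a -> B x].
Proof.
case: N M a => [|N] M a [d1 ch] Ma; first by [].
have [Q [Q' [phi [[oQ Q0] [oQ' Q'a] [[_ inj _] phiC [g [gC gK]]] phi0 img]]]] := ch a Ma.
have [U [f [oU U0 fC phif]]] := phiC 0 Q0.
have [W [h [oW Wa hC gh]]] := gC a Q'a.
pose e0 : 'rV[R]_N.+1 := delta_mx 0 0.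
pose T (t : R) : 'rV[R]_N.+1 := t *: e0.
have dT t : is_diff t T T by exact: is_diff_scalel.
have T0 : T 0 = 0 by rewrite /T scale0r.
have f0 : f 0 = a by rewrite -phif.
have oV : open (T @^-1` U).
  by apply: open_comp => // t _; apply: differentiable_continuous; case: (dT t).
exists (T @^-1` U), (f \o T); split=> //.
- by split=> //; rewrite /= T0.
- by move=> k; exact: Ck_comp_affine.
- by rewrite /= T0.
- have [fd _] := fC 1%N; have [hd _] := hC 1%N.
  have UT : U (T 0) by rewrite T0.
  have fT : f (T 0) = a by rewrite T0.
  have dhf : {near T 0, id =1 h \o f}.
    have fc : {for T 0, continuous f} := fC 0%N (T 0) UT.
    have nW : \forall x \near T 0, (W `&` Q') (f x).
      apply: fc; rewrite fT; apply: open_nbhs_nbhs; split; [exact: openI|by []].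
    have nUQ : \forall x \near T 0, (U `&` Q) x.
      by apply: open_nbhs_nbhs; rewrite T0; split; [exact: openI|by []].
    apply: filterS (filterI nW nUQ) => x [[Wx Q'x] [Ux Qx]] /=.
    by rewrite -gh // -phif // gK.
  have [idd ide] := @is_diff_id _ _ (T 0).
  have [_ e1] := near_eq_is_diff dhf idd.
  have dT1 : 'd T 0 1 = e0.
    have [_ e5] := dT 0.
    apply: etrans (congr1 (fun k : R -> 'rV[R]_N.+1 => k 1) e5) _.
    by rewrite /T scale1r.
  have hda : differentiable h (f (T 0)) by rewrite fT; exact: hd.
  have e2 := diff_comp (fd _ UT) hda.
  have dT0 : differentiable T 0 by case: (dT 0).
  have e3 := diff_comp dT0 (fd _ UT).
  have e4 : 'd (f \o T) 0 1 = 'd f (T 0) e0.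
    apply: etrans (congr1 (fun k : R -> 'rV[R]_N.+1 => k 1) e3) _.
    exact: congr1 dT1.
  rewrite e4; apply/eqP => df0.
  have : e0 = 0.
    apply: etrans (esym (congr1 (fun k : 'rV[R]_N.+1 -> 'rV[R]_N.+1 => k e0) ide)) _.
    apply: etrans (esym (congr1 (fun k : 'rV[R]_N.+1 -> 'rV[R]_N.+1 => k e0) e1)) _.
    apply: etrans (congr1 (fun k : 'rV[R]_N.+1 -> 'rV[R]_N.+1 => k e0) e2) _.
    by apply: etrans (congr1 ('d h (f (T 0))) df0) _; rewrite linear0.
  by move/rowP/(_ 0); rewrite !mxE eqxx /= => /eqP; rewrite oner_eq0.
- move=> B nB.
  have gc : {for a, continuous g} := smooth_on_continuous oQ' gC Q'a.
  have g0 : g a = 0 by rewrite -phi0 gK.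
  have nU : \forall x \near a, U (g x).
    have : nbhs (g a) U by rewrite g0; exact: open_nbhs_nbhs.
    by move=> /gc.
  have nB' : \forall x \near a, g x 0 0 != 0 -> B (f (T (g x 0 0))).
    have c0 : (fun x : 'rV[R]_N.+1 => g x 0 0) @ a --> (0 : R).
      suff : (fun x : 'rV[R]_N.+1 => g x 0 0) @ a --> g a 0 0 by rewrite g0 mxE.
      exact: (@continuous_comp _ _ _ g (fun z : 'rV[R]_N.+1 => z 0 0) a gc
        (@coord_continuous _ _ _ _ _ _)).
    have : \forall t \near (0 : R), t != 0 -> B (f (T t)) by [].
    by move=> /c0.
  have nQ' : nbhs a Q' by exact: open_nbhs_nbhs.
  apply: filterS (filterI nU (filterI nB' nQ')) => x [Ux [Bx Q'x]] Mx xa.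
  have : (phi @` (flat 1 `&` Q)) x by rewrite img.
  move=> [v [vf Qv] vx]; have gx : g x = v by rewrite -vx gK.
  have vT : v = T (v 0 0).
    apply/rowP => j; rewrite !mxE eqxx /=; have [->|j0] := eqVneq j 0.
      by rewrite mulr1.
    by rewrite mulr0; apply: vf; rewrite lt0n.
  have : g x 0 0 != 0.
    apply/eqP => v0; move/eqP: xa; apply; rewrite -vx vT -gx v0 T0.
    exact: phi0.
  move/Bx; rewrite gx -vT -phif ?vx //; last by rewrite -gx.
Qed.

Lemma nbhs0_scale (f : R -> R) (d e : R) : f 0 = 0 ->
  is_derive (0 : R) (1 : R) f d -> 0 < e ->
  \forall t \near (0 : R), `|f t - d * t| <= e * `|t|.
Proof.
move=> f0 [/derivable1_diffP fd fE] e0.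
have /eqaddoP/(_ e e0) := diff_locally fd.
have dE t : 'd f 0 t = t * d.
  have := congr1 (fun k : R -> R => k t) (diff1E fd).
  by rewrite /= derive1E fE.
apply: filterS => t /=; rewrite !fctE /= addr0 f0 /cst dE.
by rewrite add0r [t * d]mulrC.
Qed.

(** The derivative is itself differentiable at 0, so it is O(t), and the mean
    value theorem integrates this bound. *)
Lemma C2_quadratic (V : set R) (f : R -> R) : open V -> V 0 ->
  (forall k, Ck k V f) -> f 0 = 0 -> is_derive (0 : R) (1 : R) f 0 ->
  exists2 K, 0 < K & \forall t \near (0 : R), `|f t| <= K * t ^+ 2.
Proof.
move=> oV V0 fC f0 df0.
have [fd fd2] := fC 2%N; have [fdd _] := fd2 1.
pose f1 t := 'd f t 1.
have f1E t : V t -> is_derive t (1 : R) f (f1 t).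
  by move=> Vt; apply: DeriveDef; [exact/derivable1_diffP/fd|rewrite deriveE//; exact: fd].
have f10 : f1 0 = 0.
  have e1 := @derive_val _ _ _ _ _ _ _ df0.
  have e2 := @derive_val _ _ _ _ _ _ _ (f1E 0 V0).
  by rewrite -e2 e1.
have f1d : is_derive (0 : R) (1 : R) f1 ('D_1 f1 0).
  by apply: DeriveDef => //; apply/derivable1_diffP/fdd.
set D := 'D_1 f1 0 in f1d; exists (`|D| + 1); first by rewrite ltr_pwDr.
have := nbhs0_scale f10 f1d ltr01; move=> /nbhs_ballP[r /= r0 rP].
have /nbhs_ballP[s /= s0 sP] := open_nbhs_nbhs (conj oV V0).
have m0 : 0 < Num.min r s by rewrite lt_min r0.
have f1B t : `|t| < Num.min r s -> `|f1 t| <= (`|D| + 1) * `|t|.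
  rewrite lt_min => /andP[tr _].
  have : `|f1 t - D * t| <= 1 * `|t| by apply: rP; rewrite /ball /= sub0r normrN.
  have := ler_normD (f1 t - D * t) (D * t); rewrite subrK normrM; lra.
apply/nbhs_ballP; exists (Num.min r s) => //= t; rewrite /ball /= sub0r normrN => tm.
have VI u : `|u| <= `|t| -> V u.
  move=> ut; apply: sP; rewrite /ball /= sub0r normrN.
  by apply: le_lt_trans ut _; move: tm; rewrite lt_min => /andP[].
have bd (u : R) : `|u| <= `|t| -> `|f1 u * t| <= (`|D| + 1) * t ^+ 2.
  move=> ut; rewrite normrM -[t ^+ 2]real_normK ?num_real // expr2 mulrA ler_wpM2r //.
  apply: le_trans (f1B _ (le_lt_trans ut tm)) _.
  by rewrite ler_wpM2l // addr_ge0.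
have seg (x y : R) : x <= y -> (forall u, x <= u <= y -> `|u| <= `|t|) ->
    exists2 u, `|u| <= `|t| & f y - f x = f1 u * (y - x).
  move=> xy xyt; have [||u uI e] := @MVT_segment R f f1 x y xy.
  - by move=> u uI; apply/f1E/VI/xyt; rewrite !ltW ?(itvP uI).
  - apply: continuous_in_subspaceT => u; rewrite inE /= in_itv /= => uI.
    exact/differentiable_continuous/fd/VI/xyt.
  - by exists u => //; apply: xyt; rewrite !(itvP uI).
have [t0|t0] := leP 0 t.
  have [||u ut] := seg 0 t; first by [].
    by move=> u /andP[u0 ut]; rewrite !ger0_norm.
  by rewrite f0 !subr0 => ->; exact: bd.
have [||u ut] := seg t 0; first exact: ltW.
  by move=> u /andP[u0 ut]; rewrite ler0_norm ?(ltr0_norm t0) // lerN2.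
by rewrite f0 !sub0r mulrN => /oppr_inj ->; exact: bd.
Qed.

Lemma near0_neq0 (f : R -> R) (d : R) : f 0 = 0 ->
  is_derive (0 : R) (1 : R) f d -> d != 0 -> \forall t \near (0 : R)^', f t != 0.
Proof.
move=> f0 fd dn0; have d0 : 0 < `|d| / 2 by rewrite divr_gt0 ?normr_gt0.
have := nbhs0_scale f0 fd d0.
apply: filterS => t ht tn0; apply/eqP => ft; move: ht.
rewrite ft sub0r normrN normrM; have : 0 < `|d| * `|t| by rewrite mulr_gt0 ?normr_gt0.
lra.
Qed.

(** Comparison of orders in g^2 = f^3 for f ~ p t and g ~ q t. If q is nonzero
    then g^2 has order 2 against at least 3; if q = 0 and p is nonzero then
    f^3 has order 3 while g^2 has order at least 4. The second-order bound on
    g serves the second case. *)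
Lemma cusp_no_regular_curve (V : set R) (f g : R -> R) (p q : R) :
  open V -> V 0 -> (forall k, Ck k V g) -> f 0 = 0 -> g 0 = 0 ->
  is_derive (0 : R) (1 : R) f p -> is_derive (0 : R) (1 : R) g q ->
  (p != 0) || (q != 0) -> \forall t \near (0 : R)^', g t ^+ 2 != f t ^+ 3.
Proof.
move=> oV V0 gC f0 g0 fp gq pq.
have nt (e : R) : 0 < e -> \forall t \near (0 : R), `|t| < e.
  by move=> e0; apply/nbhs_ballP; exists e => //= t; rewrite /ball /= sub0r normrN.
have [q0|qn0] := eqVneq q 0.
  have pn0 : p != 0 by move: pq; rewrite q0 eqxx orbF.
  rewrite q0 in gq; have [K K0 gK] := C2_quadratic oV V0 gC g0 gq.
  have p0 : 0 < `|p| / 2 by rewrite divr_gt0 ?normr_gt0.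
  have fB := nbhs0_scale f0 fp p0.
  set m := `|p| / 2 in p0 fB.
  have e0 : 0 < m ^+ 3 / K ^+ 2 by rewrite divr_gt0 // exprn_gt0.
  apply: filterS (filterI gK (filterI fB (nt _ e0))) => t [ht [fBt te]] tn0.
  apply/eqP => /(congr1 Num.norm); rewrite !normrX => E.
  have t0 : 0 < `|t| by rewrite normr_gt0.
  have h1 : m * `|t| <= `|f t|.
    have := ler_normD (p * t - f t) (f t).
    by rewrite subrK distrC normrM (_ : `|p| = 2 * m); [lra|rewrite /m; field].
  have h2 : (m * `|t|) ^+ 3 <= `|f t| ^+ 3.
    by apply: lerXn2r; rewrite ?nnegrE // mulr_ge0 // ltW.
  have h3 : `|g t| ^+ 2 <= (K * t ^+ 2) ^+ 2.
    by apply: lerXn2r; rewrite ?nnegrE // mulr_ge0 ?sqr_ge0 // ltW.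
  have h4 : m ^+ 3 * `|t| ^+ 3 <= K ^+ 2 * `|t| ^+ 4.
    rewrite -exprMn; apply: le_trans h2 _; rewrite -E; apply: le_trans h3 _.
    by rewrite exprMn -[t ^+ 2]real_normK ?num_real // -exprM.
  move: te; rewrite ltr_pdivlMr ?exprn_gt0 //.
  have t3 : 0 < `|t| ^+ 3 by rewrite exprn_gt0.
  rewrite -(ltr_pM2r t3) => te; move: h4; rewrite leNgt => /negP; apply.
  by apply: le_lt_trans te; rewrite [`|t| ^+ 4]exprS mulrCA mulrA.
have q0 : 0 < `|q| / 2 by rewrite divr_gt0 ?normr_gt0.
have gB := nbhs0_scale g0 gq q0.
have fB := nbhs0_scale f0 fp ltr01.
set m := `|q| / 2 in q0 gB; set K := `|p| + 1.
have K0 : 0 < K by rewrite ltr_pwDr.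
have e0 : 0 < m ^+ 2 / K ^+ 3 by rewrite divr_gt0 // exprn_gt0.
apply: filterS (filterI gB (filterI fB (nt _ e0))) => t [gBt [fBt te]] tn0.
apply/eqP => /(congr1 Num.norm); rewrite !normrX => E.
have t0 : 0 < `|t| by rewrite normr_gt0.
have h1 : m * `|t| <= `|g t|.
  have := ler_normD (q * t - g t) (g t).
  by rewrite subrK distrC normrM (_ : `|q| = 2 * m); [lra|rewrite /m; field].
have h1' : `|f t| <= K * `|t|.
  have := ler_normD (f t - p * t) (p * t); rewrite subrK normrM /K; lra.
have h2 : (m * `|t|) ^+ 2 <= `|g t| ^+ 2.
  by apply: lerXn2r; rewrite ?nnegrE // mulr_ge0 // ltW.
have h3 : `|f t| ^+ 3 <= (K * `|t|) ^+ 3.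
  by apply: lerXn2r; rewrite ?nnegrE // mulr_ge0 // ltW.
have h4 : m ^+ 2 * `|t| ^+ 2 <= K ^+ 3 * `|t| ^+ 3.
  by rewrite -!exprMn; apply: le_trans h2 _; rewrite E.
move: te; rewrite ltr_pdivlMr ?exprn_gt0 //.
have t3 : 0 < `|t| ^+ 2 by rewrite exprn_gt0.
rewrite -(ltr_pM2r t3) => te; move: h4; rewrite leNgt => /negP; apply.
by apply: le_lt_trans te; rewrite [`|t| ^+ 3]exprS mulrCA mulrA.
Qed.

(** Along a regular curve through the pole, one of the defining functions of
    the zero set is nonzero at all small nonzero parameters: an imaginary
    part, x_1^2 + x_2^2 + x_3^2 - 1, or x_2^2 - x_1^3, according to which
    coordinate of the velocity is nonzero. *)
Lemma pole_not_accumulation (tau : R) (M : set 'rV[R]_(3 + 3)) : tau ^+ 2 = 1 ->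
  smooth_submanifold 1 M -> M (embed3 0 0 tau) ->
  \forall x \near embed3 0 0 tau, M x -> X x -> x = embed3 0 0 tau.
Proof.
move=> tau2 sM Ma; set a := embed3 0 0 tau.
have [V [c [[oV V0] cC c0 dc cB]]] := submanifold_curve sM Ma.
have [e0 e1 e2 e3] := embed3E 0 0 tau; rewrite -c0 in e0 e1 e2 e3.
have cd : differentiable c 0 by have [+ _] := cC 1%N; exact.
have der j : is_derive (0 : R) (1 : R) (fun t => c t 0 j) ('d c 0 1 0 j).
  have [d1 d2] := coord_is_diff j cd.
  apply: DeriveDef; first exact/derivable1_diffP.
  by rewrite deriveE //; exact: (congr1 (fun k : R -> R => k 1) d2).
suff nX : \forall t \near (0 : R)^', ~ X (c t).
  have := cB (fun x => ~ X x) nX; apply: filterS => x H Mx Xx.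
  by apply/eqP/negPn/negP => /(H Mx).
have cjC j k : Ck k V (fun t => c t 0 j) by exact: Ck_row_coord.
have [p2|] := boolP (('d c 0 1 0 (ix 0) != 0) || ('d c 0 1 0 (ix 1) != 0)).
  have := cusp_no_regular_curve oV V0 (cjC (ix 1)) e0 e1 (der _) (der _) p2.
  by apply: filterS => t /eqP h /zsphere_piP[_ _]; exact: h.
rewrite negb_or !negbK => /andP[/eqP p0 /eqP p1].
have [p2|p2] := eqVneq ('d c 0 1 0 (ix 2)) 0; last first.
  pose h t := c t 0 (ix 0) * c t 0 (ix 0) + c t 0 (ix 1) * c t 0 (ix 1) +
    c t 0 (ix 2) * c t 0 (ix 2) - 1.
  have h0 : h 0 = 0 by rewrite /h e0 e1 e2 !mul0r -expr2 tau2; lra.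
  have hd : is_derive (0 : R) (1 : R) h (2 * tau * 'd c 0 1 0 (ix 2)).
    have D j := is_deriveM (der j) (der j).
    have := is_deriveB (is_deriveD (is_deriveD (D (ix 0)) (D (ix 1))) (D (ix 2)))
      (is_derive_cst (1 : R) (0 : R) (1 : R)).
    move=> H; apply: (is_derive_eq H).
    by rewrite /GRing.scale /= e0 e1 e2; ring.
  have tn0 : 2 * tau * 'd c 0 1 0 (ix 2) != 0.
    rewrite !mulf_neq0 //; apply/eqP => t0; move: tau2.
    by rewrite t0 expr0n /= => /eqP; rewrite eq_sym oner_eq0.
  have := near0_neq0 h0 hd tn0; apply: filterS => t /eqP hn /zsphere_piP[_ n1 _].
  by apply: hn; rewrite /h -!expr2 n1 subrr.
have [j pj] : exists j, 'd c 0 1 0 (iy j) != 0.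
  apply/existsP; apply: contraNT dc; rewrite negb_exists => /forallP H.
  apply/eqP/rowP; apply: row33P; rewrite mxE ?p0 ?p1 ?p2 //;
    by apply/eqP; rewrite -[_ == _]negbK; exact: H.
have := near0_neq0 (e3 j) (der _) pj; apply: filterS => t /eqP hn.
by move=> /zsphere_piP[y0 _ _]; apply: hn.
Qed.

End NoSmoothCurve.

(** * Square roots of polynomials are real analytic *)

Section SqrtAnalytic.
Context {R : realType}.

Lemma cauchy_product_le (a b : nat -> R) (N : nat) :
  (forall k, 0 <= a k) -> (forall k, 0 <= b k) ->
  \sum_(0 <= k < N) \sum_(0 <= j < k.+1) a j * b (k - j)%N <=
  (\sum_(0 <= j < N) a j) * (\sum_(0 <= j < N) b j).
Proof.
move=> a0 b0.
have -> : \sum_(0 <= k < N) \sum_(0 <= j < k.+1) a j * b (k - j)%N =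
    \sum_(0 <= k < N) \sum_(0 <= j < N | (j <= k)%N) a j * b (k - j)%N.
  apply: eq_big_nat => k /andP[_ kN].
  by rewrite (big_nat_widen _ _ N) //; apply: eq_bigl => j; rewrite ltnS.
rewrite (exchange_big_dep_nat xpredT) //= mulr_suml; apply: ler_sum => j _.
have -> : \sum_(0 <= k < N | (j <= k)%N) a j * b (k - j)%N =
    a j * \sum_(0 <= i < N - j) b i.
  rewrite -(@big_nat_widenl _ _ _ j 0 N xpredT) //.
  rewrite (@big_addn _ _ _ 0 N j xpredT) mulr_sumr.
  by apply: eq_bigr => i _; rewrite addnK.
rewrite ler_wpM2l //.
rewrite [leRHS](big_cat_nat (n := (N - j)%N)) ?leq_subr //= lerDl.
by apply: sumr_ge0 => i _.
Qed.

(** The recursion determines y n because the terms y 0 y n and y n y 0 of the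
    convolution vanish. If 1 - z is a power series with constant term 1, then
    1 - y is its formal square root: (1 - y)^2 = 1 - 2 y + y^2 = 1 - z. *)
Lemma formal_quadratic_root (z : nat -> R) : exists y : nat -> R, y 0 = 0 /\
  forall n, (0 < n)%N -> 2 * y n = z n + \sum_(0 <= j < n.+1) y j * y (n - j)%N.
Proof.
pose val n (s : seq R) := if n is 0 then 0 else
  (z n + \sum_(0 <= j < n) s`_j * s`_(n - j)%N) / 2.
(* ys n lists y 0, ..., y (n - 1). *)
pose fix ys n := if n is m.+1 then rcons (ys m) (val m (ys m)) else [::].
have sz n : size (ys n) = n by elim: n => //= n IH; rewrite size_rcons IH.
pose y n := (ys n.+1)`_n.
have yE n m : (n < m)%N -> (ys m)`_n = y n.
  elim: m => // m IH; rewrite ltnS leq_eqVlt => /orP[/eqP <-//|nm] /=.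
  by rewrite nth_rcons sz nm IH.
have y0 : y 0 = 0 by [].
exists y; split => // n n0; rewrite big_nat_recr //= subnn y0 mulr0 addr0.
have -> : y n = val n (ys n) by rewrite /y /= nth_rcons sz ltnn eqxx.
case: n n0 => // n _; rewrite /val mulrC divfK //; congr (_ + _).
apply: eq_big_nat => j /andP[_ jn]; rewrite (yE _ _ jn).
case: j jn => [|j] jn; first by rewrite y0 !mul0r.
by rewrite yE // ltn_subrL.
Qed.

Section Majorant.
Variables (z y : nat -> R) (r : R).
Hypothesis r0 : 0 < r.
Hypothesis z_le1 : forall N, \sum_(0 <= k < N) `|z k| * r ^+ k <= 1.
Hypothesis y0 : y 0 = 0.
Hypothesis yE : forall n, (0 < n)%N ->
  2 * y n = z n + \sum_(0 <= j < n.+1) y j * y (n - j)%N.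

(** If S bounds the partial sum of index < n, then (1 + S^2) / 2 bounds the
    next one, because y 0 = 0 keeps y n itself out of the convolution; so the
    bound 1 propagates. *)
Lemma quadratic_root_le1 N : \sum_(0 <= k < N) `|y k| * r ^+ k <= 1.
Proof.
elim: N => [|n IH]; first by rewrite big_geq.
set S := \sum_(0 <= k < n) _ in IH.
have S0 : 0 <= S by apply: sumr_ge0 => k _; rewrite mulr_ge0 // exprn_ge0 // ltW.
pose a k := if (k < n)%N then `|y k| * r ^+ k else 0.
have a0 k : 0 <= a k.
  by rewrite /a; case: ifP => // _; rewrite mulr_ge0 // exprn_ge0 // ltW.
have Sa : \sum_(0 <= j < n.+1) a j = S.
  rewrite big_nat_recr //= {2}/a ltnn addr0.
  by apply: eq_big_nat => k /andP[_ kn]; rewrite /a kn.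
have step k : (k < n.+1)%N ->
    2 * (`|y k| * r ^+ k) <= `|z k| * r ^+ k + \sum_(0 <= j < k.+1) a j * a (k - j)%N.
  move=> kn; have rk : 0 <= r ^+ k by rewrite exprn_ge0 // ltW.
  case: (posnP k) => [->|k0].
    by rewrite y0 normr0 mul0r mulr0 addr_ge0 ?mulr_ge0 ?sumr_ge0 // => j _;
      rewrite mulr_ge0.
  have -> : 2 * (`|y k| * r ^+ k) = `|2 * y k| * r ^+ k.
    by rewrite normrM ger0_norm // mulrA.
  rewrite yE //; apply: le_trans (ler_wpM2r rk (ler_normD _ _)) _.
  rewrite mulrDl lerD2l; apply: le_trans (ler_wpM2r rk (ler_norm_sum _ _ _)) _.
  rewrite mulr_suml; apply: ler_sum_nat => j /andP[_ jk].
  rewrite normrM.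
  have [j0|j0] := posnP j; first by rewrite j0 y0 normr0 !mul0r mulr_ge0.
  have [kj|kj] := posnP (k - j)%N.
    by rewrite kj y0 normr0 mulr0 mul0r mulr_ge0.
  have jk' : (j < n)%N by lia.
  have kj' : (k - j < n)%N by lia.
  rewrite /a jk' kj' mulrACA -exprD subnKC //; lia.
have H : 2 * \sum_(0 <= k < n.+1) `|y k| * r ^+ k <= 1 + S * S.
  rewrite mulr_sumr; apply: le_trans (_ : _ <= \sum_(0 <= k < n.+1)
    (`|z k| * r ^+ k + \sum_(0 <= j < k.+1) a j * a (k - j)%N)) _.
    by apply: ler_sum_nat => k /andP[_ kn]; exact: step.
  by rewrite big_split /=; apply: lerD (z_le1 _) _; rewrite -Sa; exact: cauchy_product_le.
have : S * S <= 1 by rewrite mulr_ile1.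
lra.
Qed.

(** The square of the partial sum 1 - Y n differs from 1 - z by a polynomial
    of valuation at least n, whose coefficients weighted by r ^ k have sum at
    most 1; at h it is at most (|h| / r) ^ n. Since |Y n| <= 1, taking square
    roots is continuous and yields the limit. *)
Lemma sqrt_series_cvg (h zh : R) : `|h| < r -> zh <= 1 ->
  (exists m, forall n, (m <= n)%N -> \sum_(0 <= k < n) z k * h ^+ k = zh) ->
  z 0 = 0 ->
  (fun n : nat => \sum_(0 <= k < n) ((k == 0)%:R - y k) * h ^+ k) @ \oo -->
    Num.sqrt (1 - zh).
Proof.
move=> hr zh1 [m zm] z0.
pose Y n := \sum_(0 <= k < n) y k * h ^+ k.
pose q := `|h| / r.
have q0 : 0 <= q by rewrite divr_ge0 // ltW.
have q1 : q < 1 by rewrite ltr_pdivrMr // mul1r.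
have qk k : `|h| ^+ k = q ^+ k * r ^+ k.
  by rewrite -exprMn /q divfK // gt_eqF.
have hk k : `|h ^+ k| <= r ^+ k.
  by rewrite normrX lerXn2r ?nnegrE // ltW.
have Y1 n : `|Y n| <= 1.
  apply: le_trans (quadratic_root_le1 n); apply: le_trans (ler_norm_sum _ _ _) _.
  by apply: ler_sum => k _; rewrite normrM ler_wpM2l.
have E n : (m <= n)%N -> `|(1 - Y n) ^+ 2 - (1 - zh)| <= q ^+ n * 1.
  move=> mn.
  (* C k are the coefficients of Y n squared. *)
  pose yn k := if (k < n)%N then y k else 0.
  pose C k := \sum_(0 <= j < k.+1) yn j * yn (k - j)%N.
  have YY : Y n ^+ 2 = \sum_(0 <= k < n + n) C k * h ^+ k.
    pose P := \poly_(k < n) y k.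
    have PE : P.[h] = Y n by rewrite horner_poly /Y big_mkord.
    have sP : (size (P ^+ 2) <= n + n)%N.
      rewrite expr2; apply: leq_trans (size_polyMleq _ _) _.
      have := size_poly n y; rewrite -/P; lia.
    rewrite -PE -horner_exp (horner_coef_wide _ sP) big_mkord.
    apply: eq_bigr => k _; congr (_ * _); rewrite expr2 coefM /C big_mkord.
    by apply: eq_bigr => j _; rewrite !coef_poly.
  have CE k : (0 < k < n)%N -> C k = 2 * y k - z k.
    move=> /andP[k0 kn]; rewrite yE // addrC addKr /C; apply: eq_big_nat => j /andP[_ jk].
    have j1 : (j < n)%N by lia.
    have j2 : (k - j < n)%N by lia.
    by rewrite /yn j1 j2.
  have C0 : (0 < n)%N -> C 0 = 0 by move=> n0; rewrite /C big_nat1 /yn n0 y0 mul0r.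
  have -> : (1 - Y n) ^+ 2 - (1 - zh) = \sum_(n <= k < n + n) C k * h ^+ k.
    have -> : (1 - Y n) ^+ 2 - (1 - zh) = zh - 2 * Y n + Y n ^+ 2 by ring.
    rewrite YY (big_cat_nat (n := n)) ?leq_addr //= addrA -[RHS]add0r; congr (_ + _).
    rewrite -(zm n mn) /Y mulr_sumr -sumrB -big_split /=.
    rewrite big_nat_cond big1 // => k; rewrite andbT => /andP[_ kn].
    have [->|k0] := posnP k; first by rewrite z0 y0 C0 ?(leq_ltn_trans _ kn) //
      !mul0r mulr0 subrr addr0.
    by rewrite CE ?k0 //; ring.
  apply: le_trans (ler_norm_sum _ _ _) _.
  pose a k := `|yn k| * r ^+ k.
  have a0 k : 0 <= a k by rewrite mulr_ge0 // exprn_ge0 // ltW.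
  have aC k : `|C k| * r ^+ k <= \sum_(0 <= j < k.+1) a j * a (k - j)%N.
    apply: le_trans (ler_wpM2r _ (ler_norm_sum _ _ _)) _; first by rewrite exprn_ge0 // ltW.
    rewrite mulr_suml; apply: ler_sum_nat => j /andP[_ jk].
    by rewrite normrM /a mulrACA -exprD subnKC.
  apply: le_trans (_ : _ <= \sum_(n <= k < n + n) q ^+ n * (`|C k| * r ^+ k)) _.
    apply: ler_sum_nat => k /andP[nk _]; rewrite normrM normrX qk mulrCA.
    rewrite ler_wpM2r ?mulr_ge0 ?exprn_ge0 ?(ltW r0) //.
    by apply: ler_wiXn2l => //; exact: ltW.
  rewrite -mulr_sumr ler_wpM2l ?exprn_ge0 //.
  apply: le_trans (_ : _ <= \sum_(0 <= k < n + n) \sum_(0 <= j < k.+1) a j * a (k - j)%N) _.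
    rewrite [leRHS](big_cat_nat (n := n)) ?leq_addr //=.
    apply: le_trans (_ : _ <= \sum_(n <= k < n + n) \sum_(0 <= j < k.+1) a j * a (k -
      j)%N) _.
      by apply: ler_sum => k _; exact: aC.
    by rewrite lerDr; apply: sumr_ge0 => k _; apply: sumr_ge0 => j _; rewrite mulr_ge0.
  apply: le_trans (cauchy_product_le _ a0 a0) _.
  have A1 : \sum_(0 <= j < n + n) a j <= 1.
    have tail : \sum_(n <= k < n + n) a k = 0.
      rewrite big_nat_cond big1 // => k; rewrite andbT => /andP[nk _].
      by rewrite /a /yn ltnNge nk normr0 mul0r.
    rewrite (big_cat_nat (n := n)) ?leq_addr //= tail addr0.
    apply: le_trans (quadratic_root_le1 n); apply: ler_sum_nat => k /andP[_ kn].
    by rewrite /a /yn kn.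
  by rewrite mulr_ile1 // sumr_ge0.
have sq : (fun n => (1 - Y n) ^+ 2) @ \oo --> 1 - zh.
  apply/cvgrPdist_le => e e0.
  have q1' : `|q| < 1 by rewrite ger0_norm.
  have /cvgrPdist_le/(_ e e0) := cvg_expr q1'.
  move=> H; apply: filterS2 (nbhs_infty_ge m) H => n /= mn qe; rewrite distrC;
    apply: le_trans (E n mn) _.
  by rewrite mulr1; move: qe; rewrite sub0r normrN ger0_norm // exprn_ge0.
have := cvg_comp _ _ sq (@sqrt_continuous R (1 - zh)).
apply: cvg_trans; apply: near_eq_cvg; near=> n => /=.
have n0 : (0 < n)%N by near: n; exact: nbhs_infty_gt.
rewrite sqrtr_sqr ger0_norm; last by have := Y1 n; rewrite ler_norml; lra.
under eq_bigr do rewrite mulrBl.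
rewrite sumrB /Y; congr (_ - _).
rewrite big_ltn // expr0 mulr1 big_nat_cond big1 ?addr0 // => k.
by rewrite andbT => /andP[k0 _]; rewrite gtn_eqF // mul0r.
Unshelve. all: by end_near. Qed.

End Majorant.

Lemma poly_taylor_series (P : {poly R}) (t0 : R) : exists c : nat -> R,
  exists m, forall n, (m <= n)%N ->
  forall t, \sum_(0 <= k < n) c k * (t - t0) ^+ k = P.[t].
Proof.
exists (fun k => (P \Po ('X + t0%:P))`_k), (size (P \Po ('X + t0%:P))) => n mn t.
rewrite big_mkord -(horner_coef_wide _ mn) horner_comp !hornerE.
by congr (P.[_]); ring.
Qed.

(** Up to the factor P.[t0] the Taylor expansion of P at t0 has the form 1 -
    z, and the weighted norm of z is at most 1 for a small radius. *)
Lemma sqrt_poly_series (P : {poly R}) (t0 : R) : 0 < P.[t0] ->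
  (exists r, 0 < r /\ forall t, `|t - t0| < r -> 0 <= P.[t]) ->
  exists (c : nat -> R) (r : R), 0 < r /\ forall t, `|t - t0| < r ->
    (fun n : nat => \sum_(0 <= k < n) c k * (t - t0) ^+ k) @ \oo --> Num.sqrt P.[t].
Proof.
move=> p0 [r1 [r10 Pr]]; have [c [m cm]] := poly_taylor_series P t0.
set p := P.[t0] in p0.
have pn0 : p != 0 by rewrite gt_eqF.
have c0 : c 0%N = p.
  have := cm m.+1 (leqnSn _) t0; rewrite subrr big_nat_recl //= expr0 mulr1 big1 ?addr0 //.
  by move=> k _; rewrite expr0n mulr0.
pose z k := if k is 0 then 0 else - (c k / p).
have [y [y0 yE]] := formal_quadratic_root z.
pose A := \sum_(0 <= k < m) `|z k|.
have A0 : 0 <= A by apply: sumr_ge0.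
have cm0 k : (m <= k)%N -> c k = 0.
  move=> mk; have H t : c k * (t - t0) ^+ k = 0.
    have := cm k.+1 (leqW mk) t; rewrite big_nat_recr //= cm // => /eqP.
    by rewrite -subr_eq0 addrAC subrr add0r => /eqP.
  by have := H (t0 + 1); rewrite addrAC subrr add0r expr1n mulr1.
have zm0 k : (m <= k)%N -> z k = 0.
  by case: k => // k /cm0 ck; rewrite /z ck mul0r oppr0.
(* As r <= 1, the weighted sum is at most r A. *)
pose r := (1 + A)^-1.
have r0 : 0 < r by rewrite invr_gt0; lra.
have r1' : r <= 1 by rewrite invf_le1; lra.
have zN N : \sum_(0 <= k < N) `|z k| * r ^+ k <= 1.
  apply: le_trans (_ : _ <= \sum_(0 <= k < N) `|z k| * r) _.
    apply: ler_sum => -[|k] _; first by rewrite /= normr0 !mul0r.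
    by rewrite ler_wpM2l // exprS ger_pMr // exprn_ile1 // ltW.
  rewrite -mulr_suml; have NA : \sum_(0 <= k < N) `|z k| <= A.
    have [Nm|mN] := leqP N m.
      by rewrite /A [leRHS](big_cat_nat (n := N)) //= lerDl sumr_ge0.
    rewrite (big_cat_nat (n := m)) //=; last exact: ltnW.
    have -> : \sum_(m <= k < N) `|z k| = 0; last by rewrite addr0.
    rewrite big_nat_cond big1 // => k.
    by rewrite andbT => /andP[mk _]; rewrite zm0 // normr0.
  by rewrite /r ler_pdivrMr ?mul1r; lra.
exists (fun k => Num.sqrt p * ((k == 0%N)%:R - y k)), (Num.min r r1); split.
  by rewrite lt_min r0.
move=> t; rewrite lt_min => /andP[tr tr1].
have PE : P.[t] = p * (1 - (1 - P.[t] / p)) by rewrite subKr mulrC divfK.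
rewrite PE sqrtrM ?ltW //.
suff H : (fun n : nat => \sum_(0 <= k < n) ((k == 0)%:R - y k) * (t - t0) ^+ k)
    @ \oo --> Num.sqrt (1 - (1 - P.[t] / p)).
  rewrite (_ : (fun n : nat => _) = (fun n : nat => Num.sqrt p *
      \sum_(0 <= k < n) ((k == 0)%:R - y k) * (t - t0) ^+ k)).
    exact: (cvgM (cvg_cst _) H).
  apply/funext => n; rewrite mulr_sumr; apply: eq_bigr => k _; exact/esym/mulrA.
apply: (@sqrt_series_cvg z y r) => //.
  by rewrite gerBl; apply: divr_ge0; [exact: Pr|exact: ltW].
exists m.+1 => n mn; rewrite -(cm n (ltnW mn)).
have n0 : (0 < n)%N by exact: leq_ltn_trans mn.
rewrite !(big_ltn n0) /= c0 mul0r add0r expr0 mulr1 mulrDl divff // opprD addNKr.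
rewrite mulr_suml -sumrN; apply: eq_big_nat => -[|k] // _ /=.
by rewrite mulNr mulrAC.
Qed.

End SqrtAnalytic.

(** * Germs of semi-algebraic sets along the cusp *)

Section Germs.
Context {R : realType}.

Notation X := (zsphere (@pi_poly R)).

(** A set of parameters whose germ at 0+ is empty or full; semi-algebraic
    conditions along the cusp have this property, which is a Boolean one. *)
Definition decided (P : R -> Prop) : Prop :=
  (\forall t \near (0 : R)^'+, P t) \/ (\forall t \near (0 : R)^'+, ~ P t).

Lemma decidedI (P Q : R -> Prop) :
  decided P -> decided Q -> decided (fun t => P t /\ Q t).
Proof.
move=> [hP|hP] [hQ|hQ]; [left|right|right|right].
- by apply: filterS2 hP hQ.
- by apply: filterS hQ => t h [].
- by apply: filterS hP => t h [].
- by apply: filterS hP => t h [].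
Qed.

Lemma decidedC (P : R -> Prop) : decided P -> decided (fun t => ~ P t).
Proof. by move=> [h|h]; [right|left] => //; apply: filterS h => t ? /(_ _). Qed.

Lemma decided_ext (P Q : R -> Prop) : (\forall t \near (0 : R)^'+, P t <-> Q t) ->
  decided P -> decided Q.
Proof.
by move=> PQ [h|h]; [left|right]; apply: filterS2 PQ h => t e h; [exact/e|move/e].
Qed.

Lemma decidedU (P Q : R -> Prop) :
  decided P -> decided Q -> decided (fun t => P t \/ Q t).
Proof.
move=> dP dQ; have := decidedC (decidedI (decidedC dP) (decidedC dQ)).
apply: decided_ext; near=> t; split; last by move=> [p|q] [].
by move=> /not_andP[] /contrapT ?; [left|right].
Unshelve. all: by end_near. Qed.

(** Near 0 the sign of a polynomial is that of its lowest-order term. *)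
Lemma decided_poly (p : {poly R}) : decided (fun t => 0 < p.[t]).
Proof.
have [->|pn0] := eqVneq p 0.
  by right; near=> t; rewrite horner0 ltxx.
have [m [q /implyP/(_ pn0) q0 ->]] := multiplicity_XsubC p 0.
have tE t : (q * ('X - 0%:P) ^+ m).[t] = q.[t] * t ^+ m.
  by rewrite subr0 hornerM hornerXn.
have tm : \forall t \near (0 : R)^'+, 0 < t ^+ m.
  by near=> t; apply: exprn_gt0.
have qc := @continuous_horner R q 0.
have [q0'|q0'] := ltP 0 q.[0].
  have H : \forall t \near (0 : R)^'+, 0 < q.[t].
    by apply: cvg_within; exact: (cvgr_gt _ qc _ q0').
  left.
  by apply: filterS2 tm H => t tm qt; rewrite tE mulr_gt0.
have {}q0' : q.[0] < 0 by rewrite lt_neqAle q0' andbT.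
have H : \forall t \near (0 : R)^'+, q.[t] < 0.
  by apply: cvg_within; exact: (cvgr_lt _ qc _ q0').
by right; apply: filterS2 tm H => t tm qt; rewrite tE nmulr_rgt0 // ltNge ltW.
Unshelve. all: by end_near. Qed.

(** The sign of a + b s with s = sqrt q is decided by those of a, b and a^2 -
    b^2 q = (a + b s) (a - b s). *)
Lemma sign_add_sqrt (a b s q : R) : 0 < s -> s ^+ 2 = q -> 0 < a + b * s <->
  [\/ 0 < a /\ ~ 0 < - b, ~ 0 < - a /\ 0 < b, 0 < a /\ 0 < a ^+ 2 - b ^+ 2 * q |
      0 < b /\ 0 < b ^+ 2 * q - a ^+ 2].
Proof.
move=> s0 <-; have E : a ^+ 2 - b ^+ 2 * s ^+ 2 = (a + b * s) * (a - b * s) by ring.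
have E' : b ^+ 2 * s ^+ 2 - a ^+ 2 = (a + b * s) * (b * s - a) by ring.
rewrite E E'; split.
  move=> f0; have [a0|a0] := ltP 0 a.
    have [b0|b0] := leP 0 b; first by apply: Or41; split=> //; apply/negP;
      rewrite -leNgt; lra.
    apply: Or43; split=> //; rewrite mulr_gt0 //.
    by have := mulr_gt0 (_ : 0 < - b) s0; rewrite oppr_gt0 => /(_ b0); lra.
  have b0 : 0 < b by rewrite -(pmulr_lgt0 b s0); lra.
  by apply: Or44; split=> //; rewrite mulr_gt0 //; lra.
case=> [[a0 /negP]|[/negP]|[a0]|[b0]].
- rewrite -leNgt => b0; have : 0 <= b * s by apply: mulr_ge0; lra.
  lra.
- rewrite -leNgt => a0 b0; have := mulr_gt0 b0 s0; lra.
- have [bs|bs] := leP (b * s) 0; last by move=> _; lra.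
  by rewrite pmulr_lgt0; lra.
- have := mulr_gt0 b0 s0 => bs; have [a0|a0] := leP 0 a; first by lra.
  by rewrite pmulr_lgt0; lra.
Qed.

(** The square of the third coordinate along the cusp. *)
Definition radicand : {poly R} := 1 - 'X^4 - 'X^6.

Lemma radicandE t : radicand.[t] = 1 - t ^+ 4 - t ^+ 6.
Proof. by rewrite /radicand !(hornerD, hornerN) !hornerXn hornerC. Qed.

Lemma radicand_gt0 t : `|t| <= 2^-1 -> 0 < radicand.[t].
Proof. by rewrite radicandE; exact: cusp_radicand_gt0. Qed.

(** The algebra generated over the polynomials by the square root of the
    radicand: it contains the coordinates of the cusp and hence every
    polynomial function along it. *)
Definition root_alg (f : R -> R) : Prop := exists A B : {poly R},
  forall t, `|t| <= 2^-1 -> f t = A.[t] + B.[t] * Num.sqrt radicand.[t].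

Lemma root_alg_poly (p : {poly R}) : root_alg (fun t => p.[t]).
Proof. by exists p, 0 => t _; rewrite horner0 mul0r addr0. Qed.

Lemma root_algD (f g : R -> R) : root_alg f -> root_alg g -> root_alg (fun t => f t + g t).
Proof.
move=> [A [B fE]] [C [D gE]]; exists (A + C), (B + D) => t t2.
by rewrite fE // gE // !hornerD; ring.
Qed.

Lemma root_algM (f g : R -> R) : root_alg f -> root_alg g -> root_alg (fun t => f t * g t).
Proof.
move=> [A [B fE]] [C [D gE]]; exists (A * C + B * D * radicand), (A * D + B * C) => t t2.
have key (a b u v s q : R) : s ^+ 2 = q ->
    (a + b * s) * (u + v * s) = a * u + b * v * q + (a * v + b * u) * s.
  by move=> <-; ring.
rewrite fE // gE // (key _ _ _ _ _ _ (sqr_sqrtr (ltW (radicand_gt0 t2)))).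
by rewrite -!hornerM -!hornerD.
Qed.

Lemma root_alg_meval n (P : mpoly n R) (c : 'I_n -> R -> R) :
  (forall i, root_alg (c i)) -> root_alg (fun t => meval (fun i => c i t) P).
Proof.
move=> cA; elim/mpolyind: P => [|a m p _ _ IH].
  exists 0, 0 => t _; rewrite meval0 horner0 mul0r addr0 //.
have mA : root_alg (fun t => \prod_i c i t ^+ m i).
  have H (r : seq 'I_n) : root_alg (fun t => \prod_(i <- r) c i t ^+ m i).
    elim: r => [|i r IHr].
      by exists 1, 0 => t _; rewrite big_nil hornerC horner0 mul0r addr0.
    have pw k : root_alg (fun t => c i t ^+ k).
      elim: k => [|k IHk].
        by exists 1, 0 => t _; rewrite expr0 hornerC horner0 mul0r addr0.
      by have [A [B H]] := root_algM (cA i) IHk; exists A, B => t /H <-; rewrite exprS.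
    by have [A [B H]] := root_algM (pw (m i)) IHr; exists A, B => t /H <-; rewrite big_cons.
  exact: H.
have [A [B H]] := root_algD (root_algM (root_alg_poly a%:P) mA) IH.
by exists A, B => t /H <-; rewrite mevalD mevalZ mevalX hornerC.
Qed.

Lemma near_small : \forall t \near (0 : R)^'+, 0 < t <= 2^-1.
Proof.
near=> t; apply/andP; split=> //; near: t; apply: nbhs_right_le.
by rewrite invr_gt0.
Unshelve. all: by end_near. Qed.

Lemma root_alg_cusp sg j : root_alg (fun t => cusp sg 1 t 0 j).
Proof.
have E t := embed3E (t ^+ 2) (sg * t ^+ 3) (1 * Num.sqrt (1 - t ^+ 4 - t ^+ 6)).
move: j; apply: row33P.
- by exists 'X^2, 0 => t _; have [-> _ _ _] := E t; rewrite hornerXn horner0 mul0r addr0.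
- exists (sg *: 'X^3), 0 => t _; have [_ -> _ _] := E t.
  by rewrite hornerZ hornerXn horner0 mul0r addr0.
- by exists 0, 1 => t _; have [_ _ -> _] := E t; rewrite horner0 add0r hornerC radicandE.
- by exists 0, 0 => t _; have [_ _ _ ->] := E t; rewrite !horner0 mul0r addr0.
- by exists 0, 0 => t _; have [_ _ _ ->] := E t; rewrite !horner0 mul0r addr0.
- by exists 0, 0 => t _; have [_ _ _ ->] := E t; rewrite !horner0 mul0r addr0.
Qed.

(** It is enough to decide the sign of a polynomial along the cusp, that is of
    A + B sqrt Q with polynomials A, B and Q. *)
Lemma semialg_decided sg (A : set 'rV[R]_(3 + 3)) : semialg A ->
  decided (fun t => A (cusp sg 1 t)).
Proof.
elim=> {A} [P|A B _ IA _ IB|A B _ IA _ IB|A _ IA].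
- have [A [B E]] := root_alg_meval P (root_alg_cusp sg).
  have dE (a b : {poly R}) : decided (fun t => 0 < a.[t] /\ 0 < b.[t]).
    by apply: decidedI; exact: decided_poly.
  have := decidedU (decidedI (decided_poly A) (decidedC (decided_poly (- B))))
    (decidedU (decidedI (decidedC (decided_poly (- A))) (decided_poly B))
    (decidedU (dE A (A ^+ 2 - B ^+ 2 * radicand)) (dE B (B ^+ 2 * radicand - A ^+ 2)))).
  apply: decided_ext; apply: filterS near_small => t /andP[t0 t2].
  have t2' : `|t| <= 2^-1 by rewrite gtr0_norm.
  rewrite /= E //.
  have r0 := radicand_gt0 t2'.
  have S0 : 0 < Num.sqrt radicand.[t] by rewrite sqrtr_gt0.
  have := sign_add_sqrt A.[t] B.[t] S0 (sqr_sqrtr (ltW r0)).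
  rewrite !(hornerD, hornerN, hornerM, horner_exp) => ->; split.
    by move=> [|[|[|]]] ?; [apply: Or41|apply: Or42|apply: Or43|apply: Or44].
  by case; tauto.
- exact: decidedI.
- exact: decidedU.
- exact: decidedC.
Qed.

Lemma cuspN sg t : cusp sg 1 (- t) = cusp (- sg) 1 t :> 'rV[R]_(3 + 3).
Proof. by rewrite /cusp; congr embed3; [ring|ring|congr (1 * Num.sqrt _); ring]. Qed.

(** The parameter is the square root of x_1 with the sign of x_2. *)
Lemma zsphere_cusp (x : 'rV[R]_(3 + 3)) : X x -> 0 < x 0 (ix 2) ->
  exists t, x = cusp 1 1 t /\ t ^+ 2 = x 0 (ix 0).
Proof.
move=> /zsphere_piP[y0 n1 q] x2.
have x0 : 0 <= x 0 (ix 0).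
  have : 0 <= x 0 (ix 0) ^+ 3 by rewrite -q sqr_ge0.
  by rewrite exprn_odd_ge0.
pose s := Num.sqrt (x 0 (ix 0)).
have s2 : s ^+ 2 = x 0 (ix 0) by rewrite sqr_sqrtr.
have : x 0 (ix 1) ^+ 2 = (s ^+ 3) ^+ 2 by rewrite q -s2; ring.
have xE (t : R) : t ^+ 2 = x 0 (ix 0) -> t ^+ 3 = x 0 (ix 1) -> x = cusp 1 1 t.
  move=> t2 t3; rewrite (embed3P y0) /cusp t2 t3 !mul1r; congr embed3.
  have -> : 1 - t ^+ 4 - t ^+ 6 = x 0 (ix 2) ^+ 2.
    have -> : t ^+ 4 = (t ^+ 2) ^+ 2 by ring.
    have -> : t ^+ 6 = (t ^+ 3) ^+ 2 by ring.
    by rewrite t2 t3 -n1; ring.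
  by rewrite sqrtr_sqr gtr0_norm.
move=> /eqP; rewrite eqf_sqr => /orP[/eqP e|/eqP e].
  by exists s; split=> //; exact: xE.
exists (- s); split; last by rewrite sqrrN.
by apply: xE; rewrite ?sqrrN // e; ring.
Qed.

Section Branches.
Variables (I : finType) (M : I -> set 'rV[R]_(3 + 3)).
Hypothesis MX : nash_stratification X M.

Lemma stratum_semialg i : semialg (M i).
Proof. by have [_ _ _ /(_ i)[d [_ []]]] := MX. Qed.

(** The strata are finitely many, each contains the germ of the half-branch or
    misses it, and together they cover it. *)
Lemma cusp_germ_stratum sg : sg ^+ 2 = 1 ->
  exists k, \forall t \near (0 : R)^'+, M k (cusp sg 1 t).
Proof.
move=> sg2; apply/not_existsP => H.
have {}H k : \forall t \near (0 : R)^'+, ~ M k (cusp sg 1 t).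
  by have [/(H k)|] := semialg_decided sg (stratum_semialg k).
have nX : \forall t \near (0 : R)^'+, X (cusp sg 1 t).
  apply: filterS near_small => t /andP[t0 t2].
  by apply: cusp_zsphere => //; rewrite ?expr1n // gtr0_norm.
have nM : \forall t \near (0 : R)^'+, forall k, ~ M k (cusp sg 1 t).
  exact: filter_forall.
have [E _ _ _] := MX; have [t []] : exists t, X (cusp sg 1 t) /\ forall k,
  ~ M k (cusp sg 1 t).
  by apply: (@filter_ex _ ((0 : R)^'+)); exact: filterI nX nM.
by rewrite -E => -[k _ Mk] /(_ k).
Qed.

(** Both half-branches together fill a neighbourhood of the cusp in the zero
    set; if the stratum missed both germs, the cusp would not be in its
    closure. *)
Lemma frontier_branch i : frontier_pt M i alpha3 ->
  exists sg : R, sg ^+ 2 = 1 /\ \forall t \near (0 : R)^'+, M i (cusp sg 1 t).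
Proof.
move=> [cl nM]; have o2 : (1 : R) ^+ 2 = 1 by rewrite expr1n.
have [H1|H1] := semialg_decided 1 (stratum_semialg i); first by exists 1.
have [H2|H2] := semialg_decided (- 1) (stratum_semialg i).
  by exists (- 1); rewrite sqrrN.
exfalso; have : \forall t \near (0 : R), 0 < t ->
    ~ M i (cusp 1 1 t) /\ ~ M i (cusp (- 1) 1 t) by exact: filterI H1 H2.
move=> /nbhs_ballP[e /= e0 eP].
pose B := [set x : 'rV[R]_(3 + 3) | x 0 (ix 0) < e ^+ 2 /\ 0 < x 0 (ix 2)].
have nB : nbhs (alpha3 : 'rV[R]_(3 + 3)) B.
  have [a0 _ a2 _] := embed3E (0 : R) 0 1; rewrite -alpha3E in a0 a2.
  have c0 := @coord_continuous R 1 (3 + 3) 0 (ix 0) alpha3.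
  have c2 := @coord_continuous R 1 (3 + 3) 0 (ix 2) alpha3.
  rewrite /continuous_at a0 in c0; rewrite /continuous_at a2 in c2.
  have e2 : 0 < e ^+ 2 by rewrite exprn_gt0.
  exact: filterI (cvgr_lt _ c0 _ e2) (cvgr_gt _ c2 _ (ltr01)).
have [x [Mx [x0 x2]]] := cl _ nB.
have Xx : X x by have [E _ _ _] := MX; rewrite -E; exists i.
have [t [xE t2]] := zsphere_cusp Xx x2.
have te : `|t| < e.
  have t2e : `|t| ^+ 2 < e ^+ 2 by rewrite real_normK ?num_real // t2.
  by rewrite ltNge; apply/negP => et; move: t2e; rewrite ltNge lerXn2r ?nnegrE // ltW.
have [t0|t0|t0] := ltgtP t 0.
- have /= := eP (- t); rewrite /ball /= sub0r opprK => /(_ te); rewrite oppr_gt0 =>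
  /(_ t0)[_].
  by rewrite cuspN opprK -xE.
- have /= := eP t; rewrite /ball /= sub0r normrN => /(_ te t0)[+ _].
  by rewrite -xE.
- by apply: nM; rewrite alpha3E -(cusp0 1 1) -t0 -xE.
Qed.

End Branches.
End Germs.

(** * The parametrized cusp is analytic, complex tangential and a homeomorphism *)

Section CuspCurve.
Context {R : realType}.

Notation X := (zsphere (@pi_poly R)).

Variable sg : R.
Hypothesis sg2 : sg ^+ 2 = 1.

Let o2 : (1 : R) ^+ 2 = 1. Proof. by rewrite expr1n. Qed.

Local Notation c := (cusp sg 1).
Local Notation height t := (Num.sqrt (1 - t ^+ 4 - t ^+ 6 : R)).

Lemma cuspE t : [/\ c t 0 (ix 0) = t ^+ 2, c t 0 (ix 1) = sg * t ^+ 3,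
  c t 0 (ix 2) = height t & forall j, c t 0 (iy j) = 0].
Proof.
have [e0 e1 e2 e3] := embed3E (t ^+ 2) (sg * t ^+ 3) (1 * height t).
by split=> //; rewrite /cusp e2 mul1r.
Qed.

Lemma height_gt0 (t : R) : `|t| <= 2^-1 -> 0 < height t.
Proof. by move=> t2; rewrite sqrtr_gt0; exact: cusp_radicand_gt0. Qed.

Lemma height_sqr (t : R) : `|t| <= 2^-1 -> height t ^+ 2 = 1 - t ^+ 4 - t ^+ 6.
Proof. by move=> t2; rewrite sqr_sqrtr // ltW // cusp_radicand_gt0. Qed.

Lemma open_small : open [set t : R | `|t| < 2^-1].
Proof.
rewrite (_ : mkset _ = ball (0 : R) 2^-1); first exact: ball_open.
by apply/seteqP; split=> t; rewrite /ball /= sub0r normrN.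
Qed.

Lemma Ck_cusp k : Ck k [set t : R | `|t| < 2^-1] c.
Proof.
have oU := open_small; set U := mkset _ in oU *.
have idC m : Ck m U (fun t : R => t).
  case: m => [|m]; first by move=> ? _; exact: cvg_id.
  split=> [x _|v]; first by case: (@is_diff_id _ _ x).
  apply: (Ck_ext oU _ (Ck_cst m U v)) => x _.
  have [_ e] := @is_diff_id _ _ x.
  exact: (congr1 (fun g : R -> R => g v) (esym e)).
apply: Ck_embed3 => //; first exact: CkX.
  by apply: CkM => //; [exact: Ck_cst|exact: CkX].
apply: CkM => //; first exact: Ck_cst.
apply: Ck_sqrt => // [m|t /ltW t2]; last by rewrite -radicandE radicand_gt0.
apply: CkD => //; last by apply: CkN => //; exact: CkX.
by apply: CkD => //; [exact: Ck_cst|apply: CkN => //; exact: CkX].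
Qed.

Lemma differentiable_cusp t : `|t| < 2^-1 -> differentiable c t.
Proof. by move=> t2; have [+ _] := Ck_cusp 1; exact. Qed.

Lemma cusp_real_sphere t : `|t| <= 2^-1 -> (forall j, c t 0 (iy j) = 0) /\
  c t 0 (ix 0) ^+ 2 + c t 0 (ix 1) ^+ 2 + c t 0 (ix 2) ^+ 2 = 1.
Proof. by move=> t2; have /zsphere_piP[] := cusp_zsphere sg2 o2 t2. Qed.

Lemma cusp_ct t : `|t| < 2^-1 -> herm (toC (derive1 c t)) (toC (c t)) = 0.
Proof.
move=> t2; rewrite derive1E'; last exact: differentiable_cusp.
apply: real_sphere_ct; first exact: differentiable_cusp.
apply: filterS (open_nbhs_nbhs (conj open_small t2)) => u /ltW u2.
exact: cusp_real_sphere.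
Qed.

Lemma derive1_cusp_neq0 t : `|t| < 2^-1 -> t != 0 -> derive1 c t != 0.
Proof.
move=> t2 t0; rewrite derive1E'; last exact: differentiable_cusp.
apply/eqP => /rowP/(_ (ix 0)); rewrite mxE.
have [_ e] := coord_is_diff (ix 0) (differentiable_cusp t2).
have {}e := congr1 (fun g : R -> R => g 1) e.
rewrite /= in e; rewrite -e.
have -> : (fun y => c y 0 (ix 0)) = (fun y : R => y) ^+ 2.
  by apply/funext => y; have [-> _ _ _] := cuspE y.
have [_ ->] := is_diffX 1 (@is_diff_id _ _ t).
move=> h; have {h}/eqP : 2%:R * t ^+ 1 * 1 = 0 := h.
by rewrite mulr1 expr1 mulf_eq0 (negbTE t0) orbF pnatr_eq0.
Qed.

(** The cube root is 1/3-Hoelder; this gives the continuity of the inverse of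
    the parametrization, through the second coordinate. *)
Lemma cusp_dist3 s t : `|s - t| ^+ 3 <= 4 * `|c s 0 (ix 1) - c t 0 (ix 1)|.
Proof.
have [_ -> _ _] := cuspE s; have [_ -> _ _] := cuspE t.
have nsg : `|sg| = 1.
  by apply/eqP; rewrite -sqrp_eq1 // -normrX sg2 normr1.
rewrite -mulrBr normrM nsg mul1r.
have -> : s ^+ 3 - t ^+ 3 = (s - t) * (s ^+ 2 + s * t + t ^+ 2) by ring.
rewrite normrM mulrCA exprS; apply: ler_wpM2l => //.
rewrite real_normK ?num_real // [X in _ * X]ger0_norm; last by nra.
(* 4 (s^2 + s t + t^2) - (s - t)^2 = 3 (s + t)^2. *)
rewrite -subr_ge0 (_ : _ - _ = 3 * (s + t) ^+ 2); last by ring.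
by rewrite mulr_ge0 ?sqr_ge0.
Qed.

Lemma cusp_inj s t : c s = c t -> s = t.
Proof.
move=> st; have := cusp_dist3 s t; rewrite st subrr normr0 mulr0 => h.
apply/eqP; rewrite -subr_eq0 -normr_le0 leNgt; apply/negP => st0.
by have := exprn_gt0 3 st0; lra.
Qed.

Lemma cusp_homeo (A : set R) : homeo_onto_image A c.
Proof.
split; first by apply: continuous_subspaceT; exact: cusp_continuous.
pose g x := xget 0 [set t | A t /\ c t = x].
have gK t : A t -> g (c t) = t.
  move=> At; rewrite /g; case: xgetP => [u _ [_ /cusp_inj]|/(_ t)[]] //.
exists g; split; last exact: gK.
apply/subspace_continuousP => _ [t At <-]; rewrite /from_subspace gK //.
apply/cvgrPdist_lt => e e0; rewrite /within /=.
have d0 : 0 < e ^+ 3 / 4 by rewrite divr_gt0 // exprn_gt0.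
have /cvgrPdist_lt/(_ _ d0) : (fun x : 'rV[R]_(3 + 3) => x 0 (ix 1)) @ c t --> c t 0 (ix 1).
  exact: coord_continuous.
apply: filterS => y h [s As sy]; rewrite -sy in h *; rewrite gK //.
have := cusp_dist3 t s; rewrite ltr_pdivlMr // in h; move=> h2.
rewrite ltNge; apply/negP => est.
have : e ^+ 3 <= `|t - s| ^+ 3 by apply: lerXn2r; rewrite ?nnegrE // ltW.
lra.
Qed.

(** Two coordinates are polynomials and the third is the square root of a
    polynomial positive on the interval. *)
Lemma cusp_analytic (e : R) : e <= 2^-1 -> analytic_on `]-e, e[%classic c.
Proof.
move=> e2 t0 /=; rewrite in_itv /= -ltr_norml => t0e.
have [c1 [m1 E1]] := poly_taylor_series 'X^2 t0.
have [c2 [m2 E2]] := poly_taylor_series (sg *: 'X^3) t0.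
have t02 : `|t0| < 2^-1 by exact: lt_le_trans t0e e2.
have near_pos : exists r, 0 < r /\ forall t, `|t - t0| < r -> 0 <= (@radicand R).[t].
  exists (2^-1 - `|t0|); rewrite subr_gt0; split=> // t tr.
  apply/ltW/radicand_gt0/ltW; have := ler_normD (t - t0) t0; rewrite subrK; lra.
have [c3 [r [r0 E3]]] := sqrt_poly_series (radicand_gt0 (ltW t02)) near_pos.
exists (fun k => embed3 (c1 k) (c2 k) (c3 k)), r; split=> // t /E3 {}E3.
have sE (f : nat -> 'rV[R]_(3 + 3)) j m : (\sum_(k < m) (t - t0) ^+ k *: f k) 0 j =
    \sum_(0 <= k < m) f k 0 j * (t - t0) ^+ k.
  by rewrite summxE big_mkord; apply: eq_bigr => k _; rewrite mxE mulrC.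
have ev (u : nat -> R) (l : R) m : (forall n, (m <= n)%N -> u n = l) -> u @ \oo --> l.
  move=> H; apply: cvg_near_cst.
  by apply: filterS (nbhs_infty_ge m) => n /H ->.
have EE k := embed3E (c1 k) (c2 k) (c3 k).
have [x0 x1 x2 x3] := cuspE t.
have z0 (u : nat -> R) : (forall n, u n = 0) -> u @ \oo --> (0 : R).
  by move=> H; apply: (ev _ _ 0%N).
suff H j : (fun m : nat => \sum_(0 <= k < m) embed3 (c1 k) (c2 k) (c3 k) 0 j *
    (t - t0) ^+ k) @ \oo --> c t 0 j.
  apply: row_cvg => j; apply: cvg_trans (H j); apply: near_eq_cvg.
  by apply: nearW => n; exact/esym/(sE (fun k => embed3 (c1 k) (c2 k) (c3 k))).
move: j; apply: row33P; rewrite ?x0 ?x1 ?x2 ?x3.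
- apply: (ev _ _ m1) => n nm; have := E1 n nm t; rewrite hornerXn => <-.
  by apply: eq_bigr => k _; have [-> _ _ _] := EE k.
- apply: (ev _ _ m2) => n nm; have := E2 n nm t; rewrite hornerZ hornerXn => <-.
  by apply: eq_bigr => k _; have [_ -> _ _] := EE k.
- rewrite radicandE in E3; apply: cvg_trans E3; apply: near_eq_cvg; near=> n.
  by apply: eq_bigr => k _; have [_ _ -> _] := EE k.
- by apply: z0 => n; apply: big1 => k _; have [_ _ _ ->] := EE k; rewrite mul0r.
- by apply: z0 => n; apply: big1 => k _; have [_ _ _ ->] := EE k; rewrite mul0r.
- by apply: z0 => n; apply: big1 => k _; have [_ _ _ ->] := EE k; rewrite mul0r.
Unshelve. all: by end_near. Qed.

End CuspCurve.

(** * Two branches, expansion at the cusp and the spherical cap *)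

Section CuspBranches.
Context {R : realType}.

Notation X := (zsphere (@pi_poly R)).

(** On a connected subset f has no zero, hence a constant sign. *)
Lemma two_components {T : topologicalType} (f : T -> R) (C1 C2 : set T) :
  continuous f -> connected C1 -> connected C2 -> C1 !=set0 -> C2 !=set0 ->
  (forall x, C1 x -> 0 < f x) -> (forall x, C2 x -> f x < 0) ->
  [set connected_component (C1 `|` C2) x | x in C1 `|` C2] = [set C1; C2].
Proof.
move=> fc con1 con2 [a Ca] [b Cb] f1 f2.
have sep x y : connected_component (C1 `|` C2) x y -> 0 < f x -> f y < 0 -> False.
  move=> xy fx fy; set K := connected_component (C1 `|` C2) x.
  have Kc : connected K by exact: component_connected.
  have : connected (f @` K) by apply: connected_continuous_connected => //;
    exact: continuous_subspaceT.
  move=> /connected_intervalP/(_ (f y) (f x)) H.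
  have Kx : K x.
    apply: connected_component_refl; apply: contrapT => nx.
    by move: xy; rewrite connected_component_out.
  have [|||z Kz z0] := H _ _ 0; [by exists y|by exists x|by rewrite !ltW|].
  have [/f1|/f2] := connected_component_sub Kz; by rewrite z0 ltxx.
have comp1 x : C1 x -> connected_component (C1 `|` C2) x = C1.
  move=> Cx; apply/seteqP; split; last by apply: connected_component_max => // y; left.
  move=> y Ky; have [//|/f2 fy] := connected_component_sub Ky.
  by have := sep _ _ Ky (f1 _ Cx) fy.
have comp2 x : C2 x -> connected_component (C1 `|` C2) x = C2.
  move=> Cx; apply/seteqP; split; last by apply: connected_component_max => // y; right.
  move=> y Ky; have [/f1 fy|//] := connected_component_sub Ky.
  by have := sep _ _ (connected_component_sym Ky) fy (f2 _ Cx).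
apply/seteqP; split=> K /=.
  by move=> [x [Cx|Cx] <-]; [left; exact: comp1|right; exact: comp2].
by move=> [->|->]; [exists a; [left|exact: comp1]|exists b; [right|exact: comp2]].
Qed.

Section Cusp.
Variable sg : R.
Hypothesis sg2 : sg ^+ 2 = 1.

Local Notation c := (cusp sg 1).
Local Notation height t := (Num.sqrt (1 - t ^+ 4 - t ^+ 6 : R)).

Lemma cusp_alpha3 : c 0 = alpha3.
Proof. by rewrite cusp0 alpha3E. Qed.

Lemma hnorm_cusp (t : R) : `|t| <= 2^-1 ->
  hnorm (toC (c t - alpha3)) = Num.sqrt (2 - 2 * height t).
Proof.
move=> t2; rewrite hnorm_sqnorm6; congr Num.sqrt.
have [c0 c1 c2 c3] := cuspE sg t; have [a0 a1 a2 a3] := embed3E (0 : R) 0 1.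
rewrite /sqnorm6 alpha3E !rowBE c0 c1 c2 !c3 a0 a1 a2 !a3.
have -> : (sg * t ^+ 3 - 0) ^+ 2 = sg ^+ 2 * t ^+ 6 by ring.
have -> : (height t - 1) ^+ 2 = height t ^+ 2 - 2 * height t + 1 by ring.
by rewrite sg2 height_sqr //; ring.
Qed.

Lemma height_mono (s t : R) : `|s| <= `|t| -> height t <= height s.
Proof.
move=> st; apply: ler_wsqrtr.
have H n : s ^+ (2 * n) <= t ^+ (2 * n).
  rewrite !exprM -[s ^+ 2]real_normK ?num_real // -[t ^+ 2]real_normK ?num_real //.
  by do 2![apply: lerXn2r; rewrite ?nnegrE ?exprn_ge0 //].
have := H 2%N; have := H 3%N; rewrite !(mulnE) /=; lra.
Qed.

(** The distance to the cusp increases with |t|, so a small ball cuts the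
    curve along an interval of parameters symmetric about 0; removing the cusp
    leaves the images of two intervals, separated by the sign of the second
    coordinate. *)
Lemma cusp_two_branches (e delta : R) : 0 < e -> e <= 2^-1 -> 0 < delta ->
  two_branches ((c @` `]- e, e[%classic `&`
    [set x | hnorm (toC (x - alpha3)) < delta]) `\ alpha3) alpha3.
Proof.
move=> e0 e2 d0.
pose D t := hnorm (toC (c t - alpha3)) < delta.
have DE t : `|t| <= 2^-1 -> D t = (2 - 2 * height t < delta ^+ 2).
  move=> t2; rewrite /D hnorm_cusp // -[X in _ < X]gtr0_norm // -sqrtr_sqr ltr_sqrt //.
  by rewrite exprn_gt0.
have Dmono s t : `|s| <= `|t| -> `|t| <= 2^-1 -> D t -> D s.
  by move=> st t2; rewrite !DE //; [have := height_mono st; lra|exact: le_trans t2].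
pose T1 := [set t | 0 < sg * t /\ `|t| < e /\ D t].
pose T2 := [set t | sg * t < 0 /\ `|t| < e /\ D t].
have sg1 : sg = 1 \/ sg = -1.
  by move/eqP: sg2; rewrite sqrf_eq1 => /orP[]/eqP; [left|right].
have conT (T : set R) : (forall t u v, T t -> T v -> t < u < v -> T u) ->
  connected (c @` T).
  move=> H; apply: connected_continuous_connected.
    apply/connected_intervalP => a b Ta Tb z /andP[az zb].
    have [<-//|az'] := eqVneq a z; have [->//|zb'] := eqVneq z b.
    by apply: (H a z b) => //; rewrite !lt_neqAle az' zb' az.
  by apply: continuous_subspaceT; exact: cusp_continuous.
have con1 : connected (c @` T1).
  apply: conT => t u v [t0 [te Dt]] [v0 [ve Dv]] /andP[tu uv].
  have u0 : 0 < sg * u by case: sg1 => sgE; move: t0 v0; rewrite sgE; lra.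
  have [uu|uu] : `|u| <= `|t| \/ `|u| <= `|v|.
    case: sg1 => sgE; rewrite sgE in t0 v0 u0.
      by right; rewrite !gtr0_norm; lra.
    by left; rewrite !ltr0_norm; lra.
  - by split; [exact: u0|]; split; [exact: le_lt_trans uu te|exact: Dmono uu
    (le_trans (ltW te) e2) Dt].
  - by split; [exact: u0|]; split; [exact: le_lt_trans uu ve|exact: Dmono uu
    (le_trans (ltW ve) e2) Dv].
have con2 : connected (c @` T2).
  apply: conT => t u v [t0 [te Dt]] [v0 [ve Dv]] /andP[tu uv].
  have u0 : sg * u < 0 by case: sg1 => sgE; move: t0 v0; rewrite sgE; lra.
  have [uu|uu] : `|u| <= `|t| \/ `|u| <= `|v|.
    case: sg1 => sgE; rewrite sgE in t0 v0 u0.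
      by left; rewrite !ltr0_norm; lra.
    by right; rewrite !gtr0_norm; lra.
  - by split; [exact: u0|]; split; [exact: le_lt_trans uu te|exact: Dmono uu
    (le_trans (ltW te) e2) Dt].
  - by split; [exact: u0|]; split; [exact: le_lt_trans uu ve|exact: Dmono uu
    (le_trans (ltW ve) e2) Dv].
have cx1 t : c t 0 (ix 1) = sg * t * t ^+ 2.
  by have [_ -> _ _] := cuspE sg t; ring.
have f1 x : (c @` T1) x -> 0 < x 0 (ix 1).
  move=> [t [t0 _] <-]; rewrite cx1 mulr_gt0 // exprn_even_gt0 //=.
  by apply/eqP => tt; rewrite tt mulr0 ltxx in t0.
have f2 x : (c @` T2) x -> x 0 (ix 1) < 0.
  move=> [t [t0 _] <-]; rewrite cx1 nmulr_rlt0 // exprn_even_gt0 //=.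
  by apply/eqP => tt; rewrite tt mulr0 ltxx in t0.
have -> : (c @` `]- e, e[%classic `&` [set x | hnorm (toC (x - alpha3)) < delta]) `\
  alpha3 =
    (c @` T1) `|` (c @` T2).
  apply/seteqP; split=> x.
    move=> [[[t tI <-] Dt] na].
    have te : `|t| < e by move: tI; rewrite /= in_itv /= -ltr_norml.
    have [t0|t0|t0] := ltgtP (sg * t) 0; [right|left|]; try by exists t.
    exfalso; apply: na => /=; rewrite -cusp_alpha3; congr (c _).
    by case: sg1 => sgE; move: t0; rewrite sgE; lra.
  have nin t : sg * t != 0 -> `|t| < e -> D t -> ((c @` `]- e, e[%classic `&`
      [set x | hnorm (toC (x - alpha3)) < delta]) `\ alpha3) (c t).
    move=> t0 te Dt; split; first by split=> //; exists t => //=;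
      rewrite in_itv /= -ltr_norml.
    rewrite /= -cusp_alpha3 => /(cusp_inj sg2) tt.
    by rewrite tt mulr0 eqxx in t0.
  move=> [[t [t0 [te Dt]] <-]|[t [t0 [te Dt]] <-]].
    by apply: nin te Dt; rewrite gt_eqF.
  by apply: nin te Dt; rewrite lt_eqF.
have nD : \forall t \near (0 : R), D t.
  have cc := @cusp_continuous R sg 1 0.
  have H : \forall t \near (0 : R), `|t| < 2^-1.
    apply/nbhs_ballP; exists 2^-1 => /=; first by rewrite invr_gt0.
    by move=> t; rewrite /ball /= sub0r normrN.
  have H2 : \forall t \near (0 : R), 1 - delta ^+ 2 / 4 < c t 0 (ix 2).
    have k2 : (fun t => c t 0 (ix 2)) @ (0 : R) --> c 0 0 (ix 2).
      exact: (@continuous_comp _ _ _ c (fun z : 'rV[R]_(3 + 3) =>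
        z 0 (ix 2)) 0 cc (@coord_continuous _ _ _ _ _ _)).
    apply: (cvgr_gt _ k2); have [_ _ -> _] := cuspE sg 0.
    by rewrite !expr0n /= !subr0 sqrtr1; have := exprn_gt0 2 d0; lra.
  apply: filterS2 H H2 => t t2; have [_ _ -> _] := cuspE sg t; rewrite DE ?ltW //.
  by have := exprn_gt0 2 d0; lra.
(* Each branch contains the points of parameter b t for small t > 0, with b =
   sg or b = - sg. *)
have cl (T : set R) (b : R) : (b = 1 \/ b = -1) ->
    (forall t, 0 < t -> t < e -> D (b * t) -> T (b * t)) -> closure (c @` T) alpha3.
  move=> b1 HT B; rewrite -cusp_alpha3 => B0.
  have nb : (fun t : R => b * t) @ (0 : R) --> (0 : R).
    suff : (fun t : R => b * t) @ (0 : R) --> b * 0 by rewrite mulr0.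
    apply: cvgM; [exact: cvg_cst|exact: cvg_id].
  have H1 : \forall t \near (0 : R)^'+, B (c (b * t)) /\ D (b * t).
    have nBc : \forall t \near (0 : R), B (c t) by exact: (cusp_continuous B0).
    by apply: cvg_within; exact: nb _ (filterI nBc nD).
  have H2 : \forall t \near (0 : R)^'+, 0 < t < e.
    near=> t; apply/andP; split=> //; near: t; exact: nbhs_right_lt.
  have [t [[Bt Dt] /andP[t0 te]]] : exists t, (B (c (b * t)) /\ D (b * t)) /\ 0 < t < e.
    by apply: (@filter_ex _ ((0 : R)^'+)); exact: filterI H1 H2.
  by exists (c (b * t)); split=> //; exists (b * t) => //; exact: HT.
have sgsg : sg * sg = 1 by rewrite -expr2.
have cl1 : closure (c @` T1) alpha3.
  apply: (cl _ sg) => // t t0 te Dt; split; first by rewrite mulrA sgsg mul1r.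
  by split=> //; case: sg1 => ->; rewrite ?mul1r ?mulN1r ?normrN gtr0_norm.
have cl2 : closure (c @` T2) alpha3.
  apply: (cl _ (- sg)).
    by case: sg1 => ->; [right|left]; rewrite ?opprK.
  move=> t t0 te Dt; split; first by rewrite mulrA mulrN sgsg mulN1r oppr_lt0.
  by split=> //; case: sg1 => ->; rewrite ?opprK ?mul1r ?mulN1r ?normrN gtr0_norm.
have ne (T : set R) : closure (c @` T) alpha3 -> (c @` T) !=set0.
  by move=> /(_ setT filterT)[x [Tx _]]; exists x.
have [x1 Cx1] := ne _ cl1.
exists (c @` T1), (c @` T2); split=> //.
- by move=> CE; have := f1 _ Cx1; rewrite CE in Cx1; have := f2 _ Cx1; lra.
- apply: (@two_components _ (fun x : 'rV[R]_(3 + 3) => x 0 (ix 1))) => //.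
  + exact: coord_continuous.
  + exact: ne.
  + exact: ne.
Unshelve. all: by end_near. Qed.

Lemma normc_real (a : R) : Normc.normc (a +i* 0) = `|a|.
Proof. by rewrite /= expr0n /= addr0 sqrtr_sqr. Qed.

(** With u = t^4 + t^6 the height is sqrt (1 - u), which lies within t^6 of 1
    - t^4 / 2: compare squares. *)
Lemma height_expansion (t : R) : `|t| <= 2^-1 ->
  `|height t - (1 - 2^-1 * t ^+ 4)| <= t ^+ 6.
Proof.
move=> t2; have S2 := height_sqr t2; have S0 := height_gt0 t2.
set s := height t in S2 S0 *.
have tt : t ^+ 2 <= 4^-1.
  by rewrite -[t ^+ 2]ger0_norm ?sqr_ge0 // normrX; have := normr_ge0 t; nra.
have a0 := sqr_ge0 t; set a := t ^+ 2 in tt a0.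
have bE : t ^+ 4 = a * a by rewrite /a; ring.
have dE : t ^+ 6 = a * (a * a) by rewrite /a; ring.
rewrite bE dE in S2 *.
have b0 : 0 <= a * a by rewrite mulr_ge0.
have d0 : 0 <= a * (a * a) by rewrite mulr_ge0.
have db : a * (a * a) <= 4^-1 * (a * a) by rewrite ler_wpM2r.
have bb : a * a * (a * a) <= 4^-1 * (a * (a * a)).
  by rewrite -mulrA ler_wpM2r.
have b1 : a * a <= 4^-1 * a by rewrite ler_wpM2r.
move: (a * a) (a * (a * a)) b0 d0 db bb b1 S2 => b d b0 d0 db bb b1 S2.
have le_sq (x y : R) : 0 <= x -> 0 <= y -> x ^+ 2 <= y ^+ 2 -> x <= y.
  by move=> x0 y0 xy; rewrite -ler_sqr ?nnegrE.
have bd : b * d <= 4^-1 * (b * b).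
  by rewrite -[b * d]mulrC [X in _ <= X]mulrA ler_wpM2r.
have dd : d * d <= 4^-1 * (b * d) by rewrite [X in _ <= X]mulrA ler_wpM2r.
have bb0 : 0 <= b * b by rewrite mulr_ge0.
have up : s <= 1 - 2^-1 * b + d.
  apply: le_sq; [exact: ltW|lra|].
  rewrite S2 (_ : _ ^+ 2 = 1 - b + 2 * d + (2^-1 * b - d) ^+ 2); last by field.
  by have := sqr_ge0 (2^-1 * b - d); lra.
have lo : 1 - 2^-1 * b - d <= s.
  apply: le_sq; [lra|exact: ltW|].
  rewrite S2 (_ : _ ^+ 2 = 1 - b - 2 * d + (4^-1 * (b * b) + b * d + d * d)); last by field.
  lra.
by rewrite ler_norml; apply/andP; split; lra.
Qed.

Lemma toCE (x : 'rV[R]_(3 + 3)) (j : 'I_3) :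
  toC x 0 j = x 0 (ix j) +i* x 0 (iy j).
Proof. by rewrite mxE. Qed.

(** The exponent is nu = 2 and the leading vector (1, 0), so a = - 1 / 2: the
    expansions are t^2, sg t^3 = o(t^2) and 1 - t^4 / 2 + O(t^6). *)
Lemma cusp_expansion : ct_expansion (fun t => toC (c t) *m (1%:M : 'M[R[i]]_3)).
Proof.
have e1 t : toC (c t) *m (1%:M : 'M[R[i]]_3) = toC (c t) by rewrite mulmx1.
exists 2%N, (delta_mx 0 0 : 'rV[R[i]]_2).
have bE : \sum_j Normc.normc ((delta_mx 0 0 : 'rV[R[i]]_2) 0 j) ^+ 2 = 1 :> R.
  rewrite !big_ord_recr big_ord0 /= !mxE /= !expr0n /= !expr1n !addr0 sqrtr1 sqrtr0.
  by rewrite expr1n expr0n /= add0r addr0.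
rewrite bE mulr1 /=; split=> //.
- by apply/eqP => /rowP/(_ 0); rewrite !mxE /= => /eqP; rewrite oner_eq0.
- have small eps : 0 < eps -> \forall t \near (0 : R), `|t| < eps.
    move=> eps0; apply/nbhs_ballP; exists eps => //= t.
    by rewrite /ball /= sub0r normrN.
  case=> -[|[|//]] i; apply/eqoP => eps eps0; apply: filterS (small _ eps0) => t te;
    have [c0 c1 c2 c3] := cuspE sg t; rewrite mulmx1 toCE.
  + have d1 : (delta_mx 0 0 : 'rV[R[i]]_2) 0 (Ordinal i) = 1 by rewrite mxE.
    have -> : lift ord_max (Ordinal i) = 0 :> 'I_3 by exact/val_inj.
    rewrite d1 c0 c3 mul1r subrr (_ : 0 = 0 +i* 0 :> R[i]) // normc_real !normr0.
    by rewrite mulr_ge0 // ltW.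
  + have d1 : (delta_mx 0 0 : 'rV[R[i]]_2) 0 (Ordinal i) = 0 by rewrite mxE.
    have -> : lift ord_max (Ordinal i) = 1 :> 'I_3 by exact/val_inj.
    rewrite d1 c1 c3 mul0r subr0 normc_real normr_id.
    have nsg : `|sg| = 1 by apply/eqP; rewrite -sqrp_eq1 // -normrX sg2 normr1.
    rewrite normrM nsg mul1r !normrX exprS; apply: ler_wpM2r; last exact: ltW.
    by rewrite exprn_ge0.
- apply/eqoP => eps eps0.
  have small : \forall t \near (0 : R), `|t| < Num.min 2^-1 eps.
    apply/nbhs_ballP; exists (Num.min 2^-1 eps) => /=;
      first by rewrite lt_min invr_gt0 ltr0n.
    by move=> t; rewrite /ball /= sub0r normrN.
  apply: filterS small => t; rewrite lt_min => /andP[/ltW t2 te].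
  have [c0 c1 c2 c3] := cuspE sg t; rewrite mulmx1 toCE.
  have -> : ord_max = 2 :> 'I_3 by exact/val_inj.
  rewrite c2 c3 mulNr.
  rewrite (_ : _ - _ = (height t - (1 - 2^-1 * t ^+ 4)) +i* 0);
    last by rewrite -/(real_complex R _) -rmorphB.
  rewrite normc_real normr_id; apply: le_trans (height_expansion t2) _.
  rewrite normrX (_ : t ^+ 6 = `|t| ^+ 2 * `|t| ^+ 4).
    apply: ler_wpM2r; first by rewrite exprn_ge0.
    by apply: le_trans (_ : `|t| <= _); [have := normr_ge0 t; nra|exact: ltW].
  by rewrite -exprD -normrX ger0_norm // exprn_even_ge0.
Qed.

End Cusp.

Lemma ct_upper_cap : @ct_submanifold R 3 2 upper_cap.
Proof.
split; first exact/nash_smooth_submanifold/nash_upper_cap.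
  move=> x /upper_capP[y0 n1 _]; rewrite /rsphere /csphere /=; apply/hnorm_eq1.
  by rewrite /sqnorm6 !y0 n1; lra.
move=> x w _ [e [g [e0 gC gN g0 gw]]].
have J0 : `]- e, e[%classic (0 : R) by rewrite /= in_itv /= oppr_lt0 e0.
have oJ : open `]- e, e[%classic by exact: interval_open.
have [U [h [oU U0 hC gh]]] := gC 0 J0.
have nJU : \forall t \near (0 : R), (`]- e, e[%classic `&` U) t.
  by apply: open_nbhs_nbhs; split; [exact: openI|].
have gd : differentiable g 0.
  have [hd _] := hC 1%N.
  apply: (@ex_diff _ _ _ _ _ _ _ (near_eq_is_diff _ (hd 0 U0))).
  by apply: filterS nJU => t [Jt Ut]; rewrite gh.
rewrite -gw -g0 derive1E' //; apply: real_sphere_ct => //.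
apply: filterS nJU => t [Jt _].
have : upper_cap (g t) by apply: gN; exists t.
by move=> /upper_capP[].
Qed.

End CuspBranches.

(** * Regularity of the cusp *)

Section Regularity.
Context {R : realType}.

Notation X := (zsphere (@pi_poly R)).

Variables (I : finType) (M : I -> set 'rV[R]_(3 + 3)).
Hypothesis MX : nash_stratification X M.

Let o2 : (1 : R) ^+ 2 = 1. Proof. by rewrite expr1n. Qed.

(** The stratum contains one half of the cusp; orienting the cusp by sg makes
    it the positive half. The curve lies in the real sphere, and its positive
    half in the upper cap. *)
Lemma frontier_regular i : frontier_pt M i alpha3 -> @regular_wrt R 2 X I M i alpha3.
Proof.
move=> fr; have [sg [sg2 nM]] := frontier_branch MX fr.
have [|k nMk] := @cusp_germ_stratum _ I M MX (- sg); first by rewrite sqrrN.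
have : \forall t \near (0 : R), 0 < t -> M i (cusp sg 1 t) /\ M k (cusp (- sg) 1 t).
  exact: filterI nM nMk.
move=> /nbhs_ballP[e1 /= e10 e1P].
pose e := Num.min e1 2^-1.
have e0 : 0 < e by rewrite lt_min e10 invr_gt0 ltr0n.
have e2 : e <= 2^-1 by rewrite ge_min lexx orbT.
have eP t : 0 < t -> t < e -> M i (cusp sg 1 t) /\ M k (cusp (- sg) 1 t).
  move=> t0; rewrite lt_min => /andP[te _]; apply: e1P => //.
  by rewrite /ball /= sub0r normrN gtr0_norm.
have JP t : `]- e, e[%classic t -> `|t| < 2^-1.
  by rewrite /= in_itv /= -ltr_norml => te; exact: lt_le_trans te e2.
exists e, (cusp sg 1); split; last first.
  exists 2%N, upper_cap; split; first exact: ct_upper_cap.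
  move=> _ [t /= tI <-]; have t2 : `|t| <= 2^-1.
    by move: tI; rewrite in_itv /= => /andP[t0 te];
      rewrite ger0_norm // ltW // (lt_le_trans te).
  have [y0 n1] := cusp_real_sphere sg2 t2; apply/upper_capP; split=> //.
  by have [_ _ -> _] := cuspE sg t; exact: height_gt0.
split; [|split; [|split]].
- split=> //; first by move=> _ [t /JP/ltW t2 <-]; exact: cusp_zsphere.
    exact: cusp_analytic.
  exact: cusp_homeo.
- split; first split.
  + by move=> _ [t /= + <-]; rewrite in_itv /= => /andP[t0 te]; have [] := eP t t0 te.
  + exact: cusp_alpha3.
  + by move=> t /JP t2 t0; exact: derive1_cusp_neq0.
  + exists k; split.
      move=> _ [t /= + <-]; rewrite in_itv /= => /andP[te t0].
      have nt0 : 0 < - t by rewrite oppr_gt0.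
      have nte : - t < e by rewrite ltrNl.
      by have [_] := eP _ nt0 nte; rewrite cuspN opprK.
    move=> k' Hk'; have e20 : 0 < e / 2 by rewrite divr_gt0.
    have e2e : e / 2 < e by rewrite ltr_pdivrMr // ltr_pMr // ltr1n.
    have [_ tr _ _] := MX; apply: tr => //; exists (cusp sg 1 (- (e / 2))); split.
      by have [_] := eP _ e20 e2e; rewrite cuspN.
    by apply: Hk'; exists (- (e / 2)) => //=; rewrite in_itv /= ltrN2 e2e oppr_lt0.
- exists 1; split=> // delta /andP[d0 _]; exact: cusp_two_branches.
- by move=> t /JP t2; exact: cusp_ct.
- exists 1%:M; split; first by apply/unitarymxP; rewrite mul1mx trmx1 map_mx1.
    by rewrite mulmx1 /alpha3 toRK.
  exact: cusp_expansion.
Qed.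

(** Some stratum contains a germ of a half-branch, so the cusp is in its
    closure. The cusp does not belong to it: a stratum of dimension 0 is a
    point, and one of dimension 1 would be a smooth curve through the cusp
    containing the half-branch. *)
Lemma cusp_stratum_frontier : exists i, frontier_pt M i alpha3.
Proof.
have [k nMk] := cusp_germ_stratum MX o2; exists k.
have : \forall t \near (0 : R), 0 < t -> M k (cusp 1 1 t) by exact: nMk.
move=> /nbhs_ballP[e /= e0 eP].
have {}eP t : 0 < t -> t < e -> M k (cusp 1 1 t).
  by move=> t0 te; apply: eP => //; rewrite /ball /= sub0r normrN gtr0_norm.
have cX x : M k x -> X x by have [E _ _ _] := MX; rewrite -E => ?; exists k.
have near_t (B : set 'rV[R]_(3 + 3)) : nbhs (alpha3 : 'rV[R]_(3 + 3)) B ->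
    exists2 t, 0 < t < e & B (cusp 1 1 t).
  rewrite -(cusp_alpha3 1) => B0.
  have H1 : \forall t \near (0 : R)^'+, B (cusp 1 1 t).
    by apply: cvg_within; exact: (cusp_continuous B0).
  have H2 : \forall t \near (0 : R)^'+, 0 < t < e.
    near=> t; apply/andP; split=> //; near: t; exact: nbhs_right_lt.
  have [t [Bt te]] : exists t, B (cusp 1 1 t) /\ 0 < t < e.
    by apply: (@filter_ex _ ((0 : R)^'+)); exact: filterI H1 H2.
  by exists t.
split.
  move=> B /near_t[t /andP[t0 te] Bt].
  by exists (cusp 1 1 t); split=> //; exact: eP.
move=> Ma; have [_ _ _ /(_ k)[d [d1 sM _ [f [[bij _ _] _]] _]]] := MX.
case: d d1 sM f bij => [|[|//]] _ sM f [_ _ surj].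
  have [t1 /andP[t10 t1e] _] := near_t _ filterT.
  have [u _ uE] := surj _ (eP _ t10 t1e); have [v _ vE] := surj _ Ma.
  have uv : u = v by apply/rowP => -[].
  have : cusp 1 1 t1 = cusp 1 1 0 by rewrite cusp_alpha3 -uE -vE uv.
  by move/(cusp_inj o2) => e1; move: t10; rewrite e1 ltxx.
have := pole_not_accumulation o2 (nash_smooth_submanifold sM).
rewrite -alpha3E => /(_ Ma) /near_t[t /andP[t0 te]].
have Mt := eP _ t0 te; move=> /(_ Mt (cX _ Mt)); rewrite -(cusp_alpha3 1).
by move/(cusp_inj o2) => e1; move: t0; rewrite e1 ltxx.
Unshelve. all: by end_near. Qed.

(** The half-curve would consist of points of both the zero set and the
    submanifold accumulating at the cusp. *)
Lemma not_strong_regular i : ~ @strong_regular_wrt R 2 X I M i alpha3.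
Proof.
move=> [e [c [[[e0 cX _ [cc [g [_ gK]]]] [[[_ c0] _ _] _]] [N [[sN _ _] cN]]]]].
have Na : N alpha3.
  by apply: cN; exists 0 => //=; rewrite in_itv /= lexx e0.
have J0 : `]- e, e[%classic (0 : R) by rewrite /= in_itv /= oppr_lt0 e0.
have := pole_not_accumulation o2 sN; rewrite -alpha3E => /(_ Na) nN.
have cc0 : c @ within `]- e, e[%classic (nbhs (0 : R)) --> (alpha3 : 'rV[R]_(3 + 3)).
  by rewrite -c0; exact: (subspace_continuousP _ _).1 cc 0 J0.
have nc := cc0 _ nN.
have : \forall t \near (0 : R), `]- e, e[%classic t -> N (c t) -> X (c t) -> c t = alpha3.
  exact: nc.
move=> /nbhs_ballP[r /= r0 rP].
pose t := Num.min e r / 2.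
have m0 : 0 < Num.min e r by rewrite lt_min e0.
have t0 : 0 < t by rewrite divr_gt0.
have tm : t < Num.min e r by rewrite ltr_pdivrMr // ltr_pMr // ltr1n.
move: (tm); rewrite lt_min => /andP[te tr].
have Jt : `]- e, e[%classic t by rewrite /= in_itv /= te andbT (lt_trans _ t0) // oppr_lt0.
have := rP t; rewrite /ball /= sub0r normrN gtr0_norm // => /(_ tr Jt) H.
have ct : c t = c 0.
  rewrite c0; apply: H; last by apply: cX; exists t.
  by apply: cN; exists t => //=; rewrite in_itv /= te ltW.
have : t = 0 by rewrite -(gK t Jt) ct gK.
by move=> t00; rewrite t00 ltxx in t0.
Qed.

End Regularity.

Theorem mainTheorem3 (R : realType) :
  let X : set 'rV[R]_(3 + 3) := zsphere (@pi_poly R) in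
  [/\ stable (@pi_poly R),
      has_dimR X 1,
      (exists (I : finType) (M : I -> set 'rV[R]_(3 + 3)),
         nash_stratification X M) &
      forall (I : finType) (M : I -> set 'rV[R]_(3 + 3)),
        nash_stratification X M ->
        (exists i, weak_essential_sing_wrt X M i alpha3) /\
        ~ (exists i, essential_sing_wrt X M i alpha3)].
Proof.
split.
- exact: stable_pi.
- exact: zsphere_dim.
- exists (bool * bool)%type, stratum; exact: cusp_stratification.
- move=> I M MX; split.
    have [i fr] := cusp_stratum_frontier MX.
    by exists i; split=> //; exact: not_strong_regular.
  by move=> [i [fr nreg]]; exact: nreg (frontier_regular MX fr).
Qed.
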